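(* Let $\mathcal{R}$ be a predicative recursive TRS. For every relation $[\![f]\!]$ defined by $\mathcal{R}$ ($f$ a defined symbol), the functional problem associated with $[\![f]\!]$ is in $\mathrm{FNP}$. Moreover, if $\mathcal{R}$ is confluent then $[\![f]\!]\in\mathrm{FP}$.
   Context: Signature $\mathcal{F}$ finite, split into defined symbols $\mathcal{D}$ and constructors $\mathcal{C}$; values: variables and terms built from constructors; basic terms $f(v_1,\dots,v_n)$, $f\in\mathcal{D}$, $v_i$ values; constructor TRS: finite, all left-hand sides basic; $\to^i$ is innermost rewriting. A finite set $\mathcal{N}$ of non-accepting patterns is fixed; a value $w$ is accepting if it is no instance $p\sigma$ of a $p\in\mathcal{N}$. For $n$-ary $f\in\mathcal{D}$, $[\![f]\!]$ is the set of tuples $(v_1,\dots,v_n,w)$ of values such that $f(v_1,\dots,v_n)$ innermost-rewrites to the normal form $w$ and $w$ is accepting. The functional problem associated with an $(n+1)$-ary relation $R$: given $\vec v$ return some $w$ with $(\vec v,w)\in R$ if it exists, otherwise ''no'' (terms encoded as words). Safe mapping: safe positions $\mathrm{safe}(f)$, rest normal, constructors all safe; notation $f(s_1..s_k;s_{k+1}..s_{k+l})$. Precedence $\succeq$ ($\succ,\sim$), admissible if $f\sim g$ implies both defined or both constructors. $\approx_s$: equality, or $f\sim g$ same arity with arguments $\approx_s$-related under a permutation preserving safe/normal status. $G_\downarrow=\{g\mid f\succ g, f\in G\}$; $\mathcal{T}(G',\mathcal{V})$; $\mathrm{Fun}(s)$. $>_{sq}$: $s=f(\ldots)>_{sq}t$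 iff (1) $s_i\geqslant_{sq}t$ some $i$, normal if $f\in\mathcal{D}$; or (2) $f\in\mathcal{D}$, $t=g(t_1..t_p)$, $f\succ g$, $s>_{sq}t_j$ all $j$. $>_{pop}$: (1) $s_i\geqslant_{pop}t$ some $i$; (2) $f\in\mathcal{D}$, $t=g(t_1..t_m;t_{m+1}..t_{m+n})$, $f\succ g$, $s>_{sq}t_j$ ($j\leqslant m$), $s>_{pop}t_j$ ($j>m$), at most one safe $t_j\notin\mathcal{T}(\mathrm{Fun}(s)_\downarrow,\mathcal{V})$; (3) $f\in\mathcal{D}$, $f\sim g$, normal arguments strictly decreasing and safe arguments weakly decreasing in the multiset extension of $>_{pop}$ modulo $\approx_s$. (${\geqslant}$ adds $\approx_s$.) $\mathcal{R}$ is predicative recursive if it is a constructor TRS with $l>_{pop}r$ for all rules, for some safe mapping and admissible precedence.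
   Formalization: Admissible precedences must also have no constructor strictly above a defined symbol; otherwise the restriction to one safe argument outside T(Fun(s)↓,V) can be void and the claim fails (NEXP-hard tiling). Terms are encoded as words via their maximally shared graphs. *)

(* Defs.v *)
From HB Require Import structures.
From Stdlib Require Import Relation_Operators.
From mathcomp Require Import all_boot.

Set Implicit Arguments.
Unset Strict Implicit.
Unset Printing Implicit Defensive.

(** * Terms *)

Record signature := Signature {
  symbol : finType;
  arity : symbol -> nat;
  defined : pred symbol  (* the other symbols are the constructors *)
}.

Unset Elimination Schemes.
Inductive term (S : signature) : Type :=
| Var of nat
| App (f : symbol S) of {ffun 'I_(arity f) -> term S}.
Set Elimination Schemes.

Arguments Var {S} _.
Arguments App {S} f _.

Notation args f := {ffun 'I_(arity f) -> term _}.

Lemma term_rect (S : signature) (P : term S -> Type) :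
  (forall x, P (Var x)) ->
  (forall (f : symbol S) (a : args f), (forall i, P (a i)) -> P (App f a)) ->
  forall t, P t.
Proof.
by move=> PV PA; fix IH 1 => -[x|f a]; [apply: PV | apply: PA => i; apply: IH].
Defined.

Definition term_ind (S : signature) (P : term S -> Prop) := @term_rect S P.

Fixpoint term_to_tree {S : signature} (t : term S) :
    GenTree.tree (nat + symbol S) :=
  match t with
  | Var x => GenTree.Leaf (inl x)
  | App f a => GenTree.Node 0 (GenTree.Leaf (inr f) ::
                 [seq term_to_tree (a i) | i <- enum 'I_(arity f)])
  end.

Fixpoint tree_to_term {S : signature} (T : GenTree.tree (nat + symbol S)) :
    term S :=
  match T with
  | GenTree.Leaf (inl x) => Var x
  | GenTree.Node _ (GenTree.Leaf (inr f) :: ts) =>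
      App f [ffun i => nth (Var 0) (map tree_to_term ts) (val i)]
  | _ => Var 0
  end.

Lemma term_to_treeK (S : signature) :
  cancel (@term_to_tree S) (@tree_to_term S).
Proof.
elim=> [x|f a IH] //=; congr App; apply/ffunP => i; rewrite ffunE -map_comp.
by rewrite (nth_map i) ?size_enum_ord //= nth_ord_enum IH.
Qed.

HB.instance Definition _ (S : signature) :=
  Countable.copy (term S) (can_type (@term_to_treeK S)).

Fixpoint subst {S : signature} (sigma : nat -> term S) (t : term S) : term S :=
  match t with
  | Var x => sigma x
  | App f a => App f [ffun i => subst sigma (a i)]
  end.

Fixpoint funs {S : signature} (t : term S) : {set symbol S} :=
  match t with
  | Var _ => set0
  | App f a => f |: \bigcup_i funs (a i)
  end.

Definition value {S : signature} (t : term S) : bool :=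
  funs t \subset [pred f | ~~ defined f].

Definition basic {S : signature} (t : term S) : bool :=
  if t is App f a then defined f && [forall i, value (a i)] else false.

(** * Rewriting *)

Definition trs (S : signature) := seq (term S * term S).

Definition constructor_trs {S : signature} (R : trs S) : Prop :=
  forall l r, (l, r) \in R -> basic l.

Inductive rstep {S : signature} (R : trs S) : term S -> term S -> Prop :=
| rstep_root l r sigma :
    (l, r) \in R -> rstep R (subst sigma l) (subst sigma r)
| rstep_arg f (a b : args f) i :
    rstep R (a i) (b i) -> (forall j, j != i -> a j = b j) ->
    rstep R (App f a) (App f b).

Definition normal_form {S : signature} (R : trs S) (t : term S) : Prop :=
  forall u, ~ rstep R t u.

Inductive istep {S : signature} (R : trs S) : term S -> term S -> Prop :=
| istep_root l r sigma f (a : args f) :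
    (l, r) \in R -> subst sigma l = App f a ->
    (forall i, normal_form R (a i)) ->
    istep R (App f a) (subst sigma r)
| istep_arg f (a b : args f) i :
    istep R (a i) (b i) -> (forall j, j != i -> a j = b j) ->
    istep R (App f a) (App f b).

Definition confluent {S : signature} (R : trs S) : Prop :=
  forall s t u,
    clos_refl_trans _ (rstep R) s t -> clos_refl_trans _ (rstep R) s u ->
    exists2 v, clos_refl_trans _ (rstep R) t v
             & clos_refl_trans _ (rstep R) u v.

Definition accepting {S : signature} (N : seq (term S)) (w : term S) : Prop :=
  forall p sigma, p \in N -> w <> subst sigma p.

(* The relation [[f]] defined by R. *)
Definition sem {S : signature} (N : seq (term S)) (R : trs S) (f : symbol S)
    (v : args f) (w : term S) : Prop :=
  [/\ forall i, value (v i),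
      value w,
      clos_refl_trans _ (istep R) (App f v) w,
      normal_form R w
    & accepting N w].

(** * The polynomial path order *)

Definition safe_map (S : signature) := forall f : symbol S, {set 'I_(arity f)}.

Definition safe_mapping {S : signature} (sf : safe_map S) : Prop :=
  forall f, ~~ defined f -> sf f = setT.

Definition precedence {S : signature} (ge : rel (symbol S)) : Prop :=
  reflexive ge /\ transitive ge.

Definition prec_gt {S : signature} (ge : rel (symbol S)) : rel (symbol S) :=
  fun f g => ge f g && ~~ ge g f.
Definition prec_eq {S : signature} (ge : rel (symbol S)) : rel (symbol S) :=
  fun f g => ge f g && ge g f.

(* The second clause forbids a constructor above a defined symbol.  Without
   it the restriction on safe arguments in [pop_gt] below could be void: a
   constructor c of the left-hand side f(c(..)..) with c above f would put f
   itself into [down ge (funs s)]. *)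
Definition admissible {S : signature} (ge : rel (symbol S)) : Prop :=
  (forall f g, prec_eq ge f g -> defined f = defined g) /\
  (forall f g, ~~ defined f -> defined g -> ~~ prec_gt ge f g).

Inductive eqs {S : signature} (sf : safe_map S) (ge : rel (symbol S)) :
    term S -> term S -> Prop :=
| eqs_refl t : eqs sf ge t t
| eqs_app f g (a : args f) (b : args g) (pi : 'I_(arity f) -> 'I_(arity g)) :
    prec_eq ge f g -> bijective pi ->
    (forall i, (pi i \in sf g) = (i \in sf f)) ->
    (forall i, eqs sf ge (a i) (b (pi i))) ->
    eqs sf ge (App f a) (App g b).

Definition down {S : signature} (ge : rel (symbol S)) (G : {set symbol S}) :
    {set symbol S} :=
  [set g | [exists f in G, prec_gt ge f g]].

Inductive sq {S : signature} (sf : safe_map S) (ge : rel (symbol S)) :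
    term S -> term S -> Prop :=
| sq_sub f (a : args f) i t :
    (defined f -> i \notin sf f) ->
    sq sf ge (a i) t \/ eqs sf ge (a i) t ->
    sq sf ge (App f a) t
| sq_gt f (a : args f) g (b : args g) :
    defined f -> prec_gt ge f g ->
    (forall j, sq sf ge (App f a) (b j)) ->
    sq sf ge (App f a) (App g b).

(* Multiset extensions of the strict order gt modulo the equivalence eq, on
   multisets given as sequences: parts Z and Z' are matched up to eq, every
   element of Y is dominated by one of X. *)
Definition mul_ge {T : eqType} (gt eq : T -> T -> Prop) (M M' : seq T) : Prop :=
  exists X Y : seq T, exists ZZ' : seq (T * T),
    [/\ perm_eq M (X ++ unzip1 ZZ'), perm_eq M' (Y ++ unzip2 ZZ'),
        forall z, z \in ZZ' -> eq z.1 z.2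
      & forall y, y \in Y -> exists x, x \in X /\ gt x y].

Definition mul_gt {T : eqType} (gt eq : T -> T -> Prop) (M M' : seq T) : Prop :=
  exists X Y : seq T, exists ZZ' : seq (T * T),
    [/\ X != [::],
        perm_eq M (X ++ unzip1 ZZ'), perm_eq M' (Y ++ unzip2 ZZ'),
        forall z, z \in ZZ' -> eq z.1 z.2
      & forall y, y \in Y -> exists x, x \in X /\ gt x y].

Definition safe_args {S : signature} (sf : safe_map S) (f : symbol S)
  (a : args f) : seq (term S) := [seq a i | i <- enum (sf f)].
Definition normal_args {S : signature} (sf : safe_map S) (f : symbol S)
  (a : args f) : seq (term S) := [seq a i | i <- enum (~: sf f)].

Inductive pop {S : signature} (sf : safe_map S) (ge : rel (symbol S)) :
    term S -> term S -> Prop :=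
| pop_sub f (a : args f) i t :
    pop sf ge (a i) t \/ eqs sf ge (a i) t ->
    pop sf ge (App f a) t
| pop_gt f (a : args f) g (b : args g) :
    defined f -> prec_gt ge f g ->
    (forall j, j \notin sf g -> sq sf ge (App f a) (b j)) ->
    (forall j, j \in sf g -> pop sf ge (App f a) (b j)) ->
    (forall j k, j \in sf g -> k \in sf g ->
       ~~ (funs (b j) \subset down ge (funs (App f a))) ->
       ~~ (funs (b k) \subset down ge (funs (App f a))) -> j = k) ->
    pop sf ge (App f a) (App g b)
| pop_eq f (a : args f) g (b : args g) :
    defined f -> prec_eq ge f g ->
    mul_gt (pop sf ge) (eqs sf ge) (normal_args sf a) (normal_args sf b) ->
    mul_ge (pop sf ge) (eqs sf ge) (safe_args sf a) (safe_args sf b) ->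
    pop sf ge (App f a) (App g b).

Definition predicative_recursive {S : signature} (R : trs S) : Prop :=
  constructor_trs R /\
  exists (sf : safe_map S) (ge : rel (symbol S)),
    [/\ safe_mapping sf, precedence ge, admissible ge
      & forall l r, (l, r) \in R -> pop sf ge l r].

(** * Turing machines and the classes FNP and FP *)

(* Nondeterministic machines with (ntape M).+1 two-way infinite tapes over the
   input alphabet Sigma, finitely many work symbols and the blank None.  In an
   action, each tape gets a symbol to write and a head move: None = stay,
   Some false = left, Some true = right. *)
Record machine (Sigma : finType) := Machine {
  ntape : nat;
  work : finType;
  state : finType;
  start : state;
  accept : state;
  delta : state -> {ffun 'I_ntape.+1 -> option (Sigma + work)} ->
    {set state *
         {ffun 'I_ntape.+1 -> option (Sigma + work) * option bool}}
}.

Arguments start {Sigma} _.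
Arguments accept {Sigma} _.
Arguments delta {Sigma} _ _ _.

(* The cells left of the head (nearest first), the scanned cell, the cells
   right of the head; all cells not listed are blank. *)
Record tape (A : Type) := Tape {
  lcells : seq (option A);
  scanned : option A;
  rcells : seq (option A)
}.

Definition tape_act {A : Type} (wm : option A * option bool) (t : tape A) :
    tape A :=
  let: (w, m) := wm in
  match m with
  | None => Tape (lcells t) w (rcells t)
  | Some false =>
      Tape (behead (lcells t)) (head None (lcells t)) (w :: rcells t)
  | Some true =>
      Tape (w :: lcells t) (head None (rcells t)) (behead (rcells t))
  end.

Definition word_cells {Sigma W : Type} (x : seq Sigma) :
  seq (option (Sigma + W)) := [seq Some (inl a) | a <- x].

Definition word_tape {Sigma W : Type} (x : seq Sigma) : tape (Sigma + W) :=
  Tape [::] (head None (word_cells x)) (behead (word_cells x)).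

(* t contains exactly the word y, its head being on the first letter. *)
Definition tape_holds {Sigma W : Type} (t : tape (Sigma + W)) (y : seq Sigma) :
    Prop :=
  exists m n, lcells t = nseq m None /\
              scanned t :: rcells t = word_cells y ++ nseq n None.

Definition config (Sigma : finType) (M : machine Sigma) : Type :=
  (state M * {ffun 'I_(ntape M).+1 -> tape (Sigma + work M)})%type.

Definition init (Sigma : finType) (M : machine Sigma) (x : seq Sigma) :
    config M :=
  (start M, [ffun i => if i == ord0 then word_tape x else word_tape [::]]).

Definition actions (Sigma : finType) (M : machine Sigma) (c : config M) :=
  delta M c.1 [ffun i => scanned (c.2 i)].

Definition mstep (Sigma : finType) (M : machine Sigma) (c c' : config M) :
    Prop :=
  exists2 act, act \in actions c
             & c' = (act.1, [ffun i => tape_act (act.2 i) (c.2 i)]).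

Inductive msteps (Sigma : finType) (M : machine Sigma) :
    nat -> config M -> config M -> Prop :=
| msteps0 c : msteps 0 c c
| mstepsS n c c' c'' : mstep c c' -> msteps n c' c'' -> msteps n.+1 c c''.

Definition accepts_with (Sigma : finType) (M : machine Sigma) (x : seq Sigma)
    (c : config M) : Prop :=
  [/\ exists n, msteps n (init M x) c, actions c = set0 & c.1 = accept M].

Definition polytime (Sigma : finType) (M : machine Sigma) : Prop :=
  exists k d, forall x n (c : config M),
    msteps n (init M x) c -> n <= k * size x ^ d + k.

Definition deterministic (Sigma : finType) (M : machine Sigma) : Prop :=
  forall q a, #|delta M q a| <= 1.

(* M solves the functional problem associated with P.  A halting computation
   which is not accepting is the answer "no"; an accepting one answers with the
   word on the last tape, which has to be a solution.  If there is a solution,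
   then some computation is accepting. *)
Definition solves (Sigma : finType) (M : machine Sigma)
    (P : seq Sigma -> seq Sigma -> Prop) : Prop :=
  forall x,
    (forall c : config M, accepts_with x c ->
       exists2 y, tape_holds (c.2 ord_max) y & P x y) /\
    ((exists y, P x y) -> exists c : config M, accepts_with x c).

Definition FNP (Sigma : finType) (P : seq Sigma -> seq Sigma -> Prop) : Prop :=
  exists M : machine Sigma, polytime M /\ solves M P.

Definition FP (Sigma : finType) (P : seq Sigma -> seq Sigma -> Prop) : Prop :=
  (forall x y y', P x y -> P x y' -> y = y') /\
  exists M : machine Sigma, [/\ deterministic M, polytime M & solves M P].

(** * Terms as words *)

(* Values computed by a predicative recursive TRS can be exponentially larger
   than the input as trees, e.g. with the rules f(0;y) -> y,
   f(s(;x);y) -> g(;f(x;y)), g(;y) -> c(;y,y).  So a term is written down as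
   its maximally shared graph: the list of its distinct subterms, root first,
   each one given by its symbol and the positions in the list of its
   arguments. *)

Definition letter (S : signature) : finType := (symbol S + (bool + 'I_3))%type.
Definition lsym {S : signature} (f : symbol S) : letter S := inl f.
Definition lbit {S : signature} (b : bool) : letter S := inr (inl b).
Definition lvar {S : signature} : letter S := inr (inr (inord 0)).
Definition larg {S : signature} : letter S := inr (inr (inord 1)).
Definition lend {S : signature} : letter S := inr (inr (inord 2)).

Fixpoint pos_bits (p : BinNums.positive) : seq bool :=
  match p with
  | BinNums.xH => [:: true]
  | BinNums.xO p' => false :: pos_bits p'
  | BinNums.xI p' => true :: pos_bits p'
  end.

(* Least significant bit first; 0 is the empty word. *)
Definition nat_word {S : signature} (n : nat) : seq (letter S) :=
  if bin_of_nat n is BinNums.Npos p then map lbit (pos_bits p) else [::].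

(* Preorder. *)
Fixpoint subterms {S : signature} (t : term S) : seq (term S) :=
  t :: match t with
       | Var _ => [::]
       | App f a => flatten [seq subterms (a i) | i <- enum 'I_(arity f)]
       end.

(* undup keeps the last occurrences, so that t is still the first element. *)
Definition nodes {S : signature} (t : term S) : seq (term S) :=
  undup (subterms t).

Definition node_word {S : signature} (ns : seq (term S)) (u : term S) :
    seq (letter S) :=
  match u with
  | Var x => lvar :: nat_word x
  | App f a =>
      lsym f :: flatten [seq larg :: nat_word (index (a i) ns)
                        | i <- enum 'I_(arity f)]
  end.

Definition term_word {S : signature} (t : term S) : seq (letter S) :=
  flatten [seq node_word (nodes t) u | u <- nodes t].

Definition args_word {S : signature} (f : symbol S) (v : args f) :
    seq (letter S) :=
  flatten [seq rcons (term_word (v i)) lend | i <- enum 'I_(arity f)].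

Definition word_relation {S : signature} (f : symbol S)
    (P : args f -> term S -> Prop) (x y : seq (letter S)) : Prop :=
  exists (v : args f) (w : term S),
    [/\ x = args_word v, y = term_word w & P v w].

(* Main.v *)
From HB Require Import structures.
From Stdlib Require Import Relation_Operators Eqdep_dec.
Require Import Defs.
From mathcomp Require Import all_boot zify.

Set Implicit Arguments.
Unset Strict Implicit.
Unset Printing Implicit Defensive.

(** Let [f(v)] be a call with arguments of depth at most [D].  By induction on
    the rank of [f] in the precedence, its innermost evaluation takes a number
    of steps polynomial in [D], and the depth of its result exceeds the depth
    of the safe arguments by at most a polynomial in the depth of the normal
    ones.  Indeed a rule has at most one nested recursive call on its
    right-hand side, and along these calls the multiset of depths of the normal
    arguments decreases; read as a number with digits in base [D + 2], this
    multiset bounds the length of the recursion by a polynomial in [D].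

    Results may have exponential size as trees, so a stack machine evaluating
    innermost is run on hash-consed heaps, where equal terms have equal
    addresses; every node carries the list of the nodes below it, from which
    the encoding as a maximally shared graph can be written down.  One step adds
    a bounded number of nodes, so that all runs are polynomial.

    A Turing machine guesses the rule to be tried first at each redex; this
    finds every result.  Trying the rules always in the order of [R] is
    deterministic, terminates, and by confluence gives the only normal form. *)

(** Depth is the right measure: on values [pop] and [sq] make it decrease, and a term stored in n
    shared nodes has depth at most n, so a polynomial in the depth is one in the length of the
    input. The obstacle is that an unfolding must not multiply costs. Safe depths therefore enter
    the depth bound of a result only as a summand and the number of steps not at all, and the
    recursive call in a right-hand side is paid once. A recursion of length n then costs about n
    times one unfolding. Membership in FNP also limits the computations that fail, so the step bound
    is proved for all runs of a machine that may even give up on a redex. The lists of rules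
    actually used all contain [R]; with them a term is left standing only if it is a normal form, so
    no wrong answer arises. Machines are not given by tables: a small structured language is
    compiled to them, and a calculus of polynomial-time functions on binary trees supplies its
    programs. Every fold there needs an explicit bound on its intermediate results, because
    iterating a polynomial-time step can produce exponential sizes. *)

(** * A structured language compiled to Turing machines *)

Section Language.

Variables (Sigma : finType) (n : nat).

Notation sym := (option (Sigma + bool)).
Notation tapes := {ffun 'I_n.+1 -> tape (Sigma + bool)}.
Notation action := {ffun 'I_n.+1 -> sym * option bool}.

(** [Halt] has no move at all: a run that gets there stops at a control point other than the exit,
    which is the answer no. *)
Inductive cmd :=
| Act (i : 'I_n.+1) (g : sym -> sym * option bool)
| Halt
| Seq (a b : cmd)
| If (i : 'I_n.+1) (g : pred sym) (a b : cmd)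
| While (i : 'I_n.+1) (g : pred sym) (a : cmd)
| Choose (a b : cmd).

Fixpoint nochoice (c : cmd) : bool :=
  match c with
  | Act _ _ | Halt => true
  | Seq a b | If _ _ a b => nochoice a && nochoice b
  | While _ _ a => nochoice a
  | Choose _ _ => false
  end.

(* The control points of a command; [None : option (pos c)] is its exit. *)
Fixpoint pos (c : cmd) : finType :=
  match c with
  | Act _ _ | Halt => unit
  | Seq a b => (pos a + pos b)%type
  | If _ _ a b | Choose a b => option (pos a + pos b)
  | While _ _ a => option (pos a)
  end.

Fixpoint entry (c : cmd) : pos c :=
  match c with
  | Act _ _ | Halt => tt
  | Seq a b => inl (entry a)
  | If _ _ _ _ | Choose _ _ => None
  | While _ _ _ => None
  end.

Definition nop (s : 'I_n.+1 -> sym) : action := [ffun i => (s i, None)].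

Definition relabel (P Q : Type) (h : P -> Q) (x : P * action) := (h x.1, x.2).

Fixpoint moves (c : cmd) :
    pos c -> ('I_n.+1 -> sym) -> seq (option (pos c) * action) :=
  match c with
  | Act i g => fun _ s =>
      [:: (None, [ffun j => if j == i then g (s i) else (s j, None)])]
  | Halt => fun _ _ => [::]
  | Seq a b => fun p s =>
      match p with
      | inl q => map (relabel (fun r => Some (if r is Some r' then inl r'
                                              else inr (entry b))))
                     (moves q s)
      | inr q => map (relabel (omap inr)) (moves q s)
      end
  | If i g a b => fun p s =>
      match p with
      | None => [:: (Some (Some (if g (s i) then inl (entry a)
                                 else inr (entry b))), nop s)]
      | Some (inl q) => map (relabel (omap (fun r => Some (inl r)))) (moves q s)
      | Some (inr q) => map (relabel (omap (fun r => Some (inr r)))) (moves q s)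
      end
  | While i g a => fun p s =>
      match p with
      | None => [:: (if g (s i) then Some (Some (entry a)) else None, nop s)]
      | Some q => map (relabel (@Some _)) (moves q s)
      end
  | Choose a b => fun p s =>
      match p with
      | None => [:: (Some (Some (inl (entry a))), nop s);
                    (Some (Some (inr (entry b))), nop s)]
      | Some (inl q) => map (relabel (omap (fun r => Some (inl r)))) (moves q s)
      | Some (inr q) => map (relabel (omap (fun r => Some (inr r)))) (moves q s)
      end
  end.

Definition act_on (x : action) (ts : tapes) : tapes :=
  [ffun i => tape_act (x i) (ts i)].

Definition scan (ts : tapes) : {ffun 'I_n.+1 -> sym} :=
  [ffun i => scanned (ts i)].

(* All runs (md = true), or some run (md = false), from control point p leave
   c within k steps, in a state satisfying Q, or halt inside c. *)
Fixpoint wp (md : bool) (c : cmd) (k : nat) (p : option (pos c)) (ts : tapes)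
    (Q : tapes -> Prop) : Prop :=
  match p, k with
  | None, _ => Q ts
  | Some _, 0 => False
  | Some q, k'.+1 =>
      let ms := moves q (scan ts) in
      if md then forall x, x \in ms -> wp md k' x.1 (act_on x.2 ts) Q
      else exists2 x, x \in ms & wp md k' x.1 (act_on x.2 ts) Q
  end.

Definition wpc md c k ts Q := @wp md c k (Some (entry c)) ts Q.

Lemma wp_mono md c k k' p ts (Q Q' : tapes -> Prop) :
  @wp md c k p ts Q -> k <= k' -> (forall ts', Q ts' -> Q' ts') ->
  @wp md c k' p ts Q'.
Proof.
move=> H le QQ'; elim: k k' p ts H le => [|k IH] [|k'] [p|] ts //=; try by auto.
case: md IH => IH H le; first by move=> x /H /IH; apply.
by case: H => x xin /IH H; exists x; auto.
Qed.

(** Compiling a compound command embeds the control points of [a] by [h] without changing their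
    moves, so a run inside [a] is also a run of [c], which goes on at [h None] when [a] is left. *)
Lemma wp_lift md a c (h : option (pos a) -> option (pos c))
    (hP : forall p s, exists2 q, h (Some p) = Some q &
                               moves q s = map (relabel h) (moves p s))
    k k' p ts Q :
  wp md k p ts (fun ts' => wp md k' (h None) ts' Q) ->
  wp md (k + k') (h p) ts Q.
Proof.
elim: k p ts => [|k IH] [p|] ts //=.
- have [q -> /= mq] := hP p (scan ts); case: md IH => IH H.
  + by move=> x; rewrite mq => /mapP[y /H yin ->]; apply: IH.
  + case: H => x xin H; exists (relabel h x); last by apply: IH.
    by rewrite mq; apply: map_f.
- move=> H; refine (@wp_mono md c k' (k.+1 + k') (h None) ts Q Q H _ _) => //; lia.
Qed.

Lemma act_on_nop ts : act_on (nop (scan ts)) ts = ts.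
Proof. by apply/ffunP => i; rewrite !ffunE /=; case: (ts i). Qed.

Lemma wp_act md i g (ts : tapes) (Q : tapes -> Prop) :
  Q [ffun j => if j == i then tape_act (g (scanned (ts i))) (ts i) else ts j] ->
  wpc md (Act i g) 1 ts Q.
Proof.
set ts' := (X in Q X) => H.
have E : act_on [ffun j => if j == i then g (scan ts i) else (scan ts j, None)] ts
         = ts'.
  apply/ffunP => j; rewrite !ffunE; case: eqP => [->|] //=.
  by case: (ts j).
case: md => /=; first by move=> x; rewrite inE => /eqP-> /=; rewrite E.
by eexists; rewrite ?inE; first apply/eqP; first reflexivity; rewrite E.
Qed.

Lemma wp_seq md a b k k' ts Q :
  wpc md a k ts (fun ts' => wpc md b k' ts' Q) -> wpc md (Seq a b) (k + k') ts Q.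
Proof.
move=> H; pose h (r : option (pos a)) : option (pos (Seq a b)) :=
  Some (if r is Some r' then inl r' else inr (entry b)).
apply: (@wp_lift md a (Seq a b) h _ k k' (Some (entry a))).
  by move=> p s; exists (inl p).
apply: (wp_mono H) => // ts' H'; rewrite -[k']addn0.
apply: (@wp_lift md b (Seq a b) (omap inr) _ k' 0 (Some (entry b))).
  by move=> p s; exists (inr p).
exact: wp_mono H' _ _.
Qed.

Lemma wp_nop_move md c p ts k Q :
  moves (entry c) (scan ts) = [:: (p, nop (scan ts))] -> wp md k p ts Q ->
  wpc md c k.+1 ts Q.
Proof.
rewrite /wpc /= => -> H; case: md H => H; last by exists (p, nop (scan ts));
  rewrite ?inE // act_on_nop.
by move=> x; rewrite inE => /eqP-> /=; rewrite act_on_nop.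
Qed.

Lemma wp_if md i (g : pred sym) a b k (ts : tapes) Q :
  (if g (scanned (ts i)) then wpc md a k ts Q else wpc md b k ts Q) ->
  wpc md (If i g a b) k.+1 ts Q.
Proof.
move=> H; apply: wp_nop_move => //=; rewrite ffunE; case: ifP H => _ H; rewrite -[k]addn0.
  apply: (@wp_lift md a (If i g a b) (omap (fun r => Some (inl r))) _ k 0
          (Some (entry a))); last exact: wp_mono H _ _.
  by move=> p s; exists (Some (inl p)).
apply: (@wp_lift md b (If i g a b) (omap (fun r => Some (inr r))) _ k 0
        (Some (entry b))); last exact: wp_mono H _ _.
by move=> p s; exists (Some (inr p)).
Qed.

Lemma wp_while_false md i (g : pred sym) a k (ts : tapes) (Q : tapes -> Prop) :
  ~~ g (scanned (ts i)) -> Q ts -> wpc md (While i g a) k.+1 ts Q.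
Proof.
by move=> /negbTE Hg H; apply: wp_nop_move => //=; rewrite ffunE Hg; case: k.
Qed.

Lemma wp_while_true md i (g : pred sym) a k k' (ts : tapes) Q :
  g (scanned (ts i)) ->
  wpc md a k ts (fun ts' => wpc md (While i g a) k' ts' Q) ->
  wpc md (While i g a) (k + k').+1 ts Q.
Proof.
move=> Hg H; apply: wp_nop_move => //=; rewrite ffunE Hg.
apply: (@wp_lift md a (While i g a) (@Some _) _ k k' (Some (entry a))) => //.
by move=> p s; exists (Some p).
Qed.

Lemma wp_choose_all a b k ts Q :
  wpc true a k ts Q -> wpc true b k ts Q -> wpc true (Choose a b) k.+1 ts Q.
Proof.
move=> Ha Hb; rewrite /wpc /= => x; rewrite !inE => /orP[]/eqP-> /=; rewrite act_on_nop -[k]addn0.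
  apply: (@wp_lift true a (Choose a b) (omap (fun r => Some (inl r))) _ k 0
          (Some (entry a))); last exact: wp_mono Ha _ _.
  by move=> p s; exists (Some (inl p)).
apply: (@wp_lift true b (Choose a b) (omap (fun r => Some (inr r))) _ k 0
        (Some (entry b))); last exact: wp_mono Hb _ _.
by move=> p s; exists (Some (inr p)).
Qed.

Lemma wp_choose_some a b k ts Q :
  wpc false a k ts Q \/ wpc false b k ts Q -> wpc false (Choose a b) k.+1 ts Q.
Proof.
case=> H; [exists (Some (Some (inl (entry a))), nop (scan ts))
          |exists (Some (Some (inr (entry b))), nop (scan ts))];
  rewrite /= ?inE ?eqxx ?orbT // act_on_nop -[k]addn0.
  apply: (@wp_lift false a (Choose a b) (omap (fun r => Some (inl r))) _ k 0
          (Some (entry a))); last exact: wp_mono H _ _.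
  by move=> p s; exists (Some (inl p)).
apply: (@wp_lift false b (Choose a b) (omap (fun r => Some (inr r))) _ k 0
        (Some (entry b))); last exact: wp_mono H _ _.
by move=> p s; exists (Some (inr p)).
Qed.

Lemma wp_halt ts Q : wpc true Halt 1 ts Q.
Proof. by []. Qed.

Definition cmd_machine (c : cmd) : machine Sigma :=
  @Machine Sigma n bool (option (pos c)) (Some (entry c)) None
    (fun p s => if p is Some q then [set:: moves q s] else set0).

Lemma size_moves c p s : nochoice c -> size (@moves c p s) <= 1.
Proof.
elim: c p s => [i g|| a IHa b IHb|i g a IHa b IHb|i g a IHa|a IHa b IHb] //= p s.
- by case/andP => na nb; case: p => p; rewrite size_map ?IHa ?IHb.
- by case/andP => na nb; case: p => [[] p|] //; rewrite size_map ?IHa ?IHb.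
- by move=> na; case: p => [p|] //; rewrite size_map IHa.
Qed.

Lemma cmd_machine_deterministic c : nochoice c -> deterministic (cmd_machine c).
Proof.
move=> nc [p|] a /=; last by rewrite cards0.
rewrite cardsE; apply: leq_trans (size_moves p a nc); exact: card_size.
Qed.

(** The fuel [k] bounds all computations, which gives [polytime]; the postcondition at the exit
    gives the soundness half of [solves]. *)
Lemma wp_all_steps c k p ts Q m (d : config (cmd_machine c)) :
  wp true k p ts Q -> msteps m ((p, ts) : config (cmd_machine c)) d ->
  m <= k /\ (d.1 = None -> Q d.2).
Proof.
move=> H st; move: {-2}(p, ts) (erefl (p, ts)) st => cf E st.
elim: st k p ts H E => [d0|m' d0 d1 d2 [x xin ->] _ IH] k p ts.
  by move=> H ->; split=> // /= E; move: H; rewrite E; case: k.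
move=> H E; move: xin; rewrite E /actions /=.
case: p H E => [p|] H E; rewrite ?inE //.
case: k H => // k /= H /H {}H; rewrite E /= in IH.
by have [le q] := IH _ _ _ H (erefl _); split.
Qed.

Lemma wp_some_steps c k p ts Q :
  wp false k p ts Q ->
  exists m ts', msteps m ((p, ts) : config (cmd_machine c))
                         ((None, ts') : config (cmd_machine c)) /\ Q ts'.
Proof.
elim: k p ts => [|k IH] [p|] ts //=; try by move=> H; exists 0, ts; split => //; apply: msteps0.
case=> x xin /IH[m [ts' [st q]]]; exists m.+1, ts'; split => //.
apply: mstepsS st; exists x => //; by rewrite /actions /= inE.
Qed.

End Language.

(** * Stacks of binary trees on tapes *)

Inductive btree := Lf | Nd (a b : btree).

(** Preorder with one bit per node. This code is prefix-free, so trees can be stacked on a tape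
    without separators. *)
Fixpoint code (t : btree) : seq bool :=
  if t is Nd a b then true :: code a ++ code b else [:: false].

Definition csize t := size (code t).

Lemma csize_gt0 t : 0 < csize t.
Proof. by case: t. Qed.

Lemma csize_Nd a b : csize (Nd a b) = (csize a + csize b).+1.
Proof. by rewrite /csize /= size_cat. Qed.

Section StackTapes.

Variable Sigma : finType.

Notation sym := (option (Sigma + bool)).
Notation tp := (tape (Sigma + bool)).
Notation tapes := {ffun 'I_6 -> tape (Sigma + bool)}.
Notation cmd := (cmd Sigma 5).

Definition itape : 'I_6 := @Ordinal 6 0 isT.
Definition mtape : 'I_6 := @Ordinal 6 1 isT.
Definition atape : 'I_6 := @Ordinal 6 2 isT.
Definition btape : 'I_6 := @Ordinal 6 3 isT.
Definition ctape : 'I_6 := @Ordinal 6 4 isT.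
Definition otape : 'I_6 := @Ordinal 6 5 isT.

(** The top is the scanned cell and the stack extends to the left. Nothing is required of the cells
    on the right, since a push overwrites the cell it moves to. *)
Definition stk (t : tp) (s : seq bool) : Prop :=
  exists m, scanned t :: lcells t = [seq Some (inr b) | b <- s] ++ nseq m None.

Lemma stk_nil_scan t : stk t [::] -> scanned t = None.
Proof. by case=> -[|m] //= [-> _]. Qed.

Lemma stk_cons_scan t b s : stk t (b :: s) -> scanned t = Some (inr b).
Proof. by case=> m /= [-> _]. Qed.

Lemma stk_pop t b s : stk t (b :: s) -> stk (tape_act (None, Some false) t) s.
Proof.
case=> m /= [_ E]; rewrite /stk /= E.
case: s E => [|x s] E /=; last by exists m.
by case: m E => [|m] E; [exists 1 | exists m.+1].
Qed.

Lemma stk_push t b s : stk t s ->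
  stk (tape_act (Some (inr b), None) (tape_act (scanned t, Some true) t)) (b :: s).
Proof. by case=> m E; exists m; rewrite /= E. Qed.

Record rep (ts : tapes) (ti to : tp) (m a b c : seq bool) : Prop := Rep {
  rep_i : ts itape = ti; rep_o : ts otape = to;
  rep_m : stk (ts mtape) m; rep_a : stk (ts atape) a;
  rep_b : stk (ts btape) b; rep_c : stk (ts ctape) c }.

Definition pop_cell (i : 'I_6) : cmd := Act i (fun _ => (None, Some false)).
Definition push_cell (i : 'I_6) (b : bool) : cmd :=
  Seq (Act i (fun s => (s, Some true))) (Act i (fun _ => (Some (inr b), None))).

Definition is_top (b : bool) (s : sym) : bool :=
  if s is Some (inr b') then b' == b else false.
Definition nonblank (s : sym) : bool := isSome s.

Lemma wp_push md i b (ts : tapes) (Q : tapes -> Prop) :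
  Q [ffun j => if j == i then
       tape_act (Some (inr b), None) (tape_act (scanned (ts i), Some true) (ts i))
       else ts j] ->
  wpc md (push_cell i b) 2 ts Q.
Proof.
set g := (X in Q X -> _) => H.
apply: (@wp_seq _ _ _ _ _ 1 1); apply: wp_act; apply: wp_act.
set f := (X in Q X); suff -> : f = g by [].
by apply/ffunP => j; rewrite !ffunE eqxx; case: ifP => // ->.
Qed.

Ltac rep_upd R := split; rewrite ffunE /=;
  first [ exact: (rep_i R) | exact: (rep_o R) | exact: (rep_m R) | exact: (rep_a R)
        | exact: (rep_b R) | exact: (rep_c R)
        | exact: stk_push (rep_m R) | exact: stk_push (rep_a R)
        | exact: stk_push (rep_b R) | exact: stk_push (rep_c R)
        | exact: stk_pop (rep_m R) | exact: stk_pop (rep_a R)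
        | exact: stk_pop (rep_b R) | exact: stk_pop (rep_c R) ].

Lemma wp_push_m md x (ts : tapes) ti to m a b c (Q : tapes -> Prop) :
  rep ts ti to m a b c ->
  (forall ts', rep ts' ti to (x :: m) a b c -> Q ts') -> wpc md (push_cell mtape x) 2 ts Q.
Proof. by move=> R H; apply: wp_push; apply: H; rep_upd R. Qed.

Lemma wp_push_a md x (ts : tapes) ti to m a b c (Q : tapes -> Prop) :
  rep ts ti to m a b c ->
  (forall ts', rep ts' ti to m (x :: a) b c -> Q ts') -> wpc md (push_cell atape x) 2 ts Q.
Proof. by move=> R H; apply: wp_push; apply: H; rep_upd R. Qed.

Lemma wp_push_b md x (ts : tapes) ti to m a b c (Q : tapes -> Prop) :
  rep ts ti to m a b c ->
  (forall ts', rep ts' ti to m a (x :: b) c -> Q ts') -> wpc md (push_cell btape x) 2 ts Q.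
Proof. by move=> R H; apply: wp_push; apply: H; rep_upd R. Qed.

Lemma wp_push_c md x (ts : tapes) ti to m a b c (Q : tapes -> Prop) :
  rep ts ti to m a b c ->
  (forall ts', rep ts' ti to m a b (x :: c) -> Q ts') -> wpc md (push_cell ctape x) 2 ts Q.
Proof. by move=> R H; apply: wp_push; apply: H; rep_upd R. Qed.

Lemma wp_pop_m md x (ts : tapes) ti to m a b c (Q : tapes -> Prop) :
  rep ts ti to (x :: m) a b c ->
  (forall ts', rep ts' ti to m a b c -> Q ts') -> wpc md (pop_cell mtape) 1 ts Q.
Proof. by move=> R H; apply: wp_act; apply: H; rep_upd R. Qed.

Lemma wp_pop_a md x (ts : tapes) ti to m a b c (Q : tapes -> Prop) :
  rep ts ti to m (x :: a) b c ->
  (forall ts', rep ts' ti to m a b c -> Q ts') -> wpc md (pop_cell atape) 1 ts Q.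
Proof. by move=> R H; apply: wp_act; apply: H; rep_upd R. Qed.

Lemma wp_pop_b md x (ts : tapes) ti to m a b c (Q : tapes -> Prop) :
  rep ts ti to m a (x :: b) c ->
  (forall ts', rep ts' ti to m a b c -> Q ts') -> wpc md (pop_cell btape) 1 ts Q.
Proof. by move=> R H; apply: wp_act; apply: H; rep_upd R. Qed.

Lemma wp_pop_c md x (ts : tapes) ti to m a b c (Q : tapes -> Prop) :
  rep ts ti to m a b (x :: c) ->
  (forall ts', rep ts' ti to m a b c -> Q ts') -> wpc md (pop_cell ctape) 1 ts Q.
Proof. by move=> R H; apply: wp_act; apply: H; rep_upd R. Qed.

Definition skip : cmd := Act mtape (fun s => (s, None)).

Lemma wp_skip md (ts : tapes) (Q : tapes -> Prop) : Q ts -> wpc md skip 1 ts Q.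
Proof.
move=> H; apply: wp_act; set f := (X in Q X); suff -> : f = ts by [].
by apply/ffunP => j; rewrite ffunE; case: eqP => // ->; case: (ts mtape).
Qed.

Definition push_if (f : bool) i x : cmd := if f then push_cell i x else skip.

(* [take_tree fa fb] removes the topmost tree from the main stack; its code is pushed
   letter by letter onto the scratch stacks selected by fa and fb.  The stack
   ctape counts the subtrees that are still to be read. *)
Definition take_letter fa fb x : cmd :=
  Seq (pop_cell mtape) (Seq (push_if fa atape x) (Seq (push_if fb btape x)
      (if x then push_cell ctape true else pop_cell ctape))).
Definition take_tree fa fb : cmd :=
  Seq (push_cell ctape true)
      (While ctape nonblank
         (If mtape (is_top true) (take_letter fa fb true) (take_letter fa fb false))).

Definition onto (f : bool) (s a : seq bool) := if f then rev s ++ a else a.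

Lemma wp_push_if_a md f x (ts : tapes) ti to m a b c (Q : tapes -> Prop) :
  rep ts ti to m a b c ->
  (forall ts', rep ts' ti to m (onto f [:: x] a) b c -> Q ts') ->
  wpc md (push_if f atape x) 2 ts Q.
Proof.
case: f => R H; first exact: wp_push_a R H.
by apply: (@wp_mono _ _ _ _ 1 _ _ _ Q); [apply: wp_skip; apply: H|..].
Qed.

Lemma wp_push_if_b md f x (ts : tapes) ti to m a b c (Q : tapes -> Prop) :
  rep ts ti to m a b c ->
  (forall ts', rep ts' ti to m a (onto f [:: x] b) c -> Q ts') ->
  wpc md (push_if f btape x) 2 ts Q.
Proof.
case: f => R H; first exact: wp_push_b R H.
by apply: (@wp_mono _ _ _ _ 1 _ _ _ Q); [apply: wp_skip; apply: H|..].
Qed.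

Lemma wp_take_letter md fa fb (x : bool) (ts : tapes) ti to m a b c (Q : tapes -> Prop) :
  rep ts ti to (x :: m) a b (true :: c) ->
  (forall ts', rep ts' ti to m (onto fa [:: x] a) (onto fb [:: x] b)
                 (if x then true :: true :: c else c) -> Q ts') ->
  wpc md (take_letter fa fb x) 7 ts Q.
Proof.
move=> R H; apply: (@wp_seq _ _ _ _ _ 1 6); apply: (wp_pop_m _ R) => t1 R1.
apply: (@wp_seq _ _ _ _ _ 2 4); apply: (wp_push_if_a _ R1) => t2 R2.
apply: (@wp_seq _ _ _ _ _ 2 2); apply: (wp_push_if_b _ R2) => t3 R3.
case: x R H R1 R2 R3 => _ H _ _ R3; first by apply: (wp_push_c _ R3).
by apply: (@wp_mono _ _ _ _ 1 _ _ _ Q) => //; apply: (wp_pop_c _ R3).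
Qed.

Lemma onto_cons f x s a : onto f (x :: s) a = onto f s (onto f [:: x] a).
Proof. by case: f; rewrite //= rev_cons cat_rcons. Qed.

(** Reading an inner node replaces one pending tree by two, so the induction needs a list [l] of
    pending trees; the counter stack holds its length in unary. Each letter costs 9 moves: two tests
    and the 7 of [take_letter]. *)
Lemma wp_take_loop md fa fb (l : seq btree) (ts : tapes) ti to r a b k
    (Q : tapes -> Prop) :
  size (flatten (map code l)) <= k ->
  rep ts ti to (flatten (map code l) ++ r) a b (nseq (size l) true) ->
  (forall ts', rep ts' ti to r (onto fa (flatten (map code l)) a)
      (onto fb (flatten (map code l)) b) [::] -> Q ts') ->
  wpc md (While ctape nonblank
         (If mtape (is_top true) (take_letter fa fb true) (take_letter fa fb false)))
      (9 * k + 1) ts Q.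
Proof.
elim: k l ts a b => [|k IH] [|t l] ts a b le R H.
- apply: wp_while_false; last by apply: H; rewrite /onto; do 2 case: ifP.
  by rewrite (stk_nil_scan (rep_c R)).
- by case: t le {R H}.
- have -> : 9 * k.+1 + 1 = (9 * k.+1).+1 by lia.
  apply: wp_while_false; last by apply: H; rewrite /onto; do 2 case: ifP.
  by rewrite (stk_nil_scan (rep_c R)).
have -> : 9 * k.+1 + 1 = (8 + (9 * k + 1)).+1 by lia.
apply: wp_while_true; first by rewrite (stk_cons_scan (rep_c R)).
apply: wp_if; case: t le R H => [|t1 t2] /= le R H.
  rewrite (stk_cons_scan (rep_m R)) /=.
  apply: (wp_take_letter _ R) => ts' R'; apply: IH R' _; first by lia.
  by move=> ts2; rewrite -!onto_cons; apply: H.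
rewrite (stk_cons_scan (rep_m R)) /=.
rewrite -!catA in R H le; apply: (wp_take_letter _ R) => ts' R'.
apply: (IH [:: t1, t2 & l]) => //=; first by rewrite -!catA; exact: R'.
by move=> ts2; rewrite -!onto_cons; apply: H.
Qed.

Lemma wp_take md fa fb t (ts : tapes) ti to r a b (Q : tapes -> Prop) :
  rep ts ti to (code t ++ r) a b [::] ->
  (forall ts', rep ts' ti to r (onto fa (code t) a) (onto fb (code t) b) [::] -> Q ts') ->
  wpc md (take_tree fa fb) (9 * csize t + 3) ts Q.
Proof.
move=> R H; have -> : 9 * csize t + 3 = 2 + (9 * csize t + 1) by lia.
apply: wp_seq; apply: (wp_push_c _ R) => ts' R'.
by apply: (@wp_take_loop _ _ _ [:: t] _ ti to r a b); rewrite /= ?cats0.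
Qed.

Definition flush_a : cmd := While atape nonblank
  (If atape (is_top true) (Seq (pop_cell atape) (push_cell mtape true))
                          (Seq (pop_cell atape) (push_cell mtape false))).
Definition flush_b : cmd := While btape nonblank
  (If btape (is_top true) (Seq (pop_cell btape) (push_cell mtape true))
                          (Seq (pop_cell btape) (push_cell mtape false))).

Lemma wp_flush_a md (ts : tapes) ti to m a b c (Q : tapes -> Prop) :
  rep ts ti to m a b c -> (forall ts', rep ts' ti to (rev a ++ m) [::] b c -> Q ts') ->
  wpc md flush_a (5 * size a + 1) ts Q.
Proof.
elim: a m ts => [|x a IH] m ts R H.
  by apply: wp_while_false; [rewrite (stk_nil_scan (rep_a R)) | apply: H].
have -> : 5 * size (x :: a) + 1 = (4 + (5 * size a + 1)).+1 by rewrite /=; lia.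
apply: wp_while_true; first by rewrite (stk_cons_scan (rep_a R)).
apply: wp_if; rewrite (stk_cons_scan (rep_a R)) /=.
by case: x R H => R H; apply: (@wp_seq _ _ _ _ _ 1 2); apply: (wp_pop_a _ R) => t1 R1;
  apply: (wp_push_m _ R1) => t2 R2; apply: IH R2 _ => t3; rewrite -cat_rcons -rev_cons;
  apply: H.
Qed.

Lemma wp_flush_b md (ts : tapes) ti to m a b c (Q : tapes -> Prop) :
  rep ts ti to m a b c -> (forall ts', rep ts' ti to (rev b ++ m) a [::] c -> Q ts') ->
  wpc md flush_b (5 * size b + 1) ts Q.
Proof.
elim: b m ts => [|x b IH] m ts R H.
  by apply: wp_while_false; [rewrite (stk_nil_scan (rep_b R)) | apply: H].
have -> : 5 * size (x :: b) + 1 = (4 + (5 * size b + 1)).+1 by rewrite /=; lia.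
apply: wp_while_true; first by rewrite (stk_cons_scan (rep_b R)).
apply: wp_if; rewrite (stk_cons_scan (rep_b R)) /=.
by case: x R H => R H; apply: (@wp_seq _ _ _ _ _ 1 2); apply: (wp_pop_b _ R) => t1 R1;
  apply: (wp_push_m _ R1) => t2 R2; apply: IH R2 _ => t3; rewrite -cat_rcons -rev_cons;
  apply: H.
Qed.

Definition trep (ts : tapes) ti to (l : seq btree) (r : seq bool) :=
  rep ts ti to (flatten (map code l) ++ r) [::] [::] [::].

(** The rest [r] of the main stack and both modes are quantified: a command is verified once for all
    and some runs, and the frame rule [runs_frame] comes for free. *)
Definition runs (c : cmd) (l l' : seq btree) (k : nat) : Prop :=
  forall md (ts : tapes) ti to r (Q : tapes -> Prop), trep ts ti to l r ->
    (forall ts', trep ts' ti to l' r -> Q ts') -> wpc md c k ts Q.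

Lemma runs_le c l l' k k' : runs c l l' k -> k <= k' -> runs c l l' k'.
Proof. by move=> H le md ts ti to r Q R HQ; apply: (wp_mono (H _ _ _ _ _ _ R HQ)). Qed.

Lemma runs_seq c1 c2 l l' l'' k1 k2 :
  runs c1 l l' k1 -> runs c2 l' l'' k2 -> runs (Seq c1 c2) l l'' (k1 + k2).
Proof.
move=> H1 H2 md ts ti to r Q R HQ; apply: wp_seq; apply: (H1 _ _ _ _ _ _ R) => ts' R'.
exact: H2 R' HQ.
Qed.

Lemma runs_frame c l l' l2 k : runs c l l' k -> runs c (l ++ l2) (l' ++ l2) k.
Proof.
move=> H md ts ti to r Q; rewrite /trep !map_cat !flatten_cat -!catA => R HQ.
exact: H R HQ.
Qed.

Definition drop_tree : cmd := take_tree false false.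
Definition dup : cmd := Seq (take_tree true true) (Seq flush_a flush_b).
(** Scratch stacks hold codes reversed and flushing reverses them again. The tree taken first is
    flushed first, hence ends below the other. *)
Definition swap : cmd := Seq (take_tree true false) (Seq (take_tree false true) (Seq flush_a flush_b)).

Lemma runs_drop t l : runs drop_tree (t :: l) l (9 * csize t + 3).
Proof.
by move=> md ts ti to r Q; rewrite /trep /= -catA => R HQ; apply: (wp_take _ R).
Qed.

Lemma runs_dup t l : runs dup (t :: l) [:: t, t & l] (19 * csize t + 5).
Proof.
move=> md ts ti to r Q; rewrite /trep /= -!catA => R HQ.
have -> : 19 * csize t + 5 = (9 * csize t + 3) + ((5 * csize t + 1) + (5 * csize t + 1)) by lia.
apply: wp_seq; apply: (wp_take _ R) => t1; rewrite /= !cats0 => R1.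
apply: wp_seq; rewrite -{1}[csize t]size_rev; apply: (wp_flush_a _ R1) => t2; rewrite revK => R2.
rewrite -[csize t]size_rev; apply: (wp_flush_b _ R2) => t3; rewrite revK; exact: HQ.
Qed.

Lemma runs_swap t u l :
  runs swap [:: t, u & l] [:: u, t & l] (14 * (csize t + csize u) + 8).
Proof.
move=> md ts ti to r Q; rewrite /trep /= -!catA => R HQ.
have -> : 14 * (csize t + csize u) + 8 = (9 * csize t + 3) +
  ((9 * csize u + 3) + ((5 * csize t + 1) + (5 * csize u + 1))) by lia.
apply: wp_seq; apply: (wp_take _ R) => t1; rewrite /= !cats0 => R1.
apply: wp_seq; apply: (wp_take _ R1) => t2; rewrite /= !cats0 => R2.
apply: wp_seq; rewrite -{1}[csize t]size_rev; apply: (wp_flush_a _ R2) => t3; rewrite revK => R3.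
rewrite -[csize u]size_rev; apply: (wp_flush_b _ R3) => t4; rewrite revK; exact: HQ.
Qed.

Lemma runs_cons a b l : runs (push_cell mtape true) [:: a, b & l] (Nd a b :: l) 2.
Proof.
move=> md ts ti to r Q; rewrite /trep /= => R HQ; apply: (wp_push_m _ R) => t1 R1.
by apply: HQ; rewrite /= -!catA in R1 *.
Qed.

Lemma runs_uncons a b l : runs (pop_cell mtape) (Nd a b :: l) [:: a, b & l] 1.
Proof.
move=> md ts ti to r Q; rewrite /trep /= => R HQ; apply: (wp_pop_m _ R) => t1 R1.
by apply: HQ; rewrite -!catA in R1 *.
Qed.

Lemma runs_pop_Lf l : runs (pop_cell mtape) (Lf :: l) l 1.
Proof.
by move=> md ts ti to r Q; rewrite /trep /= => R HQ; apply: (wp_pop_m _ R) => t1 R1; apply: HQ.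
Qed.

Lemma runs_push_Lf l : runs (push_cell mtape false) l (Lf :: l) 2.
Proof.
by move=> md ts ti to r Q; rewrite /trep /= => R HQ; apply: (wp_push_m _ R) => t1 R1; apply: HQ.
Qed.

Fixpoint push_tree (t : btree) : cmd :=
  if t is Nd a b then Seq (push_tree b) (Seq (push_tree a) (push_cell mtape true))
  else push_cell mtape false.

Lemma runs_push_tree t l : runs (push_tree t) l (t :: l) (2 * csize t).
Proof.
elim: t l => [|a IHa b IHb] l; first exact: runs_push_Lf.
rewrite csize_Nd; have -> : 2 * (csize a + csize b).+1 = 2 * csize b + (2 * csize a + 2) by lia.
by apply: runs_seq (IHb _) _; apply: runs_seq (IHa _) _; apply: runs_cons.
Qed.

Lemma nochoice_push_tree t : nochoice (push_tree t).
Proof. by elim: t => //= a -> b ->. Qed.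

Lemma runs_if_Nd c1 c2 a b l l' k :
  runs c1 (Nd a b :: l) l' k -> runs (If mtape (is_top true) c1 c2) (Nd a b :: l) l' k.+1.
Proof.
move=> H md ts ti to r Q R HQ; apply: wp_if.
by move: (R); rewrite /trep /= => R'; rewrite (stk_cons_scan (rep_m R')) /=; exact: H R HQ.
Qed.

Lemma runs_if_Lf c1 c2 l l' k :
  runs c2 (Lf :: l) l' k -> runs (If mtape (is_top true) c1 c2) (Lf :: l) l' k.+1.
Proof.
move=> H md ts ti to r Q R HQ; apply: wp_if.
by move: (R); rewrite /trep /= => R'; rewrite (stk_cons_scan (rep_m R')) /=; exact: H R HQ.
Qed.

Lemma runs_while_Lf c l : runs (While mtape (is_top true) c) (Lf :: l) (Lf :: l) 1.
Proof.
move=> md ts ti to r Q R HQ; apply: wp_while_false; last exact: HQ R.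
by move: (R); rewrite /trep /= => R'; rewrite (stk_cons_scan (rep_m R')).
Qed.

Lemma runs_while_Nd c a b l l' l'' k k' :
  runs c (Nd a b :: l) l' k -> runs (While mtape (is_top true) c) l' l'' k' ->
  runs (While mtape (is_top true) c) (Nd a b :: l) l'' (k + k').+1.
Proof.
move=> H H' md ts ti to r Q R HQ; apply: wp_while_true.
  by move: (R); rewrite /trep /= => R'; rewrite (stk_cons_scan (rep_m R')).
apply: (H _ _ _ _ _ _ R) => ts' R'; exact: H' R' HQ.
Qed.

End StackTapes.

(** * Polynomial bounds *)

(** The base is at least 2, so constants, factors and sums are all absorbed by the exponent and a
    bound is a single number. *)
Definition pb (X : Type) (mu f : X -> nat) : Prop :=
  exists k, forall x, f x <= (mu x + 2) ^ k.

Lemma leq_pow2 m k j : k <= j -> (m + 2) ^ k <= (m + 2) ^ j.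
Proof. by move=> le; apply: leq_pexp2l => //; lia. Qed.

Lemma leq_powl m m' k : m <= m' -> (m + 2) ^ k <= (m' + 2) ^ k.
Proof. by move=> le; case: k => // k; rewrite leq_exp2r //; lia. Qed.

(** As [(m + 2) ^ 2] is at least 4, adding 2 to a power of [m + 2] costs at most two in the
    exponent. *)
Lemma pow_comp m j k : ((m + 2) ^ j + 2) ^ k <= (m + 2) ^ ((j + 2) * k).
Proof.
rewrite expnM; case: k => // k; rewrite leq_exp2r //.
have : 0 < (m + 2) ^ j by rewrite expn_gt0; lia.
rewrite expnD; set p := _ ^ j; move: p => p.
have : 4 <= (m + 2) ^ 2 by rewrite -[4]/(2 ^ 2) leq_exp2r //; lia.
move: ((m + 2) ^ 2) => q; nia.
Qed.

Section PolyBounds.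

Variables (X : Type) (mu : X -> nat).

Lemma pb_le (f g : X -> nat) : (forall x, f x <= g x) -> pb mu g -> pb mu f.
Proof. by move=> le [k H]; exists k => x; apply: leq_trans (le x) (H x). Qed.

Lemma pb_cst n : pb mu (fun _ => n).
Proof.
exists n => x; apply: (@leq_trans (2 ^ n)); first by apply: ltnW; apply: ltn_expl.
by case: n => // n; rewrite leq_exp2r //; lia.
Qed.

Lemma pb_mu : pb mu mu.
Proof. by exists 1 => x; rewrite expn1; lia. Qed.

Lemma pb_add f g : pb mu f -> pb mu g -> pb mu (fun x => f x + g x).
Proof.
case=> k Hk [j Hj]; exists (k + j).+1 => x; rewrite expnS.
have := leq_trans (Hk x) (leq_pow2 (mu x) (leq_addr j k)).
have := leq_trans (Hj x) (leq_pow2 (mu x) (leq_addl k j)).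
move: (_ ^ (k + j)) => p; nia.
Qed.

Lemma pb_mul f g : pb mu f -> pb mu g -> pb mu (fun x => f x * g x).
Proof. by case=> k Hk [j Hj]; exists (k + j) => x; rewrite expnD leq_mul. Qed.

Lemma pb_S f : pb mu f -> pb mu (fun x => (f x).+1).
Proof. by move=> H; apply: (@pb_le _ (fun x => f x + 1)); [lia|apply: pb_add (pb_cst 1)]. Qed.

Lemma pb_pow f k : pb mu f -> pb mu (fun x => f x ^ k).
Proof.
case=> j H; exists (j * k) => x; rewrite expnM; case: k => // k.
by rewrite leq_exp2r.
Qed.

Lemma pb_comp (Y : Type) (mu' f : Y -> nat) (h : X -> Y) :
  pb mu' f -> pb mu (fun x => mu' (h x)) -> pb mu (fun x => f (h x)).
Proof.
case=> k Hk [j Hj]; exists ((j + 2) * k) => x.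
apply: leq_trans (Hk _) _; apply: leq_trans (pow_comp _ _ _); exact: leq_powl.
Qed.

End PolyBounds.

Ltac pbs := repeat first
  [ assumption | apply: pb_cst | apply: pb_mu | apply: pb_add | apply: pb_mul
  | apply: pb_S | apply: pb_pow ].

(** * Encodings of data as binary trees *)

Fixpoint teq (s t : btree) : bool :=
  match s, t with
  | Lf, Lf => true
  | Nd a b, Nd c d => teq a c && teq b d
  | _, _ => false
  end.

Lemma teqP : Equality.axiom teq.
Proof.
elim=> [|a IHa b IHb] [|c d] /=; try by constructor.
by apply: (iffP andP) => [[/IHa-> /IHb->]|[<- <-]] //; split; [apply/IHa|apply/IHb].
Qed.

HB.instance Definition _ := hasDecEq.Build btree teqP.

Class Enc (T : Type) := { enc : T -> btree; enc_inj : injective enc }.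

#[global] Instance enc_btree : Enc btree := { enc := id; enc_inj := fun _ _ e => e }.

#[global] Instance enc_unit : Enc unit.
Proof. by exists (fun _ => Lf) => -[] []. Defined.

#[global] Instance enc_bool : Enc bool.
Proof. by exists (fun b : bool => if b then Nd Lf Lf else Lf) => -[] []. Defined.

(** Unary is affordable because only addresses, lengths and positions are stored this way. Names of
    variables may be exponential in the length of their word and are kept as lists of bits. *)
Fixpoint nat_tree (n : nat) : btree := if n is n'.+1 then Nd Lf (nat_tree n') else Lf.

#[global] Instance enc_nat : Enc nat.
Proof. by exists nat_tree; elim=> [|m IH] [|n] //= [/IH->]. Defined.

#[global] Instance enc_prod A B {_ : Enc A} {_ : Enc B} : Enc (A * B).
Proof.
by exists (fun p => Nd (enc p.1) (enc p.2)) => -[a b] [c d] /= [/(@enc_inj A _)-> /(@enc_inj B _)->].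
Defined.

Fixpoint seq_tree A (e : A -> btree) (s : seq A) : btree :=
  if s is a :: s' then Nd (e a) (seq_tree e s') else Lf.

#[global] Instance enc_seq A {_ : Enc A} : Enc (seq A).
Proof.
by exists (seq_tree enc); elim=> [|a s IH] [|b t] //= [/(@enc_inj A _)-> /IH->].
Defined.

#[global] Instance enc_option A {_ : Enc A} : Enc (option A).
Proof.
exists (fun o => if o is Some a then Nd (enc a) Lf else Lf) => -[a|] [b|] //= [].
by move/(@enc_inj A _)->.
Defined.

Definition enc_fin (T : finType) : Enc T.
Proof. by exists (fun x => nat_tree (enum_rank x)) => x y /(@enc_inj _ enc_nat)/val_inj/enum_rank_inj. Defined.

Definition sz {T : Type} {E : Enc T} (x : T) := csize (enc x).

Lemma sz_gt0 T {_ : Enc T} (x : T) : 0 < sz x.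
Proof. exact: csize_gt0. Qed.

Lemma sz_pair A B {_ : Enc A} {_ : Enc B} (p : A * B) : sz p = (sz p.1 + sz p.2).+1.
Proof. exact: csize_Nd. Qed.

Lemma sz_nil A {_ : Enc A} : sz ([::] : seq A) = 1.
Proof. by []. Qed.

Lemma sz_cons A {_ : Enc A} (a : A) s : sz (a :: s) = (sz a + sz s).+1.
Proof. exact: csize_Nd. Qed.

Lemma sz_nat (n : nat) : sz n = (n.*2).+1.
Proof. elim: n => // n IH; change (csize (Nd Lf (nat_tree n)) = n.+1.*2.+1).
by rewrite csize_Nd; change (csize (nat_tree n) = n.*2.+1) in IH; rewrite IH. Qed.

Lemma sz_bool (b : bool) : sz b <= 3.
Proof. by case: b. Qed.

Lemma size_sz A {_ : Enc A} (s : seq A) : size s < sz s.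
Proof. by elim: s => // a s IH; rewrite sz_cons /=; lia. Qed.

Lemma sz_mem (A : eqType) {_ : Enc A} (s : seq A) a : a \in s -> sz a <= sz s.
Proof.
elim: s => // b s IH; rewrite inE sz_cons => /orP[/eqP->|/IH]; lia.
Qed.

Lemma sz_le A {_ : Enc A} (s : seq A) m :
  all (fun a => sz a <= m) s -> sz s <= size s * m.+1 + 1.
Proof. by elim: s => // a s IH /= /andP[? /IH]; rewrite sz_cons; lia. Qed.

Lemma sz_cat A {_ : Enc A} (s t : seq A) : (sz (s ++ t)).+1 = sz s + sz t.
Proof. by elim: s => [|a s IH]; rewrite ?sz_nil //= !sz_cons; lia. Qed.

Lemma sz_take A {_ : Enc A} (s : seq A) i : sz (take i s) <= sz s.
Proof. by elim: s i => [|a s IH] [|i] //=; rewrite !sz_cons ?sz_nil //; have := IH i; lia. Qed.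

Lemma sz_drop A {_ : Enc A} (s : seq A) i : sz (drop i s) <= sz s.
Proof. by elim: s i => [|a s IH] [|i] //=; rewrite sz_cons; have := IH i; lia. Qed.

Lemma sz_rev A {_ : Enc A} (s : seq A) : sz (rev s) = sz s.
Proof.
elim: s => // a s IH; rewrite rev_cons -cats1; pose proof (sz_cat (rev s) [:: a]) as E; move: E.
by rewrite IH !sz_cons sz_nil; lia.
Qed.

(** * Functions computed by programs in polynomial time *)

Section PolyFun.

Variable Sigma : finType.
Notation cmd := (cmd Sigma 5).

(** The size of the result is bounded separately because the time of a composition depends on it. *)
Definition pf {X A : Type} {EX : Enc X} {EA : Enc A} (f : X -> A) : Prop :=
  exists (c : cmd) (t : X -> nat),
    [/\ nochoice c, pb sz t, pb sz (fun x => sz (f x))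
      & forall x, runs c [:: enc x] [:: enc (f x)] (t x)].

Section Basics.

Context {X A B C : Type} {EX : Enc X} {EA : Enc A} {EB : Enc B} {EC : Enc C}.

Lemma pf_enc (f : X -> A) (g : X -> B) : (forall x, enc (f x) = enc (g x)) -> pf f -> pf g.
Proof.
move=> E [c [t [nc pt ps H]]]; exists c, t; split=> //; last by move=> x; rewrite -E.
by case: ps => k ps; exists k => x; move: (ps x); rewrite /sz E.
Qed.

Lemma pf_ext (f g : X -> A) : f =1 g -> pf f -> pf g.
Proof. by move=> E [c [t [nc pt ps H]]]; exists c, t; split=> // [|x]; [case: ps => k Hk; exists k => x|]; rewrite -?E. Qed.

Lemma pf_id : pf (@id X).
Proof.
exists (skip Sigma), (fun _ => 1); split=> //; [exact: pb_cst|exact: pb_mu|].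
by move=> x md ts ti to r Q R HQ; apply: wp_skip; apply: HQ.
Qed.

Lemma pf_comp (f : A -> B) (g : X -> A) : pf f -> pf g -> pf (fun x => f (g x)).
Proof.
move=> [c [t [nc pt ps H]]] [c' [t' [nc' pt' ps' H']]].
exists (Seq c' c), (fun x => t' x + t (g x)); split=> /=.
- by rewrite nc' nc.
- by apply: pb_add => //; exact: (@pb_comp _ _ _ _ _ g pt ps').
- exact: (@pb_comp _ _ _ _ _ g ps ps').
- by move=> x; cbv beta; rewrite /sz; apply: runs_seq (H' x) (H _).
Qed.

Lemma pf_pair (f : X -> A) (g : X -> B) : pf f -> pf g -> pf (fun x => (f x, g x)).
Proof.
move=> [c [t [nc pt ps H]]] [c' [t' [nc' pt' ps' H']]].
exists (Seq (dup Sigma) (Seq c (Seq (swap Sigma) (Seq c' (Seq (swap Sigma) (push_cell Sigma mtape true)))))).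
exists (fun x => (19 * sz x + 5) + (t x + ((14 * (sz (f x) + sz x) + 8) +
  (t' x + ((14 * (sz (g x) + sz (f x)) + 8) + 2))))); split=> /=.
- by rewrite nc nc'.
- by pbs.
- by apply: (@pb_le _ _ _ (fun x => (sz (f x) + sz (g x)).+1)); [move=> x; rewrite sz_pair|pbs].
move=> x; cbv beta; rewrite /sz; apply: runs_seq (@runs_dup _ _ _) _.
apply: runs_seq (@runs_frame _ _ _ _ [:: enc x] _ (H x)) _ => /=.
apply: runs_seq (@runs_swap _ _ _ _) _.
apply: runs_seq (@runs_frame _ _ _ _ [:: enc (f x)] _ (H' x)) _ => /=.
apply: runs_seq (@runs_swap _ _ _ _) _; exact: runs_cons.
Qed.

Lemma pf_fst (f : X -> A * B) : pf f -> pf (fun x => (f x).1).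
Proof.
move=> Hf; apply: (@pf_ext (fun x => (f x).1)) => //.
case: Hf => [c [t [nc pt ps H]]].
exists (Seq c (Seq (pop_cell Sigma mtape) (Seq (swap Sigma) (drop_tree Sigma)))).
exists (fun x => t x + (1 + ((14 * sz (f x) + 8) + (9 * sz (f x) + 3)))); split=> /=.
- by rewrite nc.
- by pbs.
- by apply: pb_le ps => x; rewrite [sz (f x)]sz_pair; lia.
move=> x; cbv beta; rewrite /sz; apply: runs_seq (H x) _; rewrite [enc (f x)]/=.
apply: runs_seq (@runs_uncons _ _ _ _) _; apply: runs_seq.
  by apply: runs_le (@runs_swap _ _ _ _) _; rewrite csize_Nd; lia.
by apply: runs_le (@runs_drop _ _ _) _; rewrite csize_Nd; lia.
Qed.

Lemma pf_snd (f : X -> A * B) : pf f -> pf (fun x => (f x).2).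
Proof.
case=> [c [t [nc pt ps H]]].
exists (Seq c (Seq (pop_cell Sigma mtape) (drop_tree Sigma))).
exists (fun x => t x + (1 + (9 * sz (f x) + 3))); split=> /=.
- by rewrite nc.
- by pbs.
- by apply: pb_le ps => x; rewrite [sz (f x)]sz_pair; lia.
move=> x; cbv beta; rewrite /sz; apply: runs_seq (H x) _; rewrite [enc (f x)]/=.
apply: runs_seq (@runs_uncons _ _ _ _) _.
by apply: runs_le (@runs_drop _ _ _) _; rewrite csize_Nd; lia.
Qed.

Lemma pf_const (a : A) : pf (fun _ : X => a).
Proof.
exists (Seq (drop_tree Sigma) (push_tree Sigma (enc a))), (fun x => (9 * sz x + 3) + 2 * sz a).
split=> /=; [exact: nochoice_push_tree|by pbs|exact: pb_cst|].
move=> x; cbv beta; rewrite /sz; apply: runs_seq (@runs_drop _ _ _) (@runs_push_tree _ _ _).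
Qed.

End Basics.

Section Cases.

Context {X A B C : Type} {EX : Enc X} {EA : Enc A} {EB : Enc B} {EC : Enc C}.

(** Booleans, lists, trees and options all have encodings that are either a leaf or a node with two
    encoded parts; [view] abstracts this, so one program serves all these case distinctions. *)
Lemma pf_view (T : Type) {ET : Enc T} (f : X -> T) (view : T -> option (A * B))
    (g : X -> C) (h : X * (A * B) -> C) :
  (forall t, enc t = if view t is Some p then Nd (enc p.1) (enc p.2) else Lf) ->
  pf f -> pf g -> pf h ->
  pf (fun x => if view (f x) is Some p then h (x, p) else g x).
Proof.
move=> vE [cf [tf [ncf ptf psf Hf]]] [cg [tg [ncg ptg psg Hg]]] [ch [th [nch pth psh Hh]]].
set F := fun x => _.
pose arg x := if view (f x) is Some p then Some (x, p) else None.
have pbarg (t : X * (A * B) -> nat) :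
    pb sz t -> pb sz (fun x => if arg x is Some p then t p else 0).
  (* The 3 is the node that joins [x] and [p], together with the 2 in the base of [pb]. *)
  case=> k Hk; apply: (@pb_le _ _ _ (fun x => (sz x + sz (f x) + 3) ^ k)); last by pbs.
  move=> x; rewrite /arg; move: (vE (f x)); case: (view (f x)) => // p E.
  apply: leq_trans (Hk _) _; have E2 : sz (f x) = sz p by rewrite /sz E.
  by rewrite sz_pair /= E2; apply: eq_leq; congr (_ ^ _); lia.
exists (Seq (dup Sigma) (Seq cf (If mtape (is_top true)
   (Seq (swap Sigma) (Seq (push_cell Sigma mtape true) ch)) (Seq (pop_cell Sigma mtape) cg)))).
exists (fun x => (19 * sz x + 5) + (tf x + ((14 * (sz (f x) + sz x) + 8) +
    (2 + (if arg x is Some p then th p else 0)) + (1 + tg x)).+1)); split=> /=.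
- by rewrite ncf ncg nch.
- by have := pbarg _ pth => ?; pbs.
- have P1 := pbarg _ psh.
  apply: (@pb_le _ _ _ (fun x => (if arg x is Some p then sz (h p) else 0) + sz (g x))).
    by move=> x; rewrite /F /arg; case: (view _) => [p|]; lia.
  by pbs.
move=> x; cbv beta; rewrite /sz; apply: runs_seq (@runs_dup _ _ _) _.
apply: runs_seq (@runs_frame _ _ _ _ [:: enc x] _ (Hf x)) _ => /=.
move: (vE (f x)); rewrite /F /arg; case E: (view (f x)) => [p|] ->.
  apply: runs_if_Nd; apply: runs_le (leq_addr _ _).
  apply: runs_seq; first by apply: runs_le (@runs_swap _ _ _ _) _.
  by apply: runs_seq (@runs_cons _ _ _ _) (Hh (x, p)).
apply: runs_if_Lf; apply: runs_le (leq_addl _ _).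
by apply: runs_seq (@runs_pop_Lf _ _) (Hg x).
Qed.

End Cases.

Section Cases2.

Context {X A B : Type} {EX : Enc X} {EA : Enc A} {EB : Enc B}.

Lemma pf_if (c : X -> bool) (f g : X -> A) :
  pf c -> pf f -> pf g -> pf (fun x => if c x then f x else g x).
Proof.
move=> Hc Hf Hg.
pose view (b : bool) := if b then Some (tt, tt) else None.
apply: (@pf_ext _ _ _ _ (fun x => if view (c x) is Some p then f (x, p).1 else g x)).
  by move=> x; rewrite /view; case: (c x).
apply: (@pf_view _ _ _ _ _ _ _ _ _ _ _ view _ (fun p => f p.1)) => //; first by case.
exact: pf_comp Hf (pf_fst pf_id).
Qed.

Lemma pf_case (f : X -> seq A) (g : X -> B) (h : X -> A -> seq A -> B) :
  pf f -> pf g -> pf (fun p : X * (A * seq A) => h p.1 p.2.1 p.2.2) ->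
  pf (fun x => if f x is a :: l then h x a l else g x).
Proof.
move=> Hf Hg Hh.
pose view (s : seq A) := if s is a :: l then Some (a, l) else None.
apply: (@pf_ext _ _ _ _ (fun x => if view (f x) is Some p then h (x, p).1 (x, p).2.1 (x, p).2.2 else g x)).
  by move=> x; rewrite /view; case: (f x).
by apply: (@pf_view _ _ _ _ _ _ _ _ _ _ _ view _ (fun p => h p.1 p.2.1 p.2.2)) => //; case.
Qed.

Lemma pf_tcase (f : X -> btree) (g : X -> B) (h : X -> btree -> btree -> B) :
  pf f -> pf g -> pf (fun p : X * (btree * btree) => h p.1 p.2.1 p.2.2) ->
  pf (fun x => if f x is Nd a l then h x a l else g x).
Proof.
move=> Hf Hg Hh.
pose view s := if s is Nd a l then Some (a, l) else None.
apply: (@pf_ext _ _ _ _ (fun x => if view (f x) is Some p then h (x, p).1 (x, p).2.1 (x, p).2.2 else g x)).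
  by move=> x; rewrite /view; case: (f x).
by apply: (@pf_view _ _ _ _ _ _ _ _ _ _ _ view _ (fun p => h p.1 p.2.1 p.2.2)) => //; case.
Qed.

Lemma pf_ocase (f : X -> option A) (g : X -> B) (h : X -> A -> B) :
  pf f -> pf g -> pf (fun p : X * A => h p.1 p.2) ->
  pf (fun x => if f x is Some a then h x a else g x).
Proof.
move=> Hf Hg Hh.
pose view (s : option A) := if s is Some a then Some (a, tt) else None.
apply: (@pf_ext _ _ _ _ (fun x => if view (f x) is Some p then h (x, p).1 (x, p).2.1 else g x)).
  by move=> x; rewrite /view; case: (f x).
apply: (@pf_view _ _ _ _ _ _ _ _ _ _ _ view _ (fun p => h p.1 p.2.1)) => //; first by case.
apply: (@pf_comp _ _ _ _ _ _ (fun p => h p.1 p.2) (fun p : X * (A * unit) => (p.1, p.2.1))) => //.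
apply: pf_pair (pf_fst pf_id) (pf_fst (pf_snd pf_id)).
Qed.

Lemma pf_cons (f : X -> A) (g : X -> seq A) : pf f -> pf g -> pf (fun x => f x :: g x).
Proof. by move=> Hf Hg; apply: pf_enc (pf_pair Hf Hg). Qed.

Lemma pf_S (f : X -> nat) : pf f -> pf (fun x => (f x).+1).
Proof. by move=> Hf; apply: pf_enc (pf_pair (pf_const tt) Hf). Qed.

Lemma pf_some (f : X -> A) : pf f -> pf (fun x => Some (f x)).
Proof. by move=> Hf; apply: pf_enc (pf_pair Hf (pf_const tt)). Qed.

Lemma pf_tree (f : X -> A) : pf f -> pf (fun x => enc (f x)).
Proof. exact: pf_enc. Qed.

End Cases2.

Section Loop.

Context {X A B : Type} {EX : Enc X} {EA : Enc A} {EB : Enc B}.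

(** Between rounds the state lies unpacked, so that the top bit of the main stack tells whether the
    list component is empty; the body packs the pair for [c] and unpacks it again. *)
Definition loop_cmd (c : cmd) : cmd :=
  While mtape (is_top true) (Seq (push_cell Sigma mtape true) (Seq c (pop_cell Sigma mtape))).

(** [n] may exceed the number of rounds made, since [G] fixes the states with an empty list. The 4
    counts the test, the push (2) and the pop around [c]. *)
Lemma runs_loop (G : seq A * B -> seq A * B) c t M n s :
  (forall s, runs c [:: enc s] [:: enc (G s)] (t s)) ->
  (forall s, s.1 = [::] -> G s = s) ->
  (iter n G s).1 = [::] -> (forall i, i <= n -> t (iter i G s) <= M) ->
  runs (loop_cmd c) [:: enc s.1; enc s.2] [:: Lf; enc (iter n G s).2] (n * (M + 4) + 1).
Proof.
move=> Hc HG; elim: n s => [|n IH] s.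
  by move=> /= -> _; apply: runs_while_Lf.
case E: s.1 => [|a l].
  move=> _ _; have -> : iter n.+1 G s = s by elim: {IH}n.+1 => //= m ->; apply: HG.
  by apply: runs_le (@runs_while_Lf _ _ _) _; lia.
rewrite iterSr => e Ht; have -> : n.+1 * (M + 4) + 1 = ((2 + (M + 1)) + (n * (M + 4) + 1)).+1 by lia.
rewrite /= ; apply: (@runs_while_Nd _ _ _ _ _ [:: enc (G s).1; enc (G s).2]).
  apply: runs_seq; first exact: runs_cons.
  apply: runs_seq; last exact: runs_uncons.
  have := Hc s; rewrite {1}[enc s]/= E => Hs; apply: runs_le Hs _; exact: (Ht 0).
apply: IH => // i le; rewrite -iterSr; exact: (Ht i.+1).
Qed.

(* N bounds the number of rounds and M the size of the intermediate states. *)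
Lemma pf_loop (G : seq A * B -> seq A * B) (init : X -> seq A * B) (N M : X -> nat) :
  pf init -> pf G -> pb sz N -> pb sz M ->
  (forall s, s.1 = [::] -> G s = s) ->
  (forall x, (iter (N x) G (init x)).1 = [::]) ->
  (forall x i, i <= N x -> sz (iter i G (init x)) <= M x) ->
  pf (fun x => (iter (N x) G (init x)).2).
Proof.
move=> [ci [ti [nci pti psi Hi]]] [c [t [nc [k Hk] ps H]]] pN pM HG HN HM.
pose T x := N x * ((M x + 2) ^ k + 4) + 1.
exists (Seq ci (Seq (pop_cell Sigma mtape) (Seq (loop_cmd c) (pop_cell Sigma mtape)))).
exists (fun x => ti x + (1 + (T x + 1))); split => /=.
- by rewrite nci nc.
- by rewrite /T; pbs.
- apply: pb_le pM => x; apply: leq_trans (HM x (N x) (leqnn _)).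
  by rewrite [X in _ <= X]sz_pair; lia.
move=> x; cbv beta; rewrite /sz; apply: runs_seq (Hi x) _.
apply: runs_seq; first by rewrite [enc (init x)]/=; exact: runs_uncons.
apply: runs_seq (@runs_pop_Lf _ _); apply: runs_loop => // i le.
by apply: leq_trans (Hk _) _; apply: leq_powl; apply: HM.
Qed.

End Loop.

Section Fold.

Context {X A B : Type} {EX : Enc X} {EA : Enc A} {EB : Enc B}.

(** A body that is polynomial in its accumulator could still make it exponential after many rounds;
    the bound [M] on all prefixes excludes this. The state of the loop carries [x], as the body may
    only use its state. *)
Lemma pf_foldl (l : X -> seq A) (z : X -> B) (h : X -> A -> B -> B) (M : X -> nat) :
  pf l -> pf z -> pf (fun p : X * (A * B) => h p.1 p.2.1 p.2.2) -> pb sz M ->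
  (forall x i, sz (foldl (fun b a => h x a b) (z x) (take i (l x))) <= M x) ->
  pf (fun x => foldl (fun b a => h x a b) (z x) (l x)).
Proof.
move=> Hl Hz Hh pM HM.
pose G (s : seq A * (X * B)) :=
  if s.1 is a :: l then (l, (s.2.1, h s.2.1 a s.2.2)) else s.
pose init x := (l x, (x, z x)).
have itG i l0 x b : iter i G (l0, (x, b)) =
    (drop i l0, (x, foldl (fun b a => h x a b) b (take i l0))).
  elim: i l0 b => [|i IH] [|a l0] b //; rewrite iterSr ?IH //=.
apply: (@pf_ext _ _ _ _ (fun x => (iter (size (l x)) G (init x)).2.2)).
  by move=> x; rewrite itG take_size.
apply: pf_snd; apply: (@pf_loop X A (X * B) _ _ _ G init (fun x => size (l x))
  (fun x => (sz (l x) + (sz x + M x).+1).+1)).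
- exact: pf_pair Hl (pf_pair pf_id Hz).
- apply: (@pf_case (seq A * (X * B)) A _ _ _ _ _ id (fun s a l => (l, (s.2.1, h s.2.1 a s.2.2)))).
  + exact: pf_fst pf_id.
  + exact: pf_id.
  + apply: pf_pair; first exact: pf_snd (pf_snd pf_id).
    apply: pf_pair; first exact: pf_fst (pf_snd (pf_fst pf_id)).
    apply: (@pf_comp _ _ _ _ _ _ (fun p : X * (A * B) => h p.1 p.2.1 p.2.2)
       (fun p => (p.1.2.1, (p.2.1, p.1.2.2)))) => //.
    apply: pf_pair; first exact: pf_fst (pf_snd (pf_fst pf_id)).
    apply: pf_pair; first exact: pf_fst (pf_snd pf_id).
    exact: pf_snd (pf_snd (pf_fst pf_id)).
- case: Hl => [_ [_ [_ _ ps _]]]; apply: pb_le ps => x; exact: ltnW (size_sz _).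
- by case: Hl => [_ [_ [_ _ ps _]]]; pbs.
- by move=> [[|a l0] s].
- by move=> x; rewrite itG drop_size.
- move=> x i _; rewrite itG !sz_pair /=; have := HM x i; pose proof (sz_drop (l x) i); lia.
Qed.

End Fold.

End PolyFun.

Ltac pf_step := first [exact: pf_const | exact: pf_id | solve [apply: pf_fst; exact: pf_id] |
  solve [apply: pf_snd; exact: pf_id] |
  match goal with
  | H : @pf _ _ _ _ _ ?f |- @pf _ _ _ _ _ (fun x => ?f (@?a x)) =>
      apply: (@pf_comp _ _ _ _ _ _ _ f a H)
  end |
  lazymatch goal with
  | |- @pf _ _ _ _ _ (fun x => (@?a x, @?b x)) => apply: (@pf_pair _ _ _ _ _ _ _ a b)
  | |- @pf _ _ _ _ _ (fun x => (@?a x).1) => apply: (@pf_fst _ _ _ _ _ _ _ a)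
  | |- @pf _ _ _ _ _ (fun x => (@?a x).2) => apply: (@pf_snd _ _ _ _ _ _ _ a)
  | |- @pf _ _ _ _ _ (fun x => (@?a x).+1) => apply: (@pf_S _ _ _ a)
  | |- @pf _ _ _ _ _ (fun x => @?a x :: @?b x) => apply: (@pf_cons _ _ _ _ _ a b)
  | |- @pf _ _ _ _ _ (fun x => Some (@?a x)) => apply: (@pf_some _ _ _ _ _ a)
  end].
Ltac pfs := cbv beta; repeat first [assumption | pf_step | apply: pf_if].

(** * List functions, equality and finite case distinction in polynomial time *)

Section DerivedFunctions.

Variable Sigma : finType.
Notation pfn := (@pf Sigma _ _ _ _).

Lemma pf_sz X A {EX : Enc X} {EA : Enc A} (f : X -> A) : pfn f -> pb sz (fun x => sz (f x)).
Proof. by move=> [c [t [? ? ? ?]]]. Qed.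

Section Lists.

Context {X A B : Type} {EX : Enc X} {EA : Enc A} {EB : Enc B}.

Lemma foldl_catrev (s t : seq A) : foldl (fun b a => a :: b) t s = catrev s t.
Proof. by elim: s t => //= a s IH t; rewrite IH. Qed.

Lemma sz_catrev (s t : seq A) : (sz (catrev s t)).+1 = sz s + sz t.
Proof. by rewrite catrevE sz_cat sz_rev. Qed.

Lemma pf_catrev (f g : X -> seq A) : pfn f -> pfn g -> pfn (fun x => catrev (f x) (g x)).
Proof.
move=> Hf Hg; apply: (@pf_ext _ _ _ _ _ (fun x => foldl (fun b a => a :: b) (g x) (f x))).
  by move=> x; rewrite foldl_catrev.
apply: (@pf_foldl _ _ _ _ _ _ _ f g (fun x a b => a :: b) (fun x => sz (f x) + sz (g x))) => //.
- by pfs.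
- by have := pf_sz Hf; have := pf_sz Hg => ? ?; pbs.
move=> x i; rewrite foldl_catrev.
pose proof (sz_catrev (take i (f x)) (g x)); pose proof (sz_take (f x) i); lia.
Qed.

Lemma pf_rev (f : X -> seq A) : pfn f -> pfn (fun x => rev (f x)).
Proof. by move=> Hf; apply: pf_catrev => //; pfs. Qed.

Lemma pf_cat (f g : X -> seq A) : pfn f -> pfn g -> pfn (fun x => f x ++ g x).
Proof.
move=> Hf Hg; apply: (@pf_ext _ _ _ _ _ (fun x => catrev (rev (f x)) (g x))).
  by move=> x; rewrite catrevE revK.
by apply: pf_catrev => //; apply: pf_rev.
Qed.

Lemma pf_foldr (l : X -> seq A) (z : X -> B) (h : X -> A -> B -> B) (M : X -> nat) :
  pfn l -> pfn z -> pfn (fun p : X * (A * B) => h p.1 p.2.1 p.2.2) -> pb sz M ->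
  (forall x i, sz (foldr (h x) (z x) (drop i (l x))) <= M x) ->
  pfn (fun x => foldr (h x) (z x) (l x)).
Proof.
move=> Hl Hz Hh pM HM.
apply: (@pf_ext _ _ _ _ _ (fun x => foldl (fun b a => h x a b) (z x) (rev (l x)))).
  by move=> x; rewrite foldl_rev.
apply: (@pf_foldl _ _ _ _ _ _ _ _ z h M) => //; first exact: pf_rev.
by move=> x i; rewrite take_rev foldl_rev; apply: HM.
Qed.

End Lists.

Section Maps.

Context {X A B : Type} {EX : Enc X} {EA : Enc A} {EB : Enc B}.

Lemma pf_flatmap (l : X -> seq A) (f : X -> A -> seq B) :
  pfn l -> pfn (fun p : X * A => f p.1 p.2) -> pfn (fun x => flatten [seq f x a | a <- l x]).
Proof.
move=> Hl Hf.
have E x s t : foldl (fun b a => catrev (f x a) b) t s = catrev (flatten [seq f x a | a <- s]) t.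
  by elim: s t => //= a s IH t; rewrite IH !catrevE rev_cat catA.
apply: (@pf_ext _ _ _ _ _ (fun x => rev (foldl (fun b a => catrev (f x a) b) [::] (l x)))).
  by move=> x; rewrite E -/(rev _) revK.
have [k Hk] := pf_sz Hf.
apply: pf_rev; apply: (@pf_foldl _ _ _ _ _ _ _ l _ (fun x a b => catrev (f x a) b)
   (fun x => 1 + size (l x) * (sz x + sz (l x) + 3) ^ k)) => //; first by pfs.
- apply: pf_catrev; last by pfs.
  by apply: (@pf_comp _ _ _ _ _ _ _ (fun p => f p.1 p.2) (fun p => (p.1, p.2.1))) => //; pfs.
- have P := pf_sz Hl.
  have ? : pb sz (fun x => size (l x)) by apply: pb_le P => x; exact: ltnW (size_sz _).
  by pbs.
move=> x i; rewrite E -/(rev _) sz_rev.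
have H (s : seq A) : sz s <= sz (l x) -> sz (flatten [seq f x a | a <- s]) <= 1 + size s * (sz x + sz (l x) + 3) ^ k.
  elim: s => [|a s IH]; first by rewrite sz_nil.
  rewrite sz_cons => le /=; pose proof (sz_cat (f x a) (flatten [seq f x a | a <- s])).
  have := IH ltac:(lia); have := Hk (x, a); rewrite sz_pair /= => H1.
  have : ((sz x + sz a).+1 + 2) ^ k <= (sz x + sz (l x) + 3) ^ k.
    by case: (k) => // k'; rewrite leq_exp2r //; lia.
  by move: (_ ^ k) (_ ^ k) H1 => p q; lia.
apply: leq_trans (H _ (sz_take _ _)) _; rewrite leq_add2l leq_mul2r size_take_min; lia.
Qed.

Lemma pf_map (l : X -> seq A) (f : X -> A -> B) :
  pfn l -> pfn (fun p : X * A => f p.1 p.2) -> pfn (fun x => [seq f x a | a <- l x]).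
Proof.
move=> Hl Hf; apply: (@pf_ext _ _ _ _ _ (fun x => flatten [seq [:: f x a] | a <- l x])).
  by move=> x; elim: (l x) => //= a s ->.
by apply: (@pf_flatmap l (fun x a => [:: f x a])) => //; pfs.
Qed.

End Maps.

Section Lists2.

Context {X A B : Type} {EX : Enc X} {EA : Enc A} {EB : Enc B}.

Lemma pf_filter (l : X -> seq A) (c : X -> pred A) :
  pfn l -> pfn (fun p : X * A => c p.1 p.2) -> pfn (fun x => [seq a <- l x | c x a]).
Proof.
move=> Hl Hc; apply: (@pf_ext _ _ _ _ _ (fun x => flatten [seq if c x a then [:: a] else [::] | a <- l x])).
  by move=> x; elim: (l x) => //= a s ->; case: ifP.
by apply: (@pf_flatmap _ _ _ _ _ _ l (fun x a => if c x a then [:: a] else [::])) => //; pfs.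
Qed.

Lemma pf_head (d : X -> A) (l : X -> seq A) : pfn d -> pfn l -> pfn (fun x => head (d x) (l x)).
Proof.
by move=> Hd Hl; apply: (@pf_case _ _ _ _ _ _ _ l d (fun x a _ => a)) => //; pfs.
Qed.

Lemma pf_behead (l : X -> seq A) : pfn l -> pfn (fun x => behead (l x)).
Proof.
by move=> Hl; apply: (@pf_case _ _ _ _ _ _ _ l (fun _ => [::]) (fun x _ l => l)) => //; pfs.
Qed.

Lemma pf_drop_const (l : X -> seq A) n : pfn l -> pfn (fun x => drop n (l x)).
Proof.
move=> Hl; elim: n => [|n IH]; first by apply: (pf_ext _ Hl) => x; rewrite drop0.
by apply: (pf_ext _ (pf_behead IH)) => x; rewrite -drop1 drop_drop.
Qed.

Lemma pf_nth_const (d : A) (l : X -> seq A) n : pfn l -> pfn (fun x => nth d (l x) n).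
Proof.
move=> Hl; apply: (@pf_ext _ _ _ _ _ (fun x => head d (drop n (l x)))).
  by move=> x; rewrite -nth0 nth_drop addn0.
by apply: pf_head; [exact: pf_const|exact: pf_drop_const].
Qed.

Lemma pf_nilp (l : X -> seq A) : pfn l -> pfn (fun x => nilp (l x)).
Proof.
move=> Hl; apply: (@pf_ext _ _ _ _ _ (fun x => if l x is _ :: _ then false else true)).
  by move=> x; case: (l x).
by apply: (@pf_case _ _ _ _ _ _ _ l _ (fun _ _ _ => false)) => //; pfs.
Qed.

Lemma pf_negb (c : X -> bool) : pfn c -> pfn (fun x => ~~ c x).
Proof. by move=> Hc; apply: (@pf_ext _ _ _ _ _ (fun x => if c x then false else true)) => //; pfs. Qed.

Lemma pf_andb (c c' : X -> bool) : pfn c -> pfn c' -> pfn (fun x => c x && c' x).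
Proof. by move=> Hc Hc'; apply: (@pf_if _ _ _ _ _ c c' (fun _ => false)); pfs. Qed.

Lemma pf_has (l : X -> seq A) (c : X -> pred A) :
  pfn l -> pfn (fun p : X * A => c p.1 p.2) -> pfn (fun x => has (c x) (l x)).
Proof.
move=> Hl Hc; apply: (@pf_ext _ _ _ _ _ (fun x => ~~ nilp [seq a <- l x | c x a])).
  by move=> x; rewrite has_count -size_filter lt0n.
by apply: pf_negb; apply: pf_nilp; apply: pf_filter.
Qed.

Lemma pf_all (l : X -> seq A) (c : X -> pred A) :
  pfn l -> pfn (fun p : X * A => c p.1 p.2) -> pfn (fun x => all (c x) (l x)).
Proof.
move=> Hl Hc; apply: (@pf_ext _ _ _ _ _ (fun x => nilp [seq a <- l x | ~~ c x a])).
  by move=> x; rewrite -[all _ _]negbK -has_predC has_count -size_filter lt0n negbK.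
apply: pf_nilp; apply: (@pf_filter l (fun x a => ~~ c x a)) => //.
by apply: (@pf_ext _ _ _ _ _ (fun p => if c p.1 p.2 then false else true)) => //; pfs.
Qed.

Lemma pf_size (l : X -> seq A) : pfn l -> pfn (fun x => size (l x)).
Proof.
move=> Hl; apply: (@pf_ext _ _ _ _ _ (fun x => foldl (fun b a => b.+1) 0 (l x))).
  move=> x; suff H n s : foldl (fun (b : nat) (a : A) => b.+1) n s = n + size s by rewrite H.
  by elim: s n => [|a s IH] n /=; rewrite ?addn0 // IH addnS.
apply: (@pf_foldl _ _ _ _ _ _ _ l _ (fun _ _ b => b.+1) (fun x => 2 * sz (l x))) => //.
- by pfs.
- by pfs.
- by have P := pf_sz Hl; pbs.
move=> x i; have -> s n : foldl (fun (b : nat) (a : A) => b.+1) n s = n + size s.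
  by elim: s n => [|a s IH] n /=; rewrite ?addn0 // IH addnS.
rewrite add0n sz_nat size_take_min; pose proof (size_sz (l x)); lia.
Qed.

End Lists2.

Section TreeEquality.

(** Equality of trees without recursion: the list holds the pairs still to be compared, and a
    mismatch empties it. *)
Definition teq_step (s : seq (btree * btree) * bool) : seq (btree * btree) * bool :=
  if s.1 is p :: w then
    if p.1 is Nd a b then
      if p.2 is Nd c d then ([:: (a, c), (b, d) & w], s.2) else ([::], false)
    else if p.2 is Nd c d then ([::], false) else (w, s.2)
  else s.

Lemma pf_teq_step : pfn teq_step.
Proof.
apply: (@pf_case _ _ _ _ _ _ _ (fun s => s.1) id (fun s p w =>
  if p.1 is Nd a b then
      if p.2 is Nd c d then ([:: (a, c), (b, d) & w], s.2) else ([::], false)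
    else if p.2 is Nd c d then ([::], false) else (w, s.2))); try by pfs.
apply: (@pf_tcase _ _ _ _ _ (fun p => p.2.1.1) _ (fun p a b =>
  if p.2.1.2 is Nd c d then ([:: (a, c), (b, d) & p.2.2], p.1.2) else ([::], false))).
- by pfs.
- by apply: (@pf_tcase _ _ _ _ _ (fun p => p.2.1.2) _ (fun p c d => ([::], false))); pfs.
apply: (@pf_tcase _ _ _ _ _ (fun p => p.1.2.1.2) _
  (fun p c d => ([:: (p.2.1, c), (p.2.2, d) & p.1.2.2], p.1.1.2))); by pfs.
Qed.

(** Each round removes at least one node from the first components, which bounds the rounds;
    splitting a pair leaves the size of the state unchanged. *)
Lemma iter_teq_step n s :
  \sum_(p <- s.1) csize p.1 <= n ->
  iter n teq_step s = ([::], s.2 && all (fun p => p.1 == p.2) s.1) /\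
  forall i, sz (iter i teq_step s) <= sz s + 2.
Proof.
elim: n s => [|n IH] [[|[a b] w] r] le //=.
- split; first by rewrite andbT.
  by elim=> [|i IHi] /=; [lia|rewrite (_ : iter i _ _ = ([::], r)); [rewrite /sz /=; lia|elim: i {IHi} => //= i ->]].
- by move: le; rewrite big_cons /=; case: a => [|? ?]; rewrite ?csize_Nd.
- have E m : iter m teq_step ([::], r) = ([::], r) by elim: m => //= m ->.
  by rewrite -iterS E andbT; split=> // i; rewrite E; lia.
move: le; rewrite big_cons /= => le.
have [b0|[a0|[s' [E sE vE szE]]]] : (a = Lf /\ exists b1 b2, b = Nd b1 b2) \/
   ((b = Lf /\ exists a1 a2, a = Nd a1 a2) \/
   exists s', [/\ teq_step ((a, b) :: w, r) = s', \sum_(p <- s'.1) csize p.1 <= n,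
     s'.2 && all (fun p => p.1 == p.2) s'.1 = [&& r, a == b & all (fun p => p.1 == p.2) w] &
     sz s' <= sz ((a, b) :: w, r)]).
  case: a b le => [|a1 a2] [|b1 b2] le.
  - right; right; exists (w, r); split=> //=.
    by rewrite !sz_pair /= sz_cons; lia.
  - by left; split=> //; exists b1, b2.
  - by right; left; split=> //; exists a1, a2.
  right; right; exists ([:: (a1, b1), (a2, b2) & w], r); split=> //=.
  - by rewrite !big_cons /=; move: le; rewrite csize_Nd; lia.
  - by rewrite [Nd _ _ == _]/(_ && _) -!andbA.
  - by rewrite !sz_pair !sz_cons !sz_pair /= /sz /= !csize_Nd; lia.
- case: b0 => -> [b1 [b2 ->]].
  have E m : iter m.+1 teq_step ((Lf, Nd b1 b2) :: w, r) = ([::], false).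
    by rewrite iterSr /=; elim: m => //= m ->.
  rewrite -iterS E /= andbF; split=> // -[|i]; first exact: leq_addr.
  by rewrite E -[X in X <= _]/3 sz_pair; pose proof (sz_gt0 ((Lf, Nd b1 b2) :: w)); pose proof (sz_gt0 r); rewrite /=; lia.
- case: a0 => -> [b1 [b2 ->]].
  have E m : iter m.+1 teq_step ((Nd b1 b2, Lf) :: w, r) = ([::], false).
    by rewrite iterSr /=; elim: m => //= m ->.
  rewrite -iterS E /= andbF; split=> // -[|i]; first exact: leq_addr.
  by rewrite E -[X in X <= _]/3 sz_pair; pose proof (sz_gt0 ((Nd b1 b2, Lf) :: w)); pose proof (sz_gt0 r); rewrite /=; lia.
have [E1 E2] := IH s' sE; rewrite -iterS iterSr E E1 vE; split=> // -[|i]; first exact: leq_addr.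
by rewrite iterSr E; apply: leq_trans (E2 i) _; rewrite leq_add2r.
Qed.

Lemma pf_eq X (A : eqType) {EX : Enc X} {EA : Enc A} (f g : X -> A) :
  pfn f -> pfn g -> pfn (fun x => f x == g x).
Proof.
move=> Hf Hg; pose init x := ([:: (@enc A EA (f x), @enc A EA (g x))], true).
have S x : \sum_(p <- (init x).1) csize p.1 <= sz (f x) by rewrite big_seq1.
apply: (@pf_ext _ _ _ _ _ (fun x => (iter (sz (f x)) teq_step (init x)).2)).
  move=> x; have [-> _] := iter_teq_step (S x); rewrite /= andbT.
  by apply/eqP/eqP => [|-> //]; apply: enc_inj.
apply: (@pf_loop _ _ _ _ _ _ _ _ _ _ (fun x => sz (init x) + 2)).
- by apply: pf_pair; [apply: pf_cons; [apply: pf_pair; apply: pf_tree|]|]; pfs.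
- exact: pf_teq_step.
- exact: pf_sz Hf.
- have P1 := pf_sz Hf; have P2 := pf_sz Hg.
  apply: (@pb_le _ _ _ (fun x => sz (f x) + sz (g x) + 10)); last by pbs.
  by move=> x; rewrite sz_pair /= sz_cons sz_nil sz_pair /= (_ : sz true = 3) // /sz /=; lia.
- by move=> [[|p w] r].
- by move=> x; have [-> _] := iter_teq_step (S x).
- by move=> x i _; have [_ ->] := iter_teq_step (S x).
Qed.

End TreeEquality.

Section Lists3.

Context {X : Type} {A : eqType} {B : Type} {EX : Enc X} {EA : Enc A} {EB : Enc B}.

Lemma pf_mem (f : X -> A) (l : X -> seq A) : pfn f -> pfn l -> pfn (fun x => f x \in l x).
Proof.
move=> Hf Hl; apply: (@pf_ext _ _ _ _ _ (fun x => has (fun a => a == f x) (l x))).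
  by move=> x; rewrite has_pred1.
apply: (@pf_has _ _ _ _ l (fun x a => a == f x)) => //; apply: pf_eq; by pfs.
Qed.

End Lists3.

Section Lists4.

Context {X : Type} {A : eqType} {B : Type} {EX : Enc X} {EA : Enc A} {EB : Enc B}.

Lemma sz_undup_le (s : seq A) : sz (undup s) <= sz s.
Proof. by elim: s => //= a s IH; case: ifP; rewrite !sz_cons; lia. Qed.

Lemma pf_undup (l : X -> seq A) : pfn l -> pfn (fun x => undup (l x)).
Proof.
move=> Hl; pose h (a : A) b := if a \in b then b else a :: b.
have E s : foldr h [::] s = undup s by elim: s => //= a s ->; rewrite /h mem_undup.
apply: (@pf_ext _ _ _ _ _ (fun x => foldr h [::] (l x))) => [x|]; first exact: E.
apply: (@pf_foldr _ _ _ _ _ _ l _ (fun _ => h) (fun x => sz (l x))) => //.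
- by pfs.
- by apply: pf_if; [apply: pf_mem|..]; pfs.
- exact: pf_sz Hl.
- by move=> x i; rewrite E; apply: leq_trans (sz_undup_le _) (sz_drop _ _).
Qed.

Lemma pf_index (f : X -> A) (l : X -> seq A) : pfn f -> pfn l -> pfn (fun x => index (f x) (l x)).
Proof.
move=> Hf Hl; pose h x (a : A) (n : nat) := if a == f x then 0 else n.+1.
have E x s : foldr (h x) 0 s = index (f x) s.
  by elim: s => //= a s ->; rewrite /h /index /=.
apply: (@pf_ext _ _ _ _ _ (fun x => foldr (h x) 0 (l x))) => [x|]; first exact: E.
apply: (@pf_foldr _ _ _ _ _ _ l _ h (fun x => 2 * sz (l x) + 1)) => //.
- by pfs.
- by apply: pf_if; [apply: pf_eq|..]; pfs.
- by have P := pf_sz Hl; pbs.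
- move=> x i; rewrite E sz_nat; pose proof (index_size (f x) (drop i (l x))) as P.
  by rewrite size_drop in P; pose proof (size_sz (l x)); lia.
Qed.

(** For symbols and letters the program itself depends on the datum, for instance through an arity;
    it is selected at run time by comparing with the elements of [T] in turn. *)
Lemma pf_fincase (T : finType) (f : X -> T) (h : T -> X -> B) :
  @pf Sigma _ _ _ (enc_fin T) f -> (forall t, pfn (h t)) -> pfn (fun x => h (f x) x).
Proof.
move=> Hf Hh.
suff H : forall (s : seq T) (d : T), @pf Sigma X B EX EB (fun x => if f x \in s then h (f x) x else h d x).
  case: (pickP (@predT T)) => [d _|T0].
    move: (H (enum T) d); apply: pf_ext; by move=> x; rewrite mem_enum.
  (* If [T] is empty, so is [X], and any program will do. *)
  case: Hf => [c [t [nc pt ps Hr]]]; exists c, t; split=> // [|x]; last by have := T0 (f x).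
  by exists 0 => x; have := T0 (f x).
move=> s d; elim: s => [|a s IH]; first exact: Hh.
apply: (@pf_ext _ _ _ _ _ (fun x => if f x == a then h a x else if f x \in s then h (f x) x else h d x)).
  by move=> x; rewrite inE; case: eqP => [->|].
apply: pf_if => //; apply: (@pf_eq _ _ _ (enc_fin T)) => //; exact: pf_const.
Qed.

End Lists4.

End DerivedFunctions.

(** * Depth and size of terms *)

Section TermFacts.

Variable S : signature.
Implicit Types (s t : term S) (f g : symbol S).

Lemma App_symbol f g (a : args f) (b : args g) : App f a = App g b -> f = g.
Proof. by case. Qed.

Lemma App_args f (a b : args f) : App f a = App f b -> a = b.
Proof.
move=> E; injection E => e; apply: inj_pair2_eq_dec e; exact: eq_comparable.
Qed.

Lemma value_App f (a : args f) :
  value (App f a) = ~~ defined f && [forall i, value (a i)].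
Proof.
apply/subsetP/andP => [H|[df /forallP H] g].
  split; first by apply: H; rewrite /= inE set11.
  by apply/forallP => i; apply/subsetP => g gi; apply: H; rewrite /= inE; apply/orP; right;
    apply/bigcupP; exists i.
by rewrite /= !inE => /orP[/eqP-> //|/bigcupP[i _ gi]]; move/subsetP: (H i) => /(_ _ gi).
Qed.

(** A term with a defined root has depth 0: a call on which the machine gives up then satisfies
    every depth bound. *)
Fixpoint depth t : nat :=
  match t with
  | Var _ => 0
  | App f a => if defined f then 0 else (\max_i depth (a i)).+1
  end.

Fixpoint term_size t : nat :=
  match t with Var _ => 1 | App f a => (\sum_i term_size (a i)).+1 end.

Lemma term_size_gt0 t : 0 < term_size t.
Proof. by case: t. Qed.

Lemma depth_arg f (a : args f) i : ~~ defined f -> depth (a i) < depth (App f a).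
Proof.
by move=> /= /negbTE->; rewrite ltnS; apply: (leq_bigmax (F := fun i => depth (a i))).
Qed.

End TermFacts.

(** * Multisets of depths ranked by numbers *)

Section MultisetRank.

(** The geometric sum of the powers of [B] with exponents below [k]. *)
Fixpoint geom (B k : nat) : nat := if k is k'.+1 then geom B k' + B ^ k' else 0.

Lemma geom_lt B k : geom B.+1 k * B < B.+1 ^ k.
Proof. by elim: k => //= k; rewrite expnS; move: (_ ^ k) (geom _ _) => p q; nia. Qed.

Lemma geom_mono B k j : k <= j -> geom B k <= geom B j.
Proof. by move/subnK <-; elim: (j - k) => //= i; rewrite addnC; lia. Qed.

(* Reads the elements of M, in decreasing order, as the digits of a number in
   base D + 2; a strict multiset descent makes the first changed digit smaller.
   The digits are summed column by column, so that nothing has to be sorted. *)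
Definition mrank (A D : nat) (M : seq nat) : nat :=
  \sum_(j < D.+1) (geom D.+2 A - geom D.+2 (A - count (leq j) M)).

Lemma mrank_lt A D M M' m :
  size M <= A -> size M' <= A -> m <= D ->
  count (leq m) M' < count (leq m) M ->
  (forall j, m < j -> count (leq j) M' = count (leq j) M) ->
  mrank A D M' < mrank A D M.
Proof.
move=> sM sM' mD lt eqj; set n := count (leq m) M' in lt.
have nA : n < A by apply: leq_trans lt (leq_trans (count_size _ _) sM).
set q := geom D.+2 (A - n.+1); set h := D.+2 ^ (A - n.+1).
have qh : q * D.+1 < h := geom_lt _ _.
have gA k : geom D.+2 (A - k) <= geom D.+2 A by apply: geom_mono; lia.
have gn : geom D.+2 (A - n) = q + h by rewrite -(subnSK nA).
(* Column [m] shrinks by at least [h], the columns above it are unchanged, and those below grow by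
   at most [q] each. There are [D.+1] columns, so [qh] makes the loss prevail. *)
have pt (j : 'I_D.+1) : geom D.+2 A - geom D.+2 (A - count (leq j) M') + (j == m :> nat) * h <=
          geom D.+2 A - geom D.+2 (A - count (leq j) M) + q.
  have mon k : n < k -> geom D.+2 (A - k) <= q by move=> ?; apply: geom_mono; lia.
  case: (ltngtP j m) => jm.
  - have := mon (count (leq j) M); have : count (leq m) M <= count (leq j) M.
      by apply: sub_count => x /=; lia.
    move=> le /(_ (leq_trans lt le)); have := gA (count (leq j) M); lia.
  - by rewrite eqj //; lia.
  rewrite jm -/n gn; have := mon _ lt; have := gA (count (leq m) M); have := gA n; rewrite gn; lia.
have : mrank A D M' + h <= mrank A D M + D.+1 * q.
  rewrite -[in X in _ <= _ + X](card_ord D.+1) -sum_nat_const -big_split /=.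
  rewrite (_ : h = \sum_(j < D.+1) (j == m :> nat) * h); last first.
    rewrite (bigD1 (Ordinal (mD : m < D.+1))) //= eqxx mul1n big1 ?addn0 //.
    by move=> i /negbTE; rewrite -val_eqE /= => ->.
  by rewrite -big_split /=; apply: leq_sum => j _.
lia.
Qed.

Lemma mrank_bound A D M : mrank A D M < (D + 2) ^ (A + 1).
Proof.
have := geom_lt D.+1 A; rewrite addn1 addn2 expnS => H.
have : mrank A D M <= D.+1 * geom D.+2 A.
  by rewrite -[X in X * _](card_ord D.+1) -sum_nat_const; apply: leq_sum => j _; apply: leq_subr.
move: (_ ^ A) (geom _ _) (mrank _ _ _) H => p q r; nia.
Qed.

Lemma max_in_seq (T : eqType) (dep : T -> nat) (X : seq T) :
  X != [::] -> exists2 x0, x0 \in X & forall x, x \in X -> dep x <= dep x0.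
Proof.
elim: X => // a [|b X] IH _; first by exists a; rewrite ?inE // => x; rewrite inE => /eqP->.
have [x0 x0in H] := IH isT; case: (leqP (dep a) (dep x0)) => le.
  by exists x0; [rewrite inE x0in orbT|move=> x; rewrite inE => /orP[/eqP->|/H]].
exists a; first by rewrite inE eqxx.
by move=> x; rewrite inE => /orP[/eqP->|/H] //; lia.
Qed.

Lemma mul_gt_rank (T : eqType) (gt eq : T -> T -> Prop) (dep : T -> nat) A D M M' :
  mul_gt gt eq M M' ->
  (forall x y, x \in M -> gt x y -> dep y < dep x) ->
  (forall x y, x \in M -> eq x y -> dep x = dep y) ->
  (forall x, x \in M -> dep x <= D) ->
  size M <= A -> size M' <= A ->
  mrank A D (map dep M') < mrank A D (map dep M).
Proof.
case=> X [Y [Z [X0 pM pM' HZ HY]]] Hgt Heq HD sM sM'.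
have inM x : x \in X -> x \in M by rewrite (perm_mem pM) mem_cat => ->.
have inZ z : z \in Z -> z.1 \in M.
  by move=> zZ; rewrite (perm_mem pM) mem_cat [X in _ || X](map_f fst zZ) orbT.
have cE (p : pred nat) : count p (map dep M) = count p (map dep X) + count p (map dep (unzip1 Z)).
  by rewrite -count_cat -map_cat; apply/permP; apply: perm_map.
have cE' (p : pred nat) : count p (map dep M') = count p (map dep Y) + count p (map dep (unzip2 Z)).
  by rewrite -count_cat -map_cat; apply/permP; apply: perm_map.
have ZE : map dep (unzip1 Z) = map dep (unzip2 Z).
  rewrite -!map_comp; apply/eq_in_map => z zZ /=; exact: Heq (inZ _ zZ) (HZ _ zZ).
(* The largest depth in [X] is the critical level: [Y] lies strictly below it, so the count drops
   there and does not change above. *)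
have [x0 x0X mx] := max_in_seq dep X0.
have Y0 j : dep x0 <= j -> count (leq j) (map dep Y) = 0.
  move=> le; apply/eqP; rewrite -leqn0 leqNgt -has_count; apply/hasPn => _ /mapP[y /HY[x [xX gxy]] ->].
  by have := Hgt _ _ (inM _ xX) gxy; have := mx _ xX; lia.
apply: (@mrank_lt _ _ _ _ (dep x0)); rewrite ?size_map //; first exact: HD (inM _ x0X).
- rewrite cE cE' ZE Y0 // add0n -addn1 addnC leq_add2r -has_count.
  by apply/hasP; exists (dep x0) => //; apply: map_f.
- move=> j lt; rewrite cE cE' ZE Y0; last by lia.
  rewrite (_ : count _ (map dep X) = 0) //; apply/eqP; rewrite -leqn0 leqNgt -has_count.
  by apply/hasPn => _ /mapP[y /mx le ->]; lia.
Qed.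

Lemma mul_gt_ge (T : eqType) (gt eq : T -> T -> Prop) M M' :
  mul_gt gt eq M M' -> mul_ge gt eq M M'.
Proof. by case=> X [Y [Z [_ ? ? ? ?]]]; exists X, Y, Z. Qed.

Lemma mul_ge_dominated (T : eqType) (gt eq : T -> T -> Prop) M M' :
  mul_ge gt eq M M' ->
  forall y, y \in M' -> exists2 x, x \in M & gt x y \/ eq x y.
Proof.
case=> X [Y [Z [pM pM' HZ HY]]] y; rewrite (perm_mem pM') mem_cat => /orP[/HY|].
  by case=> x [xX g]; exists x; [rewrite (perm_mem pM) mem_cat xX|left].
case/mapP=> z zZ ->; exists z.1; last by right; apply: HZ.
by rewrite (perm_mem pM) mem_cat [X in _ || X](map_f fst zZ) orbT.
Qed.

End MultisetRank.

(** * A stack machine on terms *)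

Section TermMachine.

Variables (S : signature) (R : trs S).
Implicit Types (s t : term S) (f g : symbol S) (sigma : nat -> term S).

(* (None, t) pushes t, (Some g, _) replaces the topmost arguments of g. *)
Definition tinstr : Type := option (symbol S) * term S.
Definition tstate : Type := seq tinstr * seq (term S).

Definition mk_app g (vs : seq (term S)) : term S :=
  App g [ffun i : 'I_(arity g) => nth (Var 0) vs i].

(** Postfix code with the arguments from last to first, so that the first one ends on top. The value
    of a variable is pushed as it is and never evaluated again. *)
Fixpoint term_code sigma t : seq tinstr :=
  match t with
  | Var x => [:: (None, sigma x)]
  | App g b => flatten [seq term_code sigma (b i) | i <- rev (enum 'I_(arity g))]
               ++ [:: (Some g, Var 0)]
  end.

(* The machine may give up on a redex here, which only adds runs. *)
Inductive tstep : tstate -> tstate -> Prop :=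
| tstep_val t c vs : tstep ((None, t) :: c, vs) (c, t :: vs)
| tstep_stuck g t c vs :
    tstep ((Some g, t) :: c, vs)
          (c, mk_app g (take (arity g) vs) :: drop (arity g) vs)
| tstep_rule g t c vs l r sigma :
    (l, r) \in R -> subst sigma l = mk_app g (take (arity g) vs) ->
    tstep ((Some g, t) :: c, vs) (term_code sigma r ++ c, drop (arity g) vs).

(** Failing runs count for [polytime] too, hence all runs are required to end within [k] steps. *)
Fixpoint must (k : nat) (st : tstate) (Q : seq (term S) -> Prop) : Prop :=
  match st.1, k with
  | [::], _ => Q st.2
  | _, 0 => False
  | _, k'.+1 => forall st', tstep st st' -> must k' st' Q
  end.

Lemma must_mono k k' st (Q Q' : seq (term S) -> Prop) :
  must k st Q -> k <= k' -> (forall vs, Q vs -> Q' vs) -> must k' st Q'.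
Proof.
move=> H le QQ; elim: k k' st H le => [|k IH] [|k'] [[|i c] vs] //=; try by auto.
Qed.

Lemma tstep_cat i c c' vs st' : tstep (i :: c ++ c', vs) st' ->
  exists2 st0, tstep (i :: c, vs) st0 & st' = (st0.1 ++ c', st0.2).
Proof.
move E: (i :: c ++ c', vs) => st0 H; case: H E => [t d ws|g t d ws|g t d ws l r sg lr e].
- by case=> -> <- ->; exists (c, t :: ws) => //; constructor.
- by case=> -> <- ->; eexists; [apply: tstep_stuck|].
- by case=> -> <- ->; eexists; [apply: tstep_rule lr e|rewrite /= catA].
Qed.

Lemma must_cat k k' c c' vs (Q Q' : seq (term S) -> Prop) :
  must k (c, vs) Q -> (forall vs', Q vs' -> must k' (c', vs') Q') ->
  must (k + k') (c ++ c', vs) Q'.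
Proof.
move=> H H'; elim: k c vs H => [|k IH] [|i c] vs //=; first exact: H'.
  by move=> /H' H; apply: (@must_mono k' (k.+1 + k') (c', vs) Q' Q') => //; lia.
move=> H st' /tstep_cat[[d ws] /H H1 ->]; exact: IH.
Qed.

(** The stack below the result is arbitrary, which lets the evaluations of several arguments be
    composed. *)
Definition evq k sigma t (Q : term S -> Prop) : Prop :=
  forall vs, must k (term_code sigma t, vs) (fun vs' => exists2 w, vs' = w :: vs & Q w).

Definition callq k g (w : 'I_(arity g) -> term S) (Q : term S -> Prop) : Prop :=
  forall vs t, must k ([:: (Some g, t)], [seq w i | i <- enum 'I_(arity g)] ++ vs)
                    (fun vs' => exists2 u, vs' = u :: vs & Q u).

Lemma mk_app_enum g (w : 'I_(arity g) -> term S) :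
  mk_app g [seq w i | i <- enum 'I_(arity g)] = App g [ffun i => w i].
Proof.
congr App; apply/ffunP => i; rewrite !ffunE (nth_map i) ?size_enum_ord //.
by rewrite nth_ord_enum.
Qed.

Lemma take_drop_enum g (w : 'I_(arity g) -> term S) vs :
  let us := [seq w i | i <- enum 'I_(arity g)] in
  take (arity g) (us ++ vs) = us /\ drop (arity g) (us ++ vs) = vs.
Proof.
have sz : size [seq w i | i <- enum 'I_(arity g)] = arity g by rewrite size_map size_enum_ord.
by split; rewrite -{1}sz ?take_size_cat ?drop_size_cat.
Qed.

Lemma evq_mono k k' sigma t (Q Q' : term S -> Prop) :
  evq k sigma t Q -> k <= k' -> (forall u, Q u -> Q' u) -> evq k' sigma t Q'.
Proof. by move=> H le QQ vs; apply: must_mono (H vs) le _ => vs' [u -> /QQ]; exists u. Qed.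

Lemma callq_mono k k' g w (Q Q' : term S -> Prop) :
  @callq k g w Q -> k <= k' -> (forall u, Q u -> Q' u) -> callq k' w Q'.
Proof. by move=> H le QQ vs t; apply: must_mono (H vs t) le _ => vs' [u -> /QQ]; exists u. Qed.

Lemma callq_ext k g w w' Q : w =1 w' -> @callq k g w Q -> @callq k g w' Q.
Proof. by move=> E H vs t; rewrite -(eq_map E); apply: H. Qed.

(** The first premise is for the run that gives up on the call, the second for those that apply a
    rule. *)
Lemma callqI k g (w : 'I_(arity g) -> term S) (Q : term S -> Prop) :
  Q (App g [ffun i => w i]) ->
  (forall l r sigma, (l, r) \in R -> subst sigma l = App g [ffun i => w i] -> evq k sigma r Q) ->
  callq k.+1 w Q.
Proof.
move=> H1 H2 vs t /= st'; have [tE dE] := take_drop_enum w vs.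
move E: ([:: (Some g, t)], _) => st0 H; case: H E => // [g' t' c ws|g' t' c ws l r sg lr e].
- case=> eg _ <- <-; subst g'; rewrite tE dE mk_app_enum; case: (k) => [|k'] /=;
  by exists (App g [ffun i => w i]).
- case=> eg _ <- ews; subst g' ws; rewrite tE mk_app_enum in e; rewrite dE cats0.
  exact: H2 lr e vs.
Qed.

Lemma evq_var sigma x : evq 1 sigma (Var x) (eq (sigma x)).
Proof.
move=> vs /= st'; move E: ([:: _], vs) => st0 H; case: H E => // t c ws [-> <- ->] /=.
by exists t.
Qed.

Lemma evq_app sigma g (k : 'I_(arity g) -> nat) m (b : args g) (Qa : 'I_(arity g) -> term S -> Prop) Q :
  (forall i, evq (k i) sigma (b i) (Qa i)) ->
  (forall w : 'I_(arity g) -> term S, (forall i, Qa i (w i)) -> callq m w Q) ->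
  evq (\sum_i k i + m) sigma (App g b) Q.
Proof.
move=> Hb Hc vs /=; apply: (must_cat (Q := fun vs' =>
  exists2 w : 'I_(arity g) -> term S, (forall i, Qa i (w i)) &
     vs' = [seq w i | i <- enum 'I_(arity g)] ++ vs)); last first.
  by move=> _ [w Hw ->]; apply: Hc.
(* Without repetitions in [s] the values found one after the other combine into a single function
   [w]. *)
have H (s : seq 'I_(arity g)) us : uniq s ->
    must (\sum_(i <- s) k i) (flatten [seq term_code sigma (b i) | i <- s], us)
      (fun vs' => exists2 w : 'I_(arity g) -> term S, {in s, forall i, Qa i (w i)} &
         vs' = [seq w i | i <- rev s] ++ us).
  elim: s us => [|i s IH] us /=.
    by move=> _; rewrite big_nil; exists (fun _ => Var 0).
  case/andP=> iNs us'; rewrite big_cons; apply: must_cat (Hb i us) _.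
  move=> _ [u -> Qu]; apply: must_mono (IH (u :: us) us') (leqnn _) _ => _ [w Hw ->].
  exists (fun j => if j == i then u else w j).
    move=> j; rewrite inE; case: eqP => [-> //|_]; exact: Hw.
  rewrite rev_cons map_rcons eqxx cat_rcons; congr (_ ++ _).
  apply/eq_in_map => j; rewrite mem_rev => js; case: eqP => // ji; move: iNs.
  by rewrite -ji js.
have := H (rev (enum 'I_(arity g))) vs; rewrite rev_uniq enum_uniq => /(_ isT).
move=> H1; apply: must_mono H1 _ _.
  by rewrite (perm_big _ (permEl (perm_rev _))) /= big_enum.
move=> _ [w Hw ->]; exists w; last by rewrite revK.
by move=> i; apply: Hw; rewrite mem_rev mem_enum.
Qed.

Hypothesis hR : constructor_trs R.

Lemma rule_lhs l r sigma g (a : args g) :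
  (l, r) \in R -> subst sigma l = App g a ->
  exists b : args g, [/\ l = App g b, defined g, forall i, value (b i)
                       & forall i, a i = subst sigma (b i)].
Proof.
move=> /hR; case: l => [x|f b] //= /andP[df /forallP vb] e.
have ef := App_symbol e; subst f; move/App_args: e => <-.
by exists b; split=> // i; rewrite ffunE.
Qed.

Lemma callq_constructor g (w : 'I_(arity g) -> term S) :
  ~~ defined g -> callq 1 w (eq (App g [ffun i => w i])).
Proof.
move=> dg; apply: callqI => // l r sg lr /(rule_lhs lr)[b [_]].
by rewrite (negbTE dg).
Qed.

(** Left-hand sides have a defined root, so no rule matches while a value is rebuilt and each of its
    symbols costs one step. *)
Lemma evq_value sigma t : value t -> evq (term_size t) sigma t (eq (subst sigma t)).
Proof.
elim: t => [x _|f a IH]; first exact: evq_var.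
rewrite value_App => /andP[df /forallP va]; rewrite /= -addn1.
apply: (@evq_app _ _ _ _ _ (fun i => eq (subst sigma (a i)))) => [i|w Hw]; first exact: IH.
apply: callq_mono (@callq_constructor _ w df) (leqnn _) _ => _ <-.
by congr App; apply/ffunP => i; rewrite !ffunE Hw.
Qed.

End TermMachine.

(** * Polynomial bound on the evaluation of predicative recursive systems *)

Lemma leq_pow_mulr n c D : n * (D + 2) ^ c <= (D + 2) ^ (n + c).
Proof.
rewrite expnD leq_mul2r; apply/orP; right; apply: (@leq_trans (2 ^ n)).
  by apply: ltnW; apply: ltn_expl.
by case: n => // n; rewrite leq_exp2r //; lia.
Qed.

Lemma leq_pow_add a b D : (D + 2) ^ a + (D + 2) ^ b <= (D + 2) ^ (a + b + 1).
Proof.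
have := @leq_pow2 D a (a + b); have := @leq_pow2 D b (a + b).
rewrite addn1 expnS leq_addr leq_addl => /(_ isT) + /(_ isT).
move: (_ ^ (a + b)) (_ ^ a) (_ ^ b) => p q r; nia.
Qed.

Lemma leq_pow_cst n D : n <= (D + 2) ^ n.
Proof. by have := leq_pow_mulr n 0 D; rewrite muln1 addn0. Qed.

Lemma leq_pow_id c D : 0 < c -> D <= (D + 2) ^ c.
Proof. by move=> c0; apply: leq_trans (leq_pow2 D c0); rewrite expn1; lia. Qed.

(** Turns exponents found separately for each argument into a uniform one, their maximum. *)
Lemma fin_bound (T : finType) (P : T -> nat -> Prop) :
  (forall i c c', P i c -> c <= c' -> P i c') ->
  (forall i, exists c, P i c) -> exists c, forall i, P i c.
Proof.
move=> mono /fin_all_exists[c Hc]; exists (\max_i c i) => i.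
by apply: mono (Hc i) _; apply: leq_bigmax.
Qed.

Lemma seq_bound (T : eqType) (s : seq T) (P : T -> nat -> Prop) :
  (forall i c c', P i c -> c <= c' -> P i c') ->
  (forall i, i \in s -> exists c, P i c) -> exists c, forall i, i \in s -> P i c.
Proof.
move=> mono; elim: s => [|a s IH] H; first by exists 0.
have [c Hc] := H a (mem_head _ _).
have [c' Hc'] := IH (fun i si => H i (mem_behead (s := a :: s) si)).
exists (maxn c c') => i; rewrite inE => /orP[/eqP->|/Hc' Hi].
  exact: mono Hc (leq_maxl _ _).
exact: mono Hi (leq_maxr _ _).
Qed.

Ltac plia := cbv beta; repeat match goal with
  | H : context [expn ?a ?b] |- _ => let p := fresh "p" in set p := expn a b in *; clearbody p
  | |- context [expn ?a ?b] => let p := fresh "p" in set p := expn a b in *; clearbody p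
  end; lia.

Section Complexity.

Variables (S : signature) (R : trs S) (sf : safe_map S) (ge : rel (symbol S)).
Hypotheses (hR : constructor_trs R) (hsf : safe_mapping sf) (hge : precedence ge)
  (had : admissible ge) (hpop : forall l r, (l, r) \in R -> pop sf ge l r).
Implicit Types (s t : term S) (f g : symbol S) (sigma : nat -> term S).

Notation evq := (@evq S R).
Notation callR k g w Q := (@callq S R k g w Q).

Lemma eqs_inv s t : eqs sf ge s t -> s = t \/
  match s, t with
  | App f a, App g b => exists pi : 'I_(arity f) -> 'I_(arity g),
      [/\ prec_eq ge f g, bijective pi, forall i, (pi i \in sf g) = (i \in sf f)
        & forall i, eqs sf ge (a i) (b (pi i))]
  | _, _ => False
  end.
Proof. by case=> [u|f g a b pi *]; [left|right; exists pi]. Qed.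

Lemma sq_inv s t : sq sf ge s t ->
  match s with
  | Var _ => False
  | App f a =>
    (exists2 i, defined f -> i \notin sf f & sq sf ge (a i) t \/ eqs sf ge (a i) t) \/
    match t with
    | Var _ => False
    | App g b => [/\ defined f, prec_gt ge f g & forall j, sq sf ge (App f a) (b j)]
    end
  end.
Proof. by case=> [f a i u ? ?|f a g b *]; [left; exists i|right]. Qed.

Lemma pop_inv s t : pop sf ge s t ->
  match s with
  | Var _ => False
  | App f a =>
    (exists i, pop sf ge (a i) t \/ eqs sf ge (a i) t) \/
    match t with
    | Var _ => False
    | App g b => defined f /\
      ([/\ prec_gt ge f g,
         forall j, j \notin sf g -> sq sf ge (App f a) (b j),
         forall j, j \in sf g -> pop sf ge (App f a) (b j)
       & forall j k, j \in sf g -> k \in sf g ->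
           ~~ (funs (b j) \subset down ge (funs (App f a))) ->
           ~~ (funs (b k) \subset down ge (funs (App f a))) -> j = k] \/
       [/\ prec_eq ge f g,
         mul_gt (pop sf ge) (eqs sf ge) (normal_args sf a) (normal_args sf b)
       & mul_ge (pop sf ge) (eqs sf ge) (safe_args sf a) (safe_args sf b)])
    end
  end.
Proof.
case=> [f a i u ?|f a g b *|f a g b *]; first by left; exists i.
- by right; split=> //; left.
- by right; split=> //; right.
Qed.

(** By admissibility equivalent symbols are both constructors, and permuting arguments does not
    change the maximum of their depths. *)
Lemma eqs_value s t : value s -> eqs sf ge s t ->
  value t /\ forall sigma, depth (subst sigma s) = depth (subst sigma t).
Proof.
elim: s t => [x|f a IH] t vs /eqs_inv[<- //|].
  by [].
case: t => // g b [pi [fg [pi' piK pi'K] _ ab]].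
move: vs; rewrite !value_App => /andP[df /forallP va].
have dg : ~~ defined g by rewrite -(had.1 _ _ fg).
have H i := IH i (b (pi i)) (va i) (ab i); split.
  by rewrite dg; apply/forallP => j; rewrite -(pi'K j); case: (H (pi' j)).
move=> sigma; rewrite /= (negbTE df) (negbTE dg); congr _.+1; apply/eqP; rewrite eqn_leq.
apply/andP; split; apply/bigmax_leqP => i _; rewrite ffunE.
  have [_ ->] := H i; apply: leq_trans (leq_bigmax (pi i)); by rewrite ffunE.
rewrite -(pi'K i); have [_ <-] := H (pi' i).
by apply: leq_trans (leq_bigmax (pi' i)); rewrite ffunE.
Qed.

Lemma depth_subst_arg f (a : args f) sigma i : ~~ defined f ->
  depth (subst sigma (a i)) < depth (subst sigma (App f a)).
Proof. by move=> df; have := @depth_arg S f [ffun i => subst sigma (a i)] i df; rewrite ffunE. Qed.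

(** On a value only the subterm clause can apply, since the other two need a defined root. *)
Lemma pop_value s t : value s -> pop sf ge s t ->
  value t /\ forall sigma, depth (subst sigma t) < depth (subst sigma s).
Proof.
elim: s t => [x|f a IH] t vs /pop_inv //.
move: vs; rewrite value_App => /andP[df /forallP va].
case=> [[i [/(IH i _ (va i))|/(eqs_value (va i))] [vt H]]|].
- by split=> // sigma; apply: ltn_trans (H sigma) _; apply: depth_subst_arg.
- by split=> // sigma; rewrite -H; apply: depth_subst_arg.
by case: t => // g b []; rewrite (negbTE df).
Qed.

Lemma sq_value s t : value s -> sq sf ge s t ->
  value t /\ forall sigma, depth (subst sigma t) < depth (subst sigma s).
Proof.
elim: s t => [x|f a IH] t vs /sq_inv //.
move: vs; rewrite value_App => /andP[df /forallP va].
case=> [[i _ [/(IH i _ (va i))|/(eqs_value (va i))] [vt H]]|].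
- by split=> // sigma; apply: ltn_trans (H sigma) _; apply: depth_subst_arg.
- by split=> // sigma; rewrite -H; apply: depth_subst_arg.
by case: t => // g b []; rewrite (negbTE df).
Qed.

Definition norm_le f (w : 'I_(arity f) -> term S) D := forall i, i \notin sf f -> depth (w i) <= D.
Definition safe_le f (w : 'I_(arity f) -> term S) E := forall i, i \in sf f -> depth (w i) <= E.

(** The predicative invariant. The safe bound [E] is absent from the time and has coefficient 1 in
    the depth of the result, so results passed on through safe positions add up instead of being
    composed. *)
Definition low c g : Prop := forall D E (w : 'I_(arity g) -> term S),
  norm_le w D -> safe_le w E -> callR ((D + 2) ^ c) g w (fun u => depth u <= (D + 2) ^ c + E).

Lemma low_mono c c' g : low c g -> c <= c' -> low c' g.
Proof.
move=> H le D E w Hn Hs; have := leq_pow2 D le => le'.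
by apply: callq_mono (H D E w Hn Hs) _ _ => [|u]; plia.
Qed.

(** All arguments are safe, and the power with exponent 0 pays for the level that the constructor
    adds. *)
Lemma low_constructor g : ~~ defined g -> low 0 g.
Proof.
move=> dg D E w _ Hs; apply: callq_mono (@callq_constructor _ _ hR _ w dg) _ _; first by [].
move=> _ <-; rewrite expn0 /= (negbTE dg) add1n ltnS; apply/bigmax_leqP => i _; rewrite ffunE.
by apply: Hs; rewrite hsf // inE.
Qed.

Section Rule.

Variables (f : symbol S) (a : {ffun 'I_(arity f) -> term S}) (c0 : nat).
Hypotheses (df : defined f) (va : forall i, value (a i))
  (Hlow : forall g, prec_gt ge f g -> low c0 g).

Notation sub sigma := (fun i => subst sigma (a i)).

Lemma evq_leaf t sigma B : value t -> depth (subst sigma t) <= B ->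
  evq (term_size t) sigma t (fun w => depth w <= B).
Proof. by move=> vt le; apply: evq_mono (evq_value hR sigma vt) (leqnn _) _ => _ <-. Qed.

Lemma term_size_pow t D : term_size t <= (D + 2) ^ (term_size t).
Proof. exact: leq_pow_cst. Qed.

(** [sq] enters the left-hand side only through normal positions of [f], so [D] alone bounds cost
    and result. This is what makes such a term fit for a normal position. *)
Lemma sq_bound t : sq sf ge (App f a) t ->
  exists c, forall sigma D, norm_le (sub sigma) D ->
    evq ((D + 2) ^ c) sigma t (fun w => depth w <= (D + 2) ^ c).
Proof.
have leaf u : (exists2 i, defined f -> i \notin sf f & sq sf ge (a i) u \/ eqs sf ge (a i) u) ->
  exists c, forall sigma D, norm_le (sub sigma) D ->
    evq ((D + 2) ^ c) sigma u (fun w => depth w <= (D + 2) ^ c).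
  case=> i /(_ df) ni H; exists (term_size u) => sigma D HD.
  apply: (@evq_mono _ _ (term_size u)); [|exact: term_size_pow|].
    apply: (@evq_leaf _ _ D); first by case: H => [/(sq_value (va i))|/(eqs_value (va i))] [].
    have := HD i ni; case: H => [/(sq_value (va i))|/(eqs_value (va i))] [_ /(_ sigma)]; plia.
  by move=> w; have := leq_pow_id D (term_size_gt0 u); plia.
elim: t => [x|g b IH] /sq_inv[/leaf //|] //; case=> _ fg sb.
have [c1 H1] : exists c, forall j sigma D, norm_le (sub sigma) D ->
    evq ((D + 2) ^ c) sigma (b j) (fun w => depth w <= (D + 2) ^ c).
  apply: fin_bound => [j c c' H le sigma D /H{}H|j]; last exact: IH (sb j).
  by have le' := leq_pow2 D le; apply: evq_mono H _ _ => [|w]; plia.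
(* The first summand pays for the arguments, the second for the call of [g] on arguments of depth
   [p], and the 1 for adding two powers. *)
exists ((arity g + c1) + (c1 + 2) * c0 + 1) => sigma D HD.
set p := (D + 2) ^ c1.
have h1 : arity g * p <= (D + 2) ^ (arity g + c1) := leq_pow_mulr _ _ _.
have h2 : (p + 2) ^ c0 <= (D + 2) ^ ((c1 + 2) * c0) := pow_comp _ _ _.
have h3 := leq_pow_add (arity g + c1) ((c1 + 2) * c0) D.
have h4 : p <= (D + 2) ^ (arity g + c1) by apply: leq_pow2; plia.
apply: (@evq_mono _ _ (\sum_(j < arity g) p + (p + 2) ^ c0)).
- apply: (@evq_app _ _ _ _ _ _ _ (fun _ w => depth w <= p)) => [j|w Hw]; first exact: H1.
  by apply: (Hlow fg (D := p) (E := p)) => i _; apply: Hw.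
- by rewrite sum_nat_const card_ord; apply: leq_trans h3; apply: leq_add.
- by move=> w /leq_trans; apply; apply: leq_trans h3; rewrite addnC; apply: leq_add.
Qed.

(** A symbol below [f] is not equivalent to it; were one below a constructor of the left-hand side
    equivalent to [f], this constructor would be above [f], against admissibility. *)
Lemma down_lt g : g \in down ge (funs (App f a)) -> ~~ prec_eq ge f g.
Proof.
rewrite inE => /existsP[h /andP[]]; rewrite /= !inE => /orP[/eqP->|/bigcupP[i _ hi]].
  by rewrite /prec_gt /prec_eq => /andP[_ /negbTE->]; rewrite andbF.
move=> hg; apply/negP => /andP[fg gf].
have dh : ~~ defined h by have := subsetP (va i) _ hi.
have := had.2 h f dh df; case/andP: hg => hg gh; rewrite /prec_gt (hge.2 _ _ _ hg gf) /=.
by rewrite negbK => fh; rewrite (hge.2 _ _ _ gf fh) in gh.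
Qed.

Lemma pop_leaf u : (exists i, pop sf ge (a i) u \/ eqs sf ge (a i) u) ->
  forall sigma D E, norm_le (sub sigma) D -> safe_le (sub sigma) E ->
    evq ((D + 2) ^ term_size u) sigma u (fun w => depth w <= (D + 2) ^ term_size u + E).
Proof.
case=> i H sigma D E HD HE.
apply: (@evq_mono _ _ (term_size u)); [|exact: term_size_pow|].
  apply: (@evq_leaf _ _ (D + E)); first by case: H => [/(pop_value (va i))|/(eqs_value (va i))] [].
  have le : depth (subst sigma (a i)) <= D + E.
    by case: (boolP (i \in sf f)) => [/HE|/HD]; plia.
  by case: H => [/(pop_value (va i))|/(eqs_value (va i))] [_ /(_ sigma)]; plia.
by move=> w; have := leq_pow_id D (term_size_gt0 u); plia.
Qed.

(* The case f > g of the order, for arguments bounded by a polynomial in D plus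
   B at the safe positions; k is the extra cost of the arguments. *)
Lemma gt_bound g (b : args g) c1 (kk : 'I_(arity g) -> nat) k B sigma D :
  prec_gt ge f g ->
  (forall j, evq ((D + 2) ^ c1 + kk j) sigma (b j)
     (fun w => depth w <= (D + 2) ^ c1 + (if j \in sf g then B else 0))) ->
  \sum_j kk j <= k ->
  let c := (arity g + c1) + (c1 + 2) * c0 + 1 in
  evq ((D + 2) ^ c + k) sigma (App g b) (fun w => depth w <= (D + 2) ^ c + B).
Proof.
move=> fg Hb Hk c; set p := (D + 2) ^ c1.
have h1 : arity g * p <= (D + 2) ^ (arity g + c1) := leq_pow_mulr _ _ _.
have h2 : (p + 2) ^ c0 <= (D + 2) ^ ((c1 + 2) * c0) := pow_comp _ _ _.
have h3 : _ <= (D + 2) ^ c := leq_pow_add (arity g + c1) ((c1 + 2) * c0) D.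
have h4 : p <= (D + 2) ^ (arity g + c1) by apply: leq_pow2; plia.
apply: (@evq_mono _ _ (\sum_(j < arity g) (p + kk j) + (p + 2) ^ c0) _ _ _
   (fun w => depth w <= (p + 2) ^ c0 + (p + B))).
- apply: (@evq_app _ _ _ _ _ _ _ (fun j w => depth w <= p + (if j \in sf g then B else 0))) => [j|w Hw].
    exact: Hb.
  apply: (Hlow fg (D := p) (E := p + B)) => i; first by move=> /negbTE si; have := Hw i; rewrite si addn0.
  by move=> si; have := Hw i; rewrite si.
- rewrite big_split /= sum_nat_const card_ord addnAC; apply: leq_add Hk.
  by apply: leq_trans h3; apply: leq_add.
- move=> w /leq_trans; apply; rewrite addnA leq_add2r.
  by apply: leq_trans h3; rewrite addnC; apply: leq_add.
Qed.

(** By [down_lt] clause [pop_eq] cannot occur in such a term, so it contains no recursive call and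
    its bound has no term for one. *)
Lemma pop_bound_below t : pop sf ge (App f a) t -> funs t \subset down ge (funs (App f a)) ->
  exists c, forall sigma D E, norm_le (sub sigma) D -> safe_le (sub sigma) E ->
    evq ((D + 2) ^ c) sigma t (fun w => depth w <= (D + 2) ^ c + E).
Proof.
elim: t => [x|g b IH] /pop_inv[/pop_leaf H _|] //; try by eexists; exact: H.
case=> _ [[fg Hsq Hpop _]|[fg _ _]] subd; last first.
  have := down_lt (subsetP subd g _); rewrite fg => /(_ _)/negP[] //.
  by rewrite /= inE set11.
have [c1 H1] : exists c, forall j sigma D E, norm_le (sub sigma) D -> safe_le (sub sigma) E ->
    evq ((D + 2) ^ c) sigma (b j) (fun w => depth w <= (D + 2) ^ c + (if j \in sf g then E else 0)).
  apply: fin_bound => [j c c' H le sigma D E HD HE|j].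
    by have le' := leq_pow2 D le; apply: evq_mono (H _ _ _ HD HE) _ _ => [|w]; plia.
  case: (boolP (j \in sf g)) => sj.
    apply: IH; first exact: Hpop.
    by apply: subset_trans subd; rewrite /= subsetU // orbC (bigcup_sup j).
  have [c Hc] := sq_bound (Hsq j sj); exists c => sigma D E HD _.
  by apply: evq_mono (Hc _ _ HD) (leqnn _) _ => w; plia.
exists ((arity g + c1) + (c1 + 2) * c0 + 1) => sigma D E HD HE.
have H2 := @gt_bound g b c1 (fun _ => 0) 0 E sigma D fg.
apply: evq_mono (H2 _ _) _ _ => //; [|by rewrite big1|by rewrite addn0].
by move=> j; rewrite addn0; apply: H1.
Qed.

(* A right-hand side contains at most one recursive call; k and B bound the cost
   and the result of that call. *)
Lemma pop_bound t : pop sf ge (App f a) t ->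
  exists c, forall sigma D E k B, norm_le (sub sigma) D -> safe_le (sub sigma) E -> E <= B ->
    (forall g (b : args g), prec_eq ge f g ->
       mul_gt (pop sf ge) (eqs sf ge) (normal_args sf a) (normal_args sf b) ->
       mul_ge (pop sf ge) (eqs sf ge) (safe_args sf a) (safe_args sf b) ->
       callR k g (fun i => subst sigma (b i)) (fun w => depth w <= B)) ->
    evq ((D + 2) ^ c + k) sigma t (fun w => depth w <= (D + 2) ^ c + B).
Proof.
elim: t => [x|g b IH] /pop_inv[/pop_leaf H|] //; try by eexists => sigma D E k B HD HE EB _;
  apply: evq_mono (H sigma D E HD HE) (leq_addr _ _) _ => w; plia.
case=> _ [[fg Hsq Hpop Huniq]|[fg Hgt Hge]]; last first.
  exists (term_size (App g b)) => sigma D E k B HD HE EB Hrec.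
  (* The arguments of a recursive call are dominated by values and hence are values; no further call
     is nested in them. *)
  have vb j : value (b j).
    case: (boolP (j \in sf g)) => sj.
      have [|x] := mul_ge_dominated Hge (y := b j); first by apply/map_f; rewrite mem_enum.
      by case/mapP=> i _ ->; case=> [/(pop_value (va i))|/(eqs_value (va i))] [].
    have [|x] := mul_ge_dominated (mul_gt_ge Hgt) (y := b j).
      by apply/map_f; rewrite mem_enum inE.
    by case/mapP=> i _ ->; case=> [/(pop_value (va i))|/(eqs_value (va i))] [].
  apply: (@evq_mono _ _ (\sum_j term_size (b j) + k) _ _ _ (fun w => depth w <= B)).
  - apply: (@evq_app _ _ _ _ _ _ _ (fun j => eq (subst sigma (b j)))) => [j|w Hw]; first exact: evq_value.
    by apply: callq_ext (Hrec g b fg Hgt Hge).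
  - by rewrite leq_add2r; apply: leq_trans (term_size_pow (App g b) D); rewrite /=; plia.
  - by move=> w; plia.
(* [sp] marks the arguments that may contain the recursive call. The last condition of [pop_gt]
   allows only one, so the sum over the arguments contains [k] at most once. *)
pose sp j := (j \in sf g) && ~~ (funs (b j) \subset down ge (funs (App f a))).
have [c1 H1] : exists c, forall j sigma D E k B, norm_le (sub sigma) D -> safe_le (sub sigma) E -> E <= B ->
    (forall g (b : args g), prec_eq ge f g ->
       mul_gt (pop sf ge) (eqs sf ge) (normal_args sf a) (normal_args sf b) ->
       mul_ge (pop sf ge) (eqs sf ge) (safe_args sf a) (safe_args sf b) ->
       callR k g (fun i => subst sigma (b i)) (fun w => depth w <= B)) ->
    evq ((D + 2) ^ c + (if sp j then k else 0)) sigma (b j)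
      (fun w => depth w <= (D + 2) ^ c + (if j \in sf g then B else 0)).
  apply: fin_bound => [j c c' H le sigma D E k B HD HE EB Hrec|j].
    have le' := leq_pow2 D le; apply: evq_mono (H _ _ _ _ _ HD HE EB Hrec) _ _; first by plia.
    by move=> w; plia.
  case: (boolP (sp j)) => [/andP[sj nsub]|]; first by rewrite sj; apply: IH (Hpop j sj).
  rewrite /sp; case: (boolP (j \in sf g)) => sj /=.
    rewrite negbK => subd; have [c Hc] := pop_bound_below (Hpop j sj) subd.
    exists c => sigma D E k B HD HE EB _; apply: evq_mono (Hc _ _ _ HD HE) _ _; first by plia.
    by move=> w; plia.
  move=> _; have [c Hc] := sq_bound (Hsq j sj); exists c => sigma D E k B HD _ _ _.
  by apply: evq_mono (Hc _ _ HD) _ _ => [|w]; plia.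
eexists => sigma D E k B HD HE EB Hrec.
apply: (gt_bound (kk := fun j => if sp j then k else 0) (c1 := c1)) => // [j|].
  exact: H1 HD HE EB Hrec.
rewrite -big_mkcond /= sum_nat_const -[X in _ <= X]mul1n leq_mul2r; apply/orP; right.
apply/card_le1_eqP => i j; rewrite !unfold_in => /andP[si ni] /andP[sj nj].
exact: Huniq.
Qed.

End Rule.

(** Constant on the classes of equivalent symbols and smaller on smaller classes, so induction over
    it handles mutually recursive symbols together. *)
Definition prec_rank f := #|[set g | prec_gt ge f g]|.

Lemma prec_gt_trans f g h : prec_gt ge f g -> ge g h -> prec_gt ge f h.
Proof.
case/andP=> fg ngf gh; rewrite /prec_gt (hge.2 _ _ _ fg gh) /=.
by apply/negP => hf; rewrite (hge.2 _ _ _ gh hf) in ngf.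
Qed.

Lemma prec_rank_gt f g : prec_gt ge f g -> prec_rank g < prec_rank f.
Proof.
move=> fg; apply: proper_card; apply/properP; split.
  by apply/subsetP => h; rewrite !inE => /andP[gh _]; apply: prec_gt_trans gh.
by exists g; rewrite !inE // /prec_gt hge.1.
Qed.

Lemma prec_rank_eq f g : prec_eq ge f g -> prec_rank f = prec_rank g.
Proof.
case/andP=> fg gf; apply: eq_card => h; rewrite !inE /prec_gt; apply/andP/andP => -[x nx].
  split; first exact: hge.2 _ _ _ gf x.
  by apply: contra nx => hg; apply: hge.2 _ _ _ hg gf.
split; first exact: hge.2 _ _ _ fg x.
by apply: contra nx => hf; apply: hge.2 _ _ _ hf fg.
Qed.

Definition max_arity := \max_(f : symbol S) arity f.

Definition norm_depths f (w : 'I_(arity f) -> term S) : seq nat :=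
  [seq depth (w i) | i <- enum (~: sf f)].

Lemma size_normal_args f (a : args f) : size (normal_args sf a) <= max_arity.
Proof.
rewrite size_map -cardE; apply: leq_trans (max_card _) _; rewrite card_ord.
exact: (leq_bigmax (F := fun f : symbol S => arity f)).
Qed.

(** One unfolding costs [(D + 2) ^ c1] steps plus the call itself, deepens the result by at most
    that power, and leads to at most one call of the same class, of smaller rank. So both bounds are
    linear in the length of the recursion. *)
Lemma class_bound k c0 : (forall g, prec_rank g < k -> low c0 g) ->
  exists c, forall f, defined f -> prec_rank f = k -> low c f.
Proof.
move=> Hlow.
have [c1 Hc1] : exists c, forall lr, lr \in R -> forall f (a : args f), lr.1 = App f a -> prec_rank f = k ->
    forall sigma D E k B, norm_le (fun i => subst sigma (a i)) D ->
      safe_le (fun i => subst sigma (a i)) E -> E <= B ->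
      (forall g (b : args g), prec_eq ge f g ->
         mul_gt (pop sf ge) (eqs sf ge) (normal_args sf a) (normal_args sf b) ->
         mul_ge (pop sf ge) (eqs sf ge) (safe_args sf a) (safe_args sf b) ->
         callR k g (fun i => subst sigma (b i)) (fun w => depth w <= B)) ->
      evq ((D + 2) ^ c + k) sigma lr.2 (fun w => depth w <= (D + 2) ^ c + B).
  apply: seq_bound => [lr c c' H le f a e rk sigma D E k' B HD HE EB Hrec|[l r] lr].
    have le' := leq_pow2 D le; apply: evq_mono (H f a e rk _ _ _ _ _ HD HE EB Hrec) _ _; first by plia.
    by move=> w; plia.
  case: l lr => [x|f a] lr /=; first by exists 0.
  have /= /andP[df /forallP va] := hR lr.
  case: (eqVneq (prec_rank f) k) => [rk|nrk]; last first.
    by exists 0 => g b e rk; rewrite -(App_symbol e) in rk; rewrite rk eqxx in nrk.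
  have [|c Hc] := @pop_bound f a c0 df va _ r (hpop lr).
    by move=> g /prec_rank_gt; rewrite rk; apply: Hlow.
  by exists c => g b e _; have eg := App_symbol e; subst g; rewrite -(App_args e).
pose A := max_arity.
(* [D] and [E] stay fixed along the recursion because the arguments of recursive calls are no deeper
   than before; only the rank decreases. *)
have main n : forall f (w : 'I_(arity f) -> term S) D E, defined f -> prec_rank f = k ->
    norm_le w D -> safe_le w E -> mrank A D (norm_depths w) < n ->
    callR (n * ((D + 2) ^ c1 + 1)) f w (fun u => depth u <= n * (D + 2) ^ c1 + E).
  elim: n => // n IH f w D E df rk HD HE Hr.
  rewrite (_ : n.+1 * _ = ((D + 2) ^ c1 + n * ((D + 2) ^ c1 + 1)).+1); last by plia.
  apply: callqI => [|l r sigma lr e]; first by rewrite /= df.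
  have [a [el _ va wa]] := rule_lhs hR lr e.
  have wE i : w i = subst sigma (a i) by rewrite -wa ffunE.
  have HD' : norm_le (fun i => subst sigma (a i)) D by move=> i ni; rewrite -wE; apply: HD.
  have HE' : safe_le (fun i => subst sigma (a i)) E by move=> i ni; rewrite -wE; apply: HE.
  rewrite mulSn -addnA; apply: (Hc1 _ lr f a el rk _ _ _ _ _ HD' HE'); first by plia.
  move=> g b fg Hgt Hge.
  have nE h (d : args h) : norm_depths (fun i => subst sigma (d i)) =
      [seq depth (subst sigma t) | t <- normal_args sf d] by rewrite -map_comp.
  have na t : t \in normal_args sf a -> value t /\ depth (subst sigma t) <= D.
    by case/mapP=> i; rewrite mem_enum inE => ni ->; split; [apply: va|apply: HD'].
  have sa t : t \in safe_args sf a -> value t /\ depth (subst sigma t) <= E.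
    by case/mapP=> i; rewrite mem_enum => ni ->; split; [apply: va|apply: HE'].
  apply: IH.
  - by rewrite -(had.1 _ _ fg).
  - by rewrite -(prec_rank_eq fg).
  - move=> j nj; have [|x xa H] := mul_ge_dominated (mul_gt_ge Hgt) (y := b j).
      by apply/map_f; rewrite mem_enum inE.
    have [vx dx] := na x xa.
    by case: H => [/(pop_value vx)|/(eqs_value vx)] [_ /(_ sigma)]; plia.
  - move=> j sj; have [|x xa H] := mul_ge_dominated Hge (y := b j).
      by apply/map_f; rewrite mem_enum.
    have [vx dx] := sa x xa.
    by case: H => [/(pop_value vx)|/(eqs_value vx)] [_ /(_ sigma)]; plia.
  - rewrite ltnS in Hr; apply: leq_trans Hr; rewrite nE.
    rewrite (_ : norm_depths w = [seq depth (subst sigma t) | t <- normal_args sf a]); last first.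
      by rewrite -map_comp; apply: eq_map => i /=; rewrite wE.
    apply: (mul_gt_rank Hgt); try exact: size_normal_args.
    + by move=> x y /na[vx _] /(pop_value vx)[_]; apply.
    + by move=> x y /na[vx _] /(eqs_value vx)[_]; apply.
    + by move=> x /na[].
(* [A + 1] is the exponent of [mrank_bound], and [c1 + 1] absorbs the additional step of each
   unfolding. *)
exists ((A + 1) + (c1 + 1)) => f df rk D E w HD HE.
have lt := mrank_bound A D (norm_depths w).
have p1 : (D + 2) ^ c1 + 1 <= (D + 2) ^ (c1 + 1).
  by have := leq_pow_add c1 0 D; rewrite expn0 addn0.
apply: callq_mono (main _ f w D E df rk HD HE lt) _ _.
  by rewrite [X in _ <= X]expnD leq_mul2l p1 orbT.
move=> u /leq_trans; apply; rewrite leq_add2r [X in _ <= X]expnD leq_mul2l leq_pow2 ?orbT //; lia.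
Qed.

Theorem runtime_bound : exists c, forall f (w : 'I_(arity f) -> term S) D,
  (forall i, depth (w i) <= D) -> callR ((D + 2) ^ c) f w (fun _ => True).
Proof.
have H k : exists c, forall f, prec_rank f < k -> low c f.
  elim: k => [|k [c0 Hc0]]; first by exists 0.
  have [c Hc] := class_bound Hc0; exists (c0 + c) => f; rewrite ltnS leq_eqVlt => /orP[/eqP rk|lt].
    case: (boolP (defined f)) => df; first by apply: low_mono (Hc f df rk) _; plia.
    by apply: low_mono (low_constructor df) _.
  by apply: low_mono (Hc0 f lt) _; plia.
have [c Hc] := H #|symbol S|.+1; exists c => f w D HD.
have rk : prec_rank f < #|symbol S|.+1 by rewrite ltnS; apply: max_card.
by apply: callq_mono (Hc f rk D D w _ _) (leqnn _) _ => // i _; apply: HD.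
Qed.

End Complexity.

(** * Matching, and the stack machine as a function *)

Section Matching.

Variable S : signature.
Implicit Types (p t : term S) (sigma : nat -> term S).

Fixpoint vars t : seq nat :=
  match t with
  | Var x => [:: x]
  | App f a => flatten [seq vars (a i) | i <- enum 'I_(arity f)]
  end.

Lemma vars_App x f (a : args f) : x \in vars (App f a) <-> exists i, x \in vars (a i).
Proof.
split=> [/flattenP[_ /mapP[i _ ->] xi]|[i xi]]; first by exists i.
by apply/flattenP; exists (vars (a i)) => //; apply: map_f; rewrite mem_enum.
Qed.

Lemma subst_ext sigma sigma' t :
  {in vars t, sigma =1 sigma'} -> subst sigma t = subst sigma' t.
Proof.
elim: t => [x|f a IH] H /=; first by apply: H; rewrite inE.
congr App; apply/ffunP => i; rewrite !ffunE; apply: IH => x xi; apply: H.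
by apply/vars_App; exists i.
Qed.

Lemma term_code_ext sigma sigma' t :
  {in vars t, sigma =1 sigma'} -> term_code sigma t = term_code sigma' t.
Proof.
elim: t => [x|f a IH] H /=; first by rewrite H ?inE.
congr (flatten _ ++ _); apply: eq_map => i; apply: IH => x xi; apply: H.
by apply/vars_App; exists i.
Qed.

(** The position of one occurrence of [x], from which its binding is read off. Repeated variables
    need no special care: the instance is compared with the whole term afterwards. *)
Fixpoint vpath (x : nat) p : option (seq nat) :=
  match p with
  | Var y => if y == x then Some [::] else None
  | App f a => ohead (pmap (fun i => omap (cons (nat_of_ord i)) (vpath x (a i)))
                           (enum 'I_(arity f)))
  end.

Definition child t (i : nat) : term S :=
  if t is App f a then nth (Var 0) [seq a j | j <- enum 'I_(arity f)] i else Var 0.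

Lemma child_App f (a : args f) (i : 'I_(arity f)) : child (App f a) i = a i.
Proof. by rewrite /= (nth_map i) ?size_enum_ord // nth_ord_enum. Qed.

Definition tsub p t (x : nat) : term S :=
  if vpath x p is Some pi then foldl child t pi else Var 0.

Lemma vpathP x p : x \in vars p ->
  exists2 pi, vpath x p = Some pi & forall sigma, foldl child (subst sigma p) pi = sigma x.
Proof.
elim: p => [y|f a IH]; first by rewrite inE => /eqP-> /=; exists [::]; rewrite ?eqxx.
move/vars_App=> [i xi] /=; set P := pmap _ _.
have [pi piE _] := IH i xi.
have : (i : nat) :: pi \in P.
  by rewrite mem_pmap; apply/mapP; exists i; rewrite ?mem_enum // piE.
case EP: P => [|rho P'] // _; exists rho => // sigma.
have : rho \in P by rewrite EP mem_head.
rewrite mem_pmap => /mapP[j _] /=; case Ej: (vpath x (a j)) => [rj|] //= [->] /=.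
rewrite -/(child (App f [ffun i => subst sigma (a i)]) j) child_App ffunE.
have [xj|nxj] := boolP (x \in vars (a j)).
  by have [pj] := IH j xj; rewrite Ej => -[->].
suff : vpath x (a j) = None by rewrite Ej.
elim: (a j) nxj => [y|g b IHb] /=; first by rewrite inE eq_sym => /negbTE->.
move=> nx; rewrite (_ : pmap _ _ = [::]) //; apply/eqP; rewrite -size_eq0 size_pmap.
rewrite -leqn0 leqNgt -has_count; apply/hasPn => k _ /=; rewrite IHb //.
by apply: contra nx => xk; apply/vars_App; exists k.
Qed.

Definition tmatch p t : bool := subst (tsub p t) p == t.

Lemma tsubE p sigma : {in vars p, tsub p (subst sigma p) =1 sigma}.
Proof. by move=> x /vpathP[pi e H]; rewrite /tsub e. Qed.

Lemma tmatchP p t : reflect (exists sigma, subst sigma p = t) (tmatch p t).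
Proof.
apply: (iffP eqP) => [<-|[sigma <-]]; first by exists (tsub p t).
by apply: subst_ext; apply: tsubE.
Qed.

Definition fstep (rs : trs S) (st : tstate S) : tstate S :=
  match st.1 with
  | [::] => st
  | (None, t) :: c => (c, t :: st.2)
  | (Some g, _) :: c =>
      let t := mk_app g (take (arity g) st.2) in
      let vs := drop (arity g) st.2 in
      if [seq q <- rs | tmatch q.1 t] is q :: _
      then (term_code (tsub q.1 t) q.2 ++ c, vs) else (c, t :: vs)
  end.

(** All nondeterminism is the choice of a list from [RS] in each step, within which the first
    matching rule is applied. A single list gives a deterministic machine. *)
Inductive reach (RS : seq (trs S)) : nat -> tstate S -> tstate S -> Prop :=
| reach0 st : reach RS 0 st st
| reachS n rs st st' : st.1 != [::] -> rs \in RS -> reach RS n (fstep rs st) st' ->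
    reach RS n.+1 st st'.

Lemma reach_trans RS n m st st' st'' :
  reach RS n st st' -> reach RS m st' st'' -> reach RS (n + m) st st''.
Proof. by elim=> // {n}n rs s s' ne rsin _ IH /IH; apply: reachS. Qed.

End Matching.

(** * Variables of right-hand sides *)

Section VarsOfRules.

Variables (S : signature) (sf : safe_map S) (ge : rel (symbol S)).
Implicit Types (s t : term S).

Lemma eqs_vars s t : eqs sf ge s t -> {subset vars t <= vars s}.
Proof.
elim: s t => [x|f a IH] t /eqs_inv[<- //|] //.
case: t => // g b [pi [_ [pi' _ pi'K] _ ab]] x /vars_App[j xj].
apply/vars_App; exists (pi' j); apply: (IH _ _ (ab _)); by rewrite pi'K.
Qed.

Lemma sq_vars s t : sq sf ge s t -> {subset vars t <= vars s}.
Proof.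
elim: s t => [x|f a IHs] t; first by move/sq_inv.
have sub u : (exists2 i, defined f -> i \notin sf f & sq sf ge (a i) u \/ eqs sf ge (a i) u) ->
    {subset vars u <= vars (App f a)}.
  move=> [i _ H] x xu; apply/vars_App; exists i.
  by case: H => [/IHs|/eqs_vars]; apply.
elim: t => [x|g b IHt] /sq_inv[/sub //|] //; case=> _ _ H x /vars_App[j xj].
exact: IHt (H j) x xj.
Qed.

(** Makes the binding found by matching the left-hand side determine the instance of the right-hand
    side. *)
Lemma pop_vars s t : pop sf ge s t -> {subset vars t <= vars s}.
Proof.
elim: s t => [x|f a IHs] t; first by move/pop_inv.
have sub u i : pop sf ge (a i) u \/ eqs sf ge (a i) u -> {subset vars u <= vars (App f a)}.
  move=> H x xu; apply/vars_App; exists i.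
  by case: H => [/IHs|/eqs_vars]; apply.
elim: t => [x|g b IHt] /pop_inv[[i /sub] //|] //; case=> _ [[_ Hs Hp _]|[_ Hgt Hge]] x /vars_App[j xj].
  case: (boolP (j \in sf g)) => sj; first exact: IHt (Hp j sj) x xj.
  exact: sq_vars (Hs j sj) x xj.
case: (boolP (j \in sf g)) => sj.
  have [|y] := mul_ge_dominated Hge (y := b j); first by apply/map_f; rewrite mem_enum.
  by case/mapP=> i _ -> /sub; apply.
have [|y] := mul_ge_dominated (mul_gt_ge Hgt) (y := b j); first by apply/map_f; rewrite mem_enum inE.
by case/mapP=> i _ -> /sub; apply.
Qed.

End VarsOfRules.

(** * Soundness and completeness of the stack machine for innermost rewriting *)

Section MachineCorrect.

Variables (S : signature) (R : trs S) (RS : seq (trs S)).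
Hypotheses (hR : constructor_trs R)
  (hvars : forall l r, (l, r) \in R -> {subset vars r <= vars l})
  (RSsub : forall rs, rs \in RS -> {subset rs <= R})
  (RSsup : forall rs, rs \in RS -> {subset R <= rs}).
Implicit Types (s t : term S) (f g : symbol S) (sigma : nat -> term S).

Notation nf := (normal_form R).
Notation "s ->* t" := (clos_refl_trans _ (istep R) s t) (at level 70).

Lemma fstep_tstep rs st : rs \in RS -> st.1 != [::] -> tstep R st (fstep rs st).
Proof.
case: st => [[|[[g|] t] c] vs] //= rsin _; rewrite /fstep /=; last exact: tstep_val.
case E: [seq _ <- _ | _] => [|[l r] fs]; first exact: tstep_stuck.
have : (l, r) \in (l, r) :: fs by rewrite mem_head.
rewrite -E mem_filter => /andP[/eqP e /(RSsub rsin) lr]; exact: tstep_rule lr e.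
Qed.

Lemma must_reach k n st st' Q : must R k st Q -> reach RS n st st' ->
  n <= k /\ (st'.1 = [::] -> Q st'.2).
Proof.
move=> H r; elim: r k H => {n st st'} [st|n rs st st' ne rsin _ IH] k.
  by case: st => [[|i c] vs]; case: k.
case: k => [|k]; first by case: st ne {IH rsin} => [[|i c] vs].
move=> H; have [] := IH k; last by move=> ? ?; split.
move: H (fstep_tstep rsin ne); case: st ne {IH} => [[|i c] vs] //= _ H; exact: H.
Qed.

Lemma must_run k st Q rs : rs \in RS -> must R k st Q ->
  exists n vs, reach RS n st ([::], vs).
Proof.
move=> rsin; elim: k st => [|k IH] [[|i c] vs] //=; try by exists 0, vs; apply: reach0.
move=> /(_ _ (@fstep_tstep rs (i :: c, vs) rsin isT))/IH[n [us r]]; exists n.+1, us.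
exact: reachS r.
Qed.

Lemma nf_Var x : nf (Var x).
Proof.
move=> u; move E: (Var x) => s H; case: H E => // l r sg /hR; by case: l.
Qed.

Lemma nf_arg f (a : args f) i : nf (App f a) -> nf (a i).
Proof.
move=> H u st; apply: (H (App f [ffun j => if j == i then u else a j])).
apply: (@rstep_arg _ _ _ _ _ i); first by rewrite ffunE eqxx.
by move=> j /negbTE ji; rewrite ffunE ji.
Qed.

Lemma nf_App f (a : args f) : (forall i, nf (a i)) ->
  (forall l r, (l, r) \in R -> ~~ tmatch l (App f a)) -> nf (App f a).
Proof.
move=> Ha Hm u; move E: (App f a) => s H; case: H E => [l r sg lr e|g b d i st _ e].
  by have := Hm _ _ lr => /tmatchP[]; exists sg.
by have eg := App_symbol e; subst g; rewrite -(App_args e) in st; apply: Ha st.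
Qed.

Lemma nf_no_match t l r : nf t -> (l, r) \in R -> ~~ tmatch l t.
Proof. by move=> H lr; apply/tmatchP => -[sg e]; apply: (H (subst sg r)); rewrite -e; apply: rstep_root. Qed.

Lemma nf_subst sigma p x : nf (subst sigma p) -> x \in vars p -> nf (sigma x).
Proof.
elim: p => [y|f a IH] H; first by rewrite inE => /eqP->.
by case/vars_App=> i; apply: IH; have := nf_arg (i := i) H; rewrite ffunE.
Qed.

Lemma nf_mk_app_arg g vs (i : 'I_(arity g)) :
  (forall t, t \in vs -> nf t) -> nf ([ffun i : 'I_(arity g) => nth (Var 0) (take (arity g) vs) i] i).
Proof.
move=> H; rewrite ffunE; have [lt|le] := ltnP i (size (take (arity g) vs)).
  exact: H (mem_take (mem_nth _ lt)).
by rewrite nth_default //; exact: nf_Var.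
Qed.

Definition okst (st : tstate S) : Prop :=
  (forall t, t \in st.2 -> nf t) /\ (forall t, (None, t) \in st.1 -> nf t).

Lemma term_code_vals sigma p t : (None, t) \in term_code sigma p -> exists2 x, x \in vars p & t = sigma x.
Proof.
elim: p => [x|f a IH] /=; first by rewrite inE => /eqP[->]; exists x; rewrite ?inE.
rewrite mem_cat => /orP[|]; last by rewrite inE.
case/flattenP=> _ /mapP[i _ ->] /IH[x xi ->]; exists x => //.
by apply/vars_App; exists i.
Qed.

Lemma rule_vals l r t g (a : args g) : (l, r) \in R -> t = App g a -> (forall i, nf (a i)) ->
  tmatch l t -> {in vars r, forall x, nf (tsub l t x)}.
Proof.
move=> lr te Ha /eqP; rewrite {2}te => e x /(hvars lr) xl.
have [b [lb _ _ ab]] := rule_lhs hR lr e; move: xl; rewrite {1}lb => /vars_App[i xi].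
by apply: (@nf_subst _ (b i)) => //; rewrite -ab.
Qed.

(** Each list contains all rules of [R], so if none of its rules matches a term with normal
    arguments, that term is a normal form and may join the values. *)
Lemma fstep_ok rs st : rs \in RS -> okst st -> okst (fstep rs st).
Proof.
case: st => [[|[[g|] t] c] vs] //= rsin [H1 H2]; rewrite /fstep /=; last first.
  split=> u /=; last by move=> uc; apply: H2; rewrite inE uc orbT.
  by rewrite inE => /orP[/eqP->|/H1] //; apply: H2; rewrite mem_head.
have na (i : 'I_(arity g)) := @nf_mk_app_arg g vs i H1; set t' := mk_app _ _.
case E: [seq _ <- _ | _] => [|[l r] fs].
  split=> u /=; last by move=> uc; apply: H2; rewrite inE uc orbT.
  rewrite inE => /orP[/eqP->|/mem_drop/H1] //; apply: nf_App => // l r lr.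
  apply/negP => m; suff : (l, r) \in [::] by [].
  by rewrite -E mem_filter m /=; apply: RSsup rsin _ lr.
have : (l, r) \in (l, r) :: fs by rewrite mem_head.
rewrite -E mem_filter => /andP[m /(RSsub rsin) lr]; split=> u /=; first by move/mem_drop/H1.
rewrite mem_cat => /orP[/term_code_vals[x xr ->]|uc]; last by apply: H2; rewrite inE uc orbT.
exact: (rule_vals lr (erefl _) na m) x xr.
Qed.

(** One instruction executed without rewriting; doing this for the whole code gives the term for
    which a state stands. *)
Definition rbi (vs : seq (term S)) (i : tinstr S) : seq (term S) :=
  if i.1 is Some g then mk_app g (take (arity g) vs) :: drop (arity g) vs else i.2 :: vs.

Definition readback (st : tstate S) : seq (term S) := foldl rbi st.2 st.1.

Lemma readback_code sigma t vs : foldl rbi vs (term_code sigma t) = subst sigma t :: vs.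
Proof.
elim: t vs => [x|f a IH] vs //=; rewrite foldl_cat /=.
have H (s : seq 'I_(arity f)) us : foldl rbi us (flatten [seq term_code sigma (a i) | i <- s]) =
              [seq subst sigma (a i) | i <- rev s] ++ us.
  by elim: s us => //= i s IHs us; rewrite foldl_cat IH IHs rev_cons map_rcons cat_rcons.
rewrite H revK /rbi /=; have [-> ->] := take_drop_enum (fun i => subst sigma (a i)) vs.
by rewrite mk_app_enum.
Qed.

Lemma istep_star_arg f (a b : args f) i : a i ->* b i -> (forall j, j != i -> a j = b j) ->
  App f a ->* App f b.
Proof.
move=> H; pose upd u : args f := [ffun j => if j == i then u else a j] => E.
have -> : b = upd (b i) by apply/ffunP => j; rewrite ffunE; case: eqP => [->|/eqP/E].
have -> : App f a = App f (upd (a i)).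
  by congr App; apply/ffunP => j; rewrite ffunE; case: eqP => [->|].
elim: H => [u v st|u|u v w _ IH1 _ IH2]; [apply: rt_step|exact: rt_refl|exact: rt_trans IH1 IH2].
apply: (@istep_arg _ _ _ _ _ i); first by rewrite !ffunE eqxx.
by move=> j /negbTE ji; rewrite !ffunE ji.
Qed.

Definition lstar (vs vs' : seq (term S)) : Prop :=
  exists pre t t' post, [/\ vs = pre ++ t :: post, vs' = pre ++ t' :: post & t ->* t'].

Lemma lstar_rbi vs vs' i : lstar vs vs' -> lstar (rbi vs i) (rbi vs' i).
Proof.
case=> pre [t [t' [post [-> -> st]]]]; rewrite /rbi; case: i => [[g|] u] /=; last first.
  by exists (u :: pre), t, t', post.
(* If [g] takes at most [size pre] entries, the reduced one stays on the stack; otherwise it becomes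
   an argument of [g] and the reduction takes place there. *)
rewrite !take_cat !drop_cat; case: ltnP => [lt|].
  by exists (mk_app g (take (arity g) pre) :: drop (arity g) pre), t, t', post.
case E: (arity g - size pre) => [|m] le /=.
  by exists [:: mk_app g (pre ++ [::])], t, t', post; rewrite ?take0 ?drop0.
have lt : size pre < arity g by lia.
exists [::], (mk_app g (pre ++ t :: take m post)), (mk_app g (pre ++ t' :: take m post)), (drop m post).
split=> //; apply: (@istep_star_arg _ _ _ (Ordinal lt)).
  by rewrite !ffunE /= !nth_cat ltnn subnn.
move=> j; rewrite -val_eqE /= => nj; rewrite !ffunE !nth_cat; case: ltnP => // le'.
by case Ej: (j - size pre) => [|k] //=; lia.
Qed.

Lemma lstar_refl t vs : lstar (t :: vs) (t :: vs).
Proof. by exists [::], t, t, vs; split=> //; apply: rt_refl. Qed.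

Lemma lstar_foldl c vs vs' : lstar vs vs' -> lstar (foldl rbi vs c) (foldl rbi vs' c).
Proof. by elim: c vs vs' => //= i c IH vs vs' /(lstar_rbi i)/IH. Qed.

Lemma fstep_readback rs st : rs \in RS -> okst st -> st.1 != [::] ->
  lstar (readback st) (readback (fstep rs st)).
Proof.
case: st => [[|[[g|] t] c] vs] //= rsin [H1 H2] _; rewrite /fstep /readback /=; last first.
  by apply: lstar_foldl; apply: lstar_refl.
case E: [seq _ <- _ | _] => [|[l r] fs]; first by apply: lstar_foldl; apply: lstar_refl.
rewrite foldl_cat readback_code; apply: lstar_foldl; rewrite /rbi /=.
have : (l, r) \in (l, r) :: fs by rewrite mem_head.
rewrite -E mem_filter => /andP[/eqP m /(RSsub rsin) lr].
exists [::]; do 2 eexists; exists (drop (arity g) vs); split=> //; apply: rt_step.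
by apply: (istep_root lr m) => i; apply: nf_mk_app_arg.
Qed.

Lemma reach_sound n st vs s : reach RS n st ([::], vs) -> okst st -> readback st = [:: s] ->
  exists w, [/\ vs = [:: w], s ->* w & nf w].
Proof.
move E: ([::], vs) => st' r; elim: r s E => {n st st'} [st|n rs st st' ne rsin _ IH] s E ok rb.
  subst st; move: rb; rewrite /readback /= => e; subst vs.
  by exists s; split=> //; [apply: rt_refl|apply: ok.1; rewrite mem_head].
have := fstep_readback rsin ok ne; rewrite rb => -[[|p pre] [t [t' [post [e1 e2 st1]]]]]; last first.
  by case: e1 => _; case: (pre).
case: e1 => es ep; subst t post.
have [w [-> st2 nw]] := IH t' E (fstep_ok rsin ok) e2.
by exists w; split=> //; apply: rt_trans st1 st2.
Qed.

(** Big-step innermost evaluation. A derivation may interleave steps in different arguments whereas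
    the machine finishes one argument after the other; [ev] forgets this order and mediates between
    them. *)
Inductive ev : term S -> term S -> Prop :=
| ev_Var x : ev (Var x) (Var x)
| ev_stuck f (a w : args f) : (forall i, ev (a i) (w i)) -> nf (App f w) ->
    ev (App f a) (App f w)
| ev_rule f (a w : args f) l r sigma u :
    (forall i, ev (a i) (w i)) -> (forall i, nf (w i)) -> (l, r) \in R ->
    subst sigma l = App f w -> ev (subst sigma r) u -> ev (App f a) u.

Lemma ev_inv s u : ev s u ->
  match s with
  | Var x => u = Var x
  | App f a => exists2 w : args f, (forall i, ev (a i) (w i)) &
      (nf (App f w) /\ u = App f w) \/
      exists l r sigma, [/\ forall i, nf (w i), (l, r) \in R, subst sigma l = App f w
                          & ev (subst sigma r) u]
  end.
Proof.
case=> [x //|f a w H1 H2|f a w l r sg v H1 H2 lr e H3]; first by exists w => //; left.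
by exists w => //; right; exists l, r, sg.
Qed.

Lemma ev_nf t : nf t -> ev t t.
Proof.
elim: t => [x _|f a IH H]; first exact: ev_Var.
by apply: ev_stuck => // i; apply: IH; apply: nf_arg.
Qed.

Lemma ev_nf_eq t u : nf t -> ev t u -> u = t.
Proof.
move=> nt e; elim: e nt => {t u} [x //|f a w _ IH _ H|f a w l r sg u _ IH _ lr e _ _ H].
  by congr App; apply/ffunP => i; apply: IH; apply: nf_arg H.
have wa : w = a by apply/ffunP => i; apply: IH; apply: nf_arg H.
by case: (H (subst sg r)); rewrite -wa -e; apply: rstep_root.
Qed.

(** Evaluation is closed under adding a step in front, so an innermost derivation is absorbed from
    its end, starting with [ev_nf]. *)
Lemma ev_istep s s' w : istep R s s' -> ev s' w -> ev s w.
Proof.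
move=> st; elim: st w => {s s'} [l r sg f a lr e Ha|f a b i st IH ab] w H.
  by apply: (ev_rule (w := a)) lr e H => // i; apply: ev_nf.
have [v Hv D] := ev_inv H.
have Hv' j : ev (a j) (v j).
  by case: (eqVneq j i) => [->|/ab ->]; [apply: IH|].
case: D => [[nv ->]|[l [r [sg [nv lr e H']]]]]; first exact: ev_stuck.
exact: ev_rule nv lr e H'.
Qed.

Lemma ev_star s s' : s ->* s' -> forall w, ev s' w -> ev s w.
Proof.
elim=> [u v st w|//|u v x _ IH1 _ IH2 w H]; first exact: ev_istep.
exact: IH1 (IH2 _ H).
Qed.

Lemma ev_complete s w : s ->* w -> nf w -> ev s w.
Proof. by move=> st nw; apply: ev_star st _ (ev_nf nw). Qed.

Definition mreach st st' := exists n, reach RS n st st'.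

Lemma mreach_step rs st st' : st.1 != [::] -> rs \in RS -> mreach (fstep rs st) st' -> mreach st st'.
Proof. by move=> ne rsin [n r]; exists n.+1; apply: reachS r. Qed.

Lemma mreach_trans st st' st'' : mreach st st' -> mreach st' st'' -> mreach st st''.
Proof. by case=> n r [m r']; exists (n + m); apply: reach_trans r r'. Qed.

Hypotheses (RSne : RS != [::]) (RSall : forall l r, (l, r) \in R -> (l, r) :: R \in RS).

Lemma mreach_args sigma g (b : args g) (w : 'I_(arity g) -> term S) c vs :
  (forall i c vs, mreach (term_code sigma (b i) ++ c, vs) (c, w i :: vs)) ->
  mreach (term_code sigma (App g b) ++ c, vs)
         ((Some g, Var 0) :: c, [seq w i | i <- enum 'I_(arity g)] ++ vs).
Proof.
move=> H /=; rewrite -catA /=; set d := _ :: c; rewrite -[enum _ in X in mreach _ X]revK.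
elim: (rev _) vs => [|i s IH] us /=; first by exists 0; apply: reach0.
rewrite -catA; apply: mreach_trans (H i _ us) _.
by rewrite rev_cons map_rcons cat_rcons; apply: IH.
Qed.

(** The machine pushes the values of variables where [ev] evaluates the instance. This agrees
    because they are normal forms, which evaluate to themselves only. *)
Lemma ev_mreach s w : ev s w -> forall sigma t c vs, s = subst sigma t ->
  {in vars t, forall x, nf (sigma x)} -> mreach (term_code sigma t ++ c, vs) (c, w :: vs).
Proof.
have [rs0 rs0in] : exists rs, rs \in RS by case: RS RSne => // rs *; exists rs; rewrite mem_head.
have var sigma x c vs : mreach (term_code sigma (Var x) ++ c, vs) (c, sigma x :: vs).
  by apply: (mreach_step (rs := rs0)) => //; exists 0; apply: reach0.
move=> e; elim: e => {s w} [y|f a w Ha IH nw|f a w l r sg u Ha IH nw lr el Hu IHu] sigma [x|g b] c vs //= es Hs.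
- by rewrite es; apply: var.
- rewrite (_ : App f w = sigma x); first exact: var.
  apply: ev_nf_eq; first by apply: Hs; rewrite inE.
  by rewrite -es; apply: ev_stuck.
- have eg := App_symbol es; subst g; have ea := App_args es.
  apply: mreach_trans.
    apply: (@mreach_args sigma f b w c vs) => i c' vs'; apply: IH.
      by rewrite ea ffunE.
    by move=> y yi; apply: Hs; apply/vars_App; exists i.
  apply: (mreach_step (rs := rs0)) => //; rewrite /fstep /=.
  have [-> ->] := take_drop_enum w vs; rewrite mk_app_enum (_ : [ffun i => w i] = w); last by apply/ffunP => i; rewrite ffunE.
  case E: [seq _ <- _ | _] => [|[l r] fs]; first by exists 0; apply: reach0.
  have : (l, r) \in (l, r) :: fs by rewrite mem_head.
  by rewrite -E mem_filter => /andP[m /(RSsub rs0in) lr]; rewrite (negbTE (nf_no_match nw lr)) in m.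
- have nx : nf (sigma x) by apply: Hs; rewrite inE.
  rewrite (_ : u = sigma x); first exact: var.
  by apply: ev_nf_eq nx _; rewrite -es; apply: ev_rule Ha nw lr el Hu.
have eg := App_symbol es; subst g; have ea := App_args es.
apply: mreach_trans.
  apply: (@mreach_args sigma f b w c vs) => i c' vs'; apply: IH.
    by rewrite ea ffunE.
  by move=> y yi; apply: Hs; apply/vars_App; exists i.
(* The right guess is the list that begins with the rule applied by [ev]. *)
apply: (mreach_step (rs := (l, r) :: R)) => //; first exact: RSall.
rewrite /fstep /=; have [-> ->] := take_drop_enum w vs.
rewrite mk_app_enum (_ : [ffun i => w i] = w); last by apply/ffunP => i; rewrite ffunE.
have m : tmatch l (App f w) by apply/tmatchP; exists sg.
rewrite m; apply: IHu.
  by apply: subst_ext => x /(hvars lr) xl; rewrite -el tsubE.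
exact: rule_vals lr (erefl _) nw m.
Qed.

Lemma ev_mreach_call f (a : args f) w c vs : ev (App f a) w -> (forall i, nf (a i)) ->
  mreach ((Some f, Var 0) :: c, [seq a i | i <- enum 'I_(arity f)] ++ vs) (c, w :: vs).
Proof.
move=> /ev_inv[b ab D] na.
have eb : b = a by apply/ffunP => i; apply: ev_nf_eq (na i) (ab i).
have fa : [ffun i => a i] = a by apply/ffunP => i; rewrite ffunE.
subst b; case: D => [[nw ->]|[l [r [sg [_ lr el H]]]]].
  have [rs0 rs0in] : exists rs, rs \in RS by case: RS RSne => // rs *; exists rs; rewrite mem_head.
  apply: (mreach_step (rs := rs0)) => //; rewrite /fstep /=; have [-> ->] := take_drop_enum a vs.
  rewrite mk_app_enum fa; case E: [seq _ <- _ | _] => [|[l r] fs]; first by exists 0; apply: reach0.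
  have : (l, r) \in (l, r) :: fs by rewrite mem_head.
  by rewrite -E mem_filter => /andP[m /(RSsub rs0in) lr]; rewrite (negbTE (nf_no_match nw lr)) in m.
apply: (mreach_step (rs := (l, r) :: R)) => //; first exact: RSall.
rewrite /fstep /=; have [-> ->] := take_drop_enum a vs; rewrite mk_app_enum fa.
have m : tmatch l (App f a) by apply/tmatchP; exists sg.
rewrite m; apply: (ev_mreach H); last exact: rule_vals lr (erefl _) na m.
by apply: subst_ext => x /(hvars lr) xl; rewrite -el tsubE.
Qed.

Lemma value_nf t : value t -> nf t.
Proof.
elim: t => [x _|f a IH]; first exact: nf_Var.
rewrite value_App => /andP[df /forallP va]; apply: nf_App => [i|l r lr]; first exact: IH.
apply/tmatchP => -[sg /(rule_lhs hR lr)[b [_]]]; by rewrite (negbTE df).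
Qed.

End MachineCorrect.

(** * Binary words *)

Definition nbits (n : nat) : seq bool :=
  if bin_of_nat n is BinNums.Npos p then pos_bits p else [::].

Definition bval (s : seq bool) : nat := foldr (fun (b : bool) n => b + n.*2) 0 s.

(** Deletes the zeros at the most significant end, which is the right one; the words [nbits n] are
    the fixed points. *)
Fixpoint strip (s : seq bool) : seq bool :=
  if s is b :: s' then
    let t := strip s' in if b || ~~ nilp t then b :: t else [::]
  else [::].

Fixpoint binc (s : seq bool) : seq bool :=
  match s with
  | [::] => [:: true]
  | false :: s' => true :: s'
  | true :: s' => false :: binc s'
  end.

Lemma bval_pos p : bval (pos_bits p) = nat_of_pos p.
Proof. by elim: p => //= p ->; rewrite NatTrec.doubleE. Qed.

Lemma nbitsK n : bval (nbits n) = n.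
Proof.
by rewrite -{2}[n]bin_of_natK /nbits; case: (bin_of_nat n) => //= p; apply: bval_pos.
Qed.

Lemma nbits_inj : injective nbits.
Proof. exact: can_inj nbitsK. Qed.

Lemma nbits_bval s : nbits (bval s) = strip s.
Proof.
elim: s => //= b s; rewrite /nbits => <-.
rewrite -{1}[bval s]bin_of_natK; case: (bin_of_nat (bval s)) => [|p] /=.
  by case: b.
rewrite (_ : b + (nat_of_pos p).*2 = nat_of_bin (BinNums.Npos (if b then BinNums.xI p else BinNums.xO p))).
  by rewrite nat_of_binK; case: b; case: (p).
by case: b; rewrite /= NatTrec.doubleE.
Qed.

Lemma strip_nbits n : strip (nbits n) = nbits n.
Proof. by rewrite -nbits_bval nbitsK. Qed.

Lemma bval_binc s : bval (binc s) = (bval s).+1.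
Proof. by elim: s => [|[] s IH] //=; rewrite IH; lia. Qed.

Lemma strip_binc s : strip s = s -> strip (binc s) = binc s.
Proof.
elim: s => [|[] s IH] //=.
  by case=> e; rewrite IH //; case: s {IH e} => [|[] s].
by case: ifP => // _ [->].
Qed.

Lemma nbitsS n : nbits n.+1 = binc (nbits n).
Proof. by rewrite -{1}[n]nbitsK -bval_binc nbits_bval strip_binc // strip_nbits. Qed.

(** * Shared subterms *)

Section Subterms.

Variable S : signature.
Implicit Types (t u : term S).

Lemma undup_flatten (T : eqType) (ss : seq (seq T)) :
  undup (flatten ss) = undup (flatten (map undup ss)).
Proof.
elim: ss => //= s ss IH; rewrite !undup_cat [undup (undup s)]undup_id ?undup_uniq // IH.
by congr cat; apply: eq_filter => x; rewrite -(mem_undup (flatten ss)) IH mem_undup.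
Qed.

Lemma undup_map_in (T U : eqType) (f : T -> U) (s : seq T) :
  {in s &, injective f} -> undup (map f s) = map f (undup s).
Proof.
elim: s => //= x s IH inj; rewrite IH; last first.
  by move=> y z ys zs; apply: inj; rewrite inE ?ys ?zs orbT.
have -> : (f x \in map f s) = (x \in s); last by case: ifP.
apply/mapP/idP => [[y ys /inj]|xs]; last by exists x.
by rewrite !inE eqxx ys orbT => /(_ isT isT) ->.
Qed.

Lemma subterms_size t u : u \in subterms t -> term_size u <= term_size t.
Proof.
elim: t => [x|f a IH] /=; first by rewrite inE => /eqP->.
rewrite inE => /orP[/eqP-> //|/flattenP[_ /mapP[i _ ->] /IH]]; rewrite (bigD1 i) //=; lia.
Qed.

(** The recurrence by which a heap entry gets its node list from those of its arguments. By size,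
    the root is not among the nodes of the arguments. *)
Lemma nodes_App (f : symbol S) (a : args f) :
  nodes (App f a) = App f a :: undup (flatten [seq nodes (a i) | i <- enum 'I_(arity f)]).
Proof.
rewrite /nodes /= ifN; last first.
  apply/flattenP => -[_ /mapP[i _ ->] /subterms_size]; rewrite /= (bigD1 i) //=; lia.
by rewrite undup_flatten -map_comp.
Qed.

(* Every argument of an element of s occurs later in s. *)
Fixpoint args_later (s : seq (term S)) : Prop :=
  if s is u :: s' then
    (if u is App f a then forall i, a i \in s' else True) /\ args_later s'
  else True.

Lemma args_later_cat s s' : args_later s -> args_later s' -> args_later (s ++ s').
Proof.
elim: s => //= u s IH [H1 H2] H'; split; last exact: IH.
by case: u H1 => // f a H i; rewrite mem_cat H.
Qed.

Lemma args_later_undup s : args_later s -> args_later (undup s).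
Proof.
elim: s => //= u s IH [H1 /IH H2]; case: ifP => // _; split=> //.
by case: u H1 => // f a H i; rewrite mem_undup.
Qed.

Lemma subterms_self t : t \in subterms t.
Proof. by case: t => *; rewrite mem_head. Qed.

Lemma args_later_subterms t : args_later (subterms t).
Proof.
elim: t => [x|f a IH] //=; split.
  move=> i; apply/flattenP; exists (subterms (a i)); last exact: subterms_self.
  by apply: map_f; rewrite mem_enum.
by elim: (enum _) => //= i s IHs; apply: args_later_cat.
Qed.

Definition rootc t : bool := if t is App f _ then ~~ defined f else true.

(** Being a value can be tested node by node on the shared graph, without unfolding a possibly
    exponential tree. *)
Lemma value_nodes t : value t = all rootc (nodes t).
Proof.
rewrite /nodes (eq_all_r (mem_undup _)).
elim: t => [x|f a IH] /=; first by apply/subsetP => y; rewrite inE.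
rewrite value_App; congr (_ && _).
apply/forallP/allP => [H u /flattenP[_ /mapP[i _ ->]]|H i].
  by move: (H i); rewrite IH => /allP; apply.
rewrite IH; apply/allP => u ui; apply: H; apply/flattenP; exists (subterms (a i)) => //.
by apply: map_f; rewrite mem_enum.
Qed.

End Subterms.

(** * Hash-consed heaps *)

Section Heap.

Variable S : signature.

(* (Some f, addresses) is an application, (None, bits) a variable. *)
Definition node : Type := (option (symbol S) * seq nat)%type.
Definition hentry : Type := (nat * (node * seq nat))%type.
Definition heap : Type := seq hentry.
Implicit Types (h : heap) (nd : node) (a b : nat).

Definition hget h a : node * seq nat :=
  (head ((0, ((None, [::]), [::])) : hentry) [seq e <- h | e.1 == a]).2.
Definition hnode h a := (hget h a).1.
Definition hlist h a := (hget h a).2.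

Definition kids nd : seq nat := if nd.1 is Some _ then nd.2 else [::].

(* The list of an entry enumerates, by address, the nodes of its term. *)
Definition hnew h nd : hentry :=
  (size h, (nd, size h :: undup (flatten [seq hlist h a | a <- kids nd]))).

Definition halloc h nd : heap * nat :=
  if [seq e <- h | e.2.1 == nd] is e :: _ then (h, e.1) else (hnew h nd :: h, size h).

Definition bitnode (s : seq bool) : node := (None, map nat_of_bool s).

Definition node_term (d : nat -> term S) nd : term S :=
  if nd.1 is Some f then mk_app f [seq d a | a <- nd.2]
  else Var (bval [seq b != 0 | b <- nd.2]).

Fixpoint den h a : term S :=
  if h is e :: h' then if e.1 == a then node_term (den h') e.2.1 else den h' a
  else Var 0.

Arguments den : simpl never.

Lemma den_consE e h a :
  den (e :: h) a = if e.1 == a then node_term (den h) e.2.1 else den h a.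
Proof. by []. Qed.

Definition nodeok n nd : Prop :=
  if nd.1 is Some f then size nd.2 = arity f /\ {in nd.2, forall a, a < n}
  else exists x, nd = bitnode (nbits x).

Fixpoint wf h : Prop :=
  if h is e :: h' then
    [/\ wf h', nodeok (size h') e.2.1, e.2.1 \notin [seq x.2.1 | x <- h'] & e = hnew h' e.2.1]
  else True.

Lemma nodeok_le n m nd : nodeok n nd -> n <= m -> nodeok m nd.
Proof.
rewrite /nodeok; case: nd.1 => // f [s H] le; split=> // a /H lt; exact: leq_trans lt le.
Qed.

Lemma kids_lt n nd : nodeok n nd -> {in kids nd, forall a, a < n}.
Proof. by rewrite /nodeok /kids; case: nd.1 => [f [_ H]|]. Qed.

Lemma node_term_ext d d' nd : {in kids nd, d =1 d'} -> node_term d nd = node_term d' nd.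
Proof.
rewrite /kids /node_term; case: nd.1 => // f H; congr mk_app; exact/eq_in_map.
Qed.

Lemma node_term_bits d s : node_term d (bitnode s) = Var (bval s).
Proof. by rewrite /node_term /= -map_comp; congr (Var (bval _)); rewrite -[RHS]map_id; apply: eq_map; case. Qed.

Lemma node_term_inj n (d : nat -> term S) nd nd' :
  {in [pred a | a < n] &, injective d} -> nodeok n nd -> nodeok n nd' ->
  node_term d nd = node_term d nd' -> nd = nd'.
Proof.
move=> inj ok ok'; move: (ok) (ok'); rewrite /nodeok.
case E: nd.1 => [f|]; case E': nd'.1 => [g|]; last first.
- by move=> [x ->] [y ->]; rewrite !node_term_bits !nbitsK => -[->].
- by move=> _ _; rewrite /node_term E E'.
- by move=> _ _; rewrite /node_term E E'.
case=> s H [s' H']; rewrite /node_term E E' => e; have fg := App_symbol e; subst g.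
rewrite [nd]surjective_pairing [nd']surjective_pairing E E'; congr (_, _).
have /ffunP e' := App_args e; apply: (@eq_from_nth _ 0) => [|i]; first by rewrite s s'.
move=> lt; have lt' : i < arity f by rewrite -s.
have := e' (Ordinal lt'); rewrite !ffunE /= !(nth_map 0) ?s ?s' //; apply: inj.
  by apply: H; apply: mem_nth.
by apply: H'; apply: mem_nth; rewrite s'.
Qed.

Lemma hget_cons e h a : hget (e :: h) a = if e.1 == a then e.2 else hget h a.
Proof. by rewrite /hget /=; case: ifP. Qed.

Lemma den_cons e h a : wf (e :: h) -> a < size h -> den (e :: h) a = den h a.
Proof. by case=> _ _ _ -> lt; rewrite den_consE ifN //=; lia. Qed.

Lemma hnode_ok h a : wf h -> a < size h -> nodeok a (hnode h a).
Proof.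
elim: h => //= e h IH [w ok _ ->]; rewrite ltnS leq_eqVlt /hnode hget_cons /= => /orP[/eqP->|lt].
  by rewrite eqxx.
by rewrite ifN; [apply: IH|lia].
Qed.

Lemma den_node h a : wf h -> a < size h -> den h a = node_term (den h) (hnode h a).
Proof.
elim: h => // e h IH w; have [w' ok _ ee] := w; have e1 : e.1 = size h by rewrite ee.
rewrite [size _]/= ltnS leq_eqVlt => lt.
have ext nd : nodeok (size h) nd -> node_term (den h) nd = node_term (den (e :: h)) nd.
  by move=> /kids_lt kl; apply: node_term_ext => b /kl lb; rewrite den_cons.
rewrite /hnode hget_cons e1; case/orP: lt => [/eqP->|lt].
  by rewrite eqxx den_consE e1 eqxx; apply: ext.
rewrite ifN; last by lia.
rewrite den_cons // -ext; first exact: IH.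
by apply: nodeok_le (hnode_ok w' lt) _; lia.
Qed.

Lemma hnode_mem h a : wf h -> a < size h -> hnode h a \in [seq x.2.1 | x <- h].
Proof.
elim: h => // e h IH w; have [w' _ _ ee] := w; have e1 : e.1 = size h by rewrite ee.
rewrite [size _]/= ltnS leq_eqVlt [map _ _]/= inE /hnode hget_cons e1 => /orP[/eqP->|lt].
  by rewrite !eqxx.
by rewrite ifN; [rewrite -/(hnode h a) IH // orbT|lia].
Qed.

(** An old address with the term of the newest entry would, by injectivity on the smaller heap,
    carry the same node; but [wf] requires this node to be new. *)
Lemma den_inj h : wf h -> {in [pred a | a < size h] &, injective (den h)}.
Proof.
elim: h => // e h IH w a b; have [w' ok new ee] := w; have inj := IH w'.
have e1 : e.1 = size h by rewrite ee.
have newE : den (e :: h) (size h) = node_term (den h) e.2.1 by rewrite den_consE e1 eqxx.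
have old c : c < size h -> den h c = node_term (den h) e.2.1 -> False.
  move=> lt; rewrite den_node // => H; have E : hnode h c = e.2.1.
    by apply: (node_term_inj inj _ ok H); apply: nodeok_le (hnode_ok w' lt) (ltnW lt).
  by rewrite -E hnode_mem in new.
rewrite !inE /= !ltnS.
rewrite leq_eqVlt => /orP[/eqP->|la]; rewrite leq_eqVlt => /orP[/eqP->|lb] //.
- by rewrite newE den_cons // => /esym/old[].
- by rewrite newE den_cons // => /old[].
- by rewrite !den_cons //; apply: inj.
Qed.

Lemma wf_entry h e : wf h -> e \in h -> e.1 < size h /\ hget h e.1 = e.2.
Proof.
elim: h => //= e' h IH [w _ _ ee]; rewrite inE hget_cons => /orP[/eqP->|/(IH w)[lt ge]].
  by rewrite eqxx {1}ee /=.
by rewrite ifN; [split=> //; lia|rewrite ee /=; lia].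
Qed.

Lemma halloc_spec h nd : wf h -> nodeok (size h) nd ->
  let: (h', a) := halloc h nd in
  [/\ wf h', a < size h', den h' a = node_term (den h) nd,
      (size h <= size h' <= (size h).+1) /\ (size h < size h' -> a = size h)
    & forall b, b < size h -> den h' b = den h b].
Proof.
move=> w ok; rewrite /halloc; case E: [seq _ <- _ | _] => [|e fs].
  have w' : wf (hnew h nd :: h).
    split=> //; apply/mapP => -[x xh xe]; suff : x \in [::] by [].
    by rewrite -E mem_filter -xe eqxx.
  split=> //=; [by rewrite den_consE eqxx|by rewrite leqnSn leqnn; split|].
  by move=> b lt; apply: (den_cons w').
have : e \in e :: fs by rewrite mem_head.
rewrite -E mem_filter => /andP[/eqP end' /(wf_entry w)[lt ge]]; split=> //; last by rewrite leqnn leqnSn ltnn; split.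
by rewrite den_node // /hnode ge end'.
Qed.

Lemma hlist_spec h a : wf h -> a < size h ->
  [seq den h b | b <- hlist h a] = nodes (den h a) /\ {in hlist h a, forall b, b < size h}.
Proof.
elim: h a => // e h IH a w; have [w' ok _ ee] := w; have e1 : e.1 = size h by rewrite ee.
rewrite [size _]/= ltnS leq_eqVlt => lt.
have ext (s : seq nat) : {in s, forall b, b < size h} ->
    [seq den (e :: h) b | b <- s] = [seq den h b | b <- s].
  by move=> H; apply/eq_in_map => b /H; apply: den_cons.
rewrite /hlist hget_cons e1; case/orP: lt => [/eqP->|lt]; last first.
  rewrite ifN; last by lia.
  have [E H] := IH a w' lt; rewrite den_cons // -/(hlist h a) ext //.
  by split=> // b /H; lia.
rewrite eqxx.
set K := undup (flatten [seq hlist h b | b <- kids e.2.1]).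
have -> : e.2.2 = size h :: K by rewrite ee.
have HK : {in K, forall b, b < size h}.
  move=> b; rewrite mem_undup => /flattenP[_ /mapP[c ck ->]].
  by have [_ H] := IH c w' (kids_lt ok ck) => /H.
split; last by move=> b; rewrite inE => /orP[/eqP-> //|/HK]; lia.
rewrite map_cons ext // den_consE e1 eqxx.
have := ok; rewrite /K /node_term /nodeok /kids; case E: e.2.1.1 => [f|] //.
case=> sz lt; rewrite /mk_app nodes_App; congr (_ :: _).
(* [den] is injective on the addresses involved, so removing equal addresses removes exactly the
   equal terms. *)
rewrite -undup_map_in; last first.
  move=> x y /flattenP[_ /mapP[c ck ->] xc] /flattenP[_ /mapP[d dk ->] yd].
  have [_ Hc] := IH c w' (lt _ ck); have [_ Hd] := IH d w' (lt _ dk).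
  by apply: (den_inj w'); rewrite inE; [apply: Hc|apply: Hd].
congr undup; rewrite map_flatten -map_comp; congr flatten.
transitivity [seq nodes (den h b) | b <- e.2.1.2].
  by apply/eq_in_map => b bk /=; have [-> _] := IH b w' (lt _ bk).
apply: (@eq_from_nth _ [::]) => [|i].
  by rewrite [LHS]size_map [RHS]size_map size_enum_ord.
rewrite size_map sz => li.
rewrite (nth_map 0) ?sz // (nth_map (Ordinal li)) ?size_enum_ord //.
rewrite (_ : nth _ (enum _) i = Ordinal li); last by apply: val_inj; rewrite /= nth_enum_ord.
by rewrite ffunE /= (nth_map 0) ?sz.
Qed.

(** Arguments have smaller addresses than their node, so a path is no longer than the heap. This
    bounds the depths of the inputs by their encoded size. *)
Lemma depth_den h a : wf h -> a < size h -> depth (den h a) <= size h.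
Proof.
elim: h a => // e h IH a w; have [w' ok _ ee] := w; rewrite [size _]/= ltnS leq_eqVlt => /orP[/eqP->|lt].
  rewrite den_consE ee eqxx /node_term; move: ok; rewrite /nodeok; case: e.2.1.1 => // f [sz lt].
  rewrite /=; case: ifP => // _; rewrite ltnS; apply/bigmax_leqP => i _; rewrite ffunE.
  by rewrite (nth_map 0) ?sz //; apply: IH => //; apply: lt; apply: mem_nth; rewrite sz.
by rewrite den_cons //; apply: leq_trans (IH a w' lt) _.
Qed.

End Heap.

(** * The stack machine on heaps *)

Section HeapMachine.

Variable S : signature.
Implicit Types (h : heap S) (p : term S) (a : nat).

Definition hchild h a i := nth 0 (kids (hnode h a)) i.

Definition hsub h p a (x : nat) : nat :=
  if vpath x p is Some pi then foldl (hchild h) a pi else 0.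

Fixpoint hmatch_at h (sigma : nat -> nat) p a : bool :=
  match p with
  | Var x => sigma x == a
  | App f ps => ((hnode h a).1 == Some f) &&
      all (fun i : 'I_(arity f) => hmatch_at h sigma (ps i) (hchild h a i))
          (enum 'I_(arity f))
  end.

Definition hmatch h p a := hmatch_at h (hsub h p a) p a.

Definition hinstr : Type := (option (symbol S) * nat)%type.
Definition hstate : Type := (seq hinstr * (seq nat * heap S))%type.

Fixpoint hcode (sigma : nat -> nat) (t : term S) : seq hinstr :=
  match t with
  | Var x => [:: (None, sigma x)]
  | App g b => flatten [seq hcode sigma (b i) | i <- rev (enum 'I_(arity g))]
               ++ [:: (Some g, 0)]
  end.

Definition hargs n (vs : seq nat) := [seq nth 0 vs i | i <- iota 0 n].

Fixpoint happly (rs : trs S) (al : heap S * nat) (c : seq hinstr) (vs : seq nat) : hstate :=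
  if rs is q :: rs' then
    if hmatch al.1 q.1 al.2 then (hcode (hsub al.1 q.1 al.2) q.2 ++ c, (vs, al.1))
    else happly rs' al c vs
  else (c, (al.2 :: vs, al.1)).

(** The call is allocated even if it will be rewritten, so that matching can work on an address;
    this costs at most one new node. *)
Definition hcall (rs : trs S) (g : symbol S) (c : seq hinstr) (st : seq nat * heap S) : hstate :=
  happly rs (halloc st.2 (Some g, hargs (arity g) st.1)) c (drop (arity g) st.1).

Definition hstep (rs : trs S) (st : hstate) : hstate :=
  if st.1 is i :: c then
    if i.1 is Some g then hcall rs g c st.2 else (c, (i.2 :: st.2.1, st.2.2))
  else st.

(** With [Var 0] at address 0, the default address in heap functions denotes the default term in the
    functions that they simulate. *)
Definition hbase h : Prop := [/\ wf h, 0 < size h & den h 0 = Var 0].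

Lemma child_den h a i : hbase h -> a < size h ->
  child (den h a) i = den h (hchild h a i) /\ hchild h a i < size h.
Proof.
case=> w h0 d0 lt; rewrite den_node // /hchild; have := hnode_ok w lt.
rewrite /nodeok /node_term /kids; case: (hnode h a).1 => [f [sz kl]|_]; last first.
  by rewrite nth_default // d0.
have [li|le] := ltnP i (arity f); last first.
  rewrite /mk_app /child !nth_default ?sz ?d0 //.
  by rewrite size_map size_enum_ord.
split; last by apply: ltn_trans lt; apply: kl; apply: mem_nth; rewrite sz.
by rewrite -[i]/(nat_of_ord (Ordinal li)) child_App ffunE /= (nth_map 0) ?sz.
Qed.

Lemma hsub_den h p a x : hbase h -> a < size h ->
  den h (hsub h p a x) = tsub p (den h a) x /\ hsub h p a x < size h.
Proof.
move=> hb lt; rewrite /hsub /tsub; case: (vpath x p) => [pi|]; last by case: hb.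
elim: pi a lt => //= i pi IH a lt; have [e lt'] := child_den i hb lt.
by rewrite e; apply: IH.
Qed.

(** By [den_inj] equality of terms is equality of addresses, so a bound variable is checked by a
    single comparison. *)
Lemma hmatch_at_den h sigma p a : hbase h -> (forall x, sigma x < size h) -> a < size h ->
  hmatch_at h sigma p a = (subst (fun x => den h (sigma x)) p == den h a).
Proof.
move=> hb Hs; have w : wf h by case: hb.
elim: p a => [x|f ps IH] a lt /=.
  by apply/eqP/eqP => [-> //|]; apply: (den_inj w); rewrite inE.
have ch i := child_den i hb lt; have dn := den_node w lt; have := hnode_ok w lt.
rewrite /nodeok; case E: (hnode h a).1 => [g|]; last by move=> _; rewrite dn /node_term E.
case=> sz _; have dE : den h a = mk_app g (map (den h) (hnode h a).2) by rewrite dn /node_term E.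
rewrite dE; case: (eqVneq (Some g) (Some f)) => [[gf]|ne] /=; last first.
  by symmetry; apply/eqP => /App_symbol fg; rewrite fg eqxx in ne.
subst g; apply/allP/eqP => [H|e i _].
  rewrite /mk_app; congr App; apply/ffunP => i; have := H i; rewrite mem_enum => /(_ isT).
  by have [ci lti] := ch i; rewrite IH // => /eqP e; rewrite [LHS]ffunE e -ci dE /mk_app child_App.
by have [ci lti] := ch i; rewrite IH // -ci dE -e child_App ffunE.
Qed.

Lemma hmatch_den h p a : hbase h -> a < size h -> hmatch h p a = tmatch p (den h a).
Proof.
move=> hb lt; have H x := hsub_den p x hb lt.
rewrite /hmatch hmatch_at_den // => [|x]; last by case: (H x).
by rewrite /tmatch; congr (_ == _); apply: subst_ext => x _; case: (H x).
Qed.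

Definition iden h (i : hinstr) : tinstr S := (i.1, if i.1 is None then den h i.2 else Var 0).

Lemma hcode_den h sigma t :
  [seq iden h i | i <- hcode sigma t] = term_code (fun x => den h (sigma x)) t.
Proof.
elim: t => [x|f a IH] //=; rewrite map_cat map_flatten -map_comp /=.
by congr (flatten _ ++ _); apply: eq_map => i /=.
Qed.

Lemma hcode_lt h sigma t : (forall x, sigma x < size h) -> 0 < size h ->
  {in hcode sigma t, forall i, i.2 < size h}.
Proof.
move=> Hs h0; elim: t => [x|f a IH] i /=; first by rewrite inE => /eqP->; apply: Hs.
by rewrite mem_cat => /orP[/flattenP[_ /mapP[j _ ->] /IH]|] //; rewrite inE => /eqP->.
Qed.

Definition valid (st : hstate) : Prop :=
  [/\ hbase st.2.2, {in st.2.1, forall a, a < size st.2.2}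
    & {in st.1, forall i, i.2 < size st.2.2}].

Definition sden (st : hstate) : tstate S :=
  ([seq iden st.2.2 i | i <- st.1], [seq den st.2.2 a | a <- st.2.1]).

Lemma hargs_lt h n (vs : seq nat) : 0 < size h -> {in vs, forall a, a < size h} ->
  {in hargs n vs, forall a, a < size h}.
Proof.
move=> h0 H _ /mapP[i _ ->]; have [lt|le] := ltnP i (size vs); first exact: H (mem_nth _ lt).
by rewrite nth_default.
Qed.

Lemma size_hargs n vs : size (hargs n vs) = n.
Proof. by rewrite size_map size_iota. Qed.

Lemma hargs_den h g (vs : seq nat) : hbase h ->
  node_term (den h) (Some g, hargs (arity g) vs) = mk_app g (take (arity g) [seq den h a | a <- vs]).
Proof.
case=> _ _ d0; rewrite /node_term /=; congr App; apply/ffunP => i; rewrite !ffunE.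
rewrite nth_take // [LHS](nth_map 0) ?size_hargs //.
rewrite /hargs [in LHS](nth_map 0) ?size_iota // nth_iota // add0n.
have [lt|le] := ltnP i (size vs); first by rewrite (nth_map 0).
by rewrite !nth_default ?size_map.
Qed.

Lemma den_ext_base h h' : hbase h -> wf h' -> size h <= size h' ->
  (forall b, b < size h -> den h' b = den h b) -> hbase h'.
Proof. by case=> w h0 d0 w' le ext; split=> //; [apply: leq_trans le|rewrite ext]. Qed.

Lemma hcall_spec rs g c vs h : hbase h -> {in vs, forall a, a < size h} ->
  {in c, forall i, i.2 < size h} ->
  valid (hcall rs g c (vs, h)) /\
  sden (hcall rs g c (vs, h)) = fstep rs ((Some g, Var 0) :: [seq iden h i | i <- c], [seq den h a | a <- vs]).
Proof.
move=> hb Hv Hc; have [w h0 d0] := hb; rewrite /hcall /fstep /=.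
have ok : nodeok (size h) (Some g, hargs (arity g) vs).
  by split; [exact: size_hargs|exact: hargs_lt].
have := halloc_spec w ok; rewrite hargs_den //; case: (halloc h _) => h' a [w' lt da [/andP[le _] _] ext].
have hb' := den_ext_base hb w' le ext; have [_ h0' _] := hb'.
have Hv' : {in drop (arity g) vs, forall b, b < size h'}.
  by move=> b /mem_drop/Hv lb; apply: leq_trans lb le.
have Hc' : {in c, forall i, i.2 < size h'} by move=> i /Hc li; apply: leq_trans li le.
have cE : [seq iden h' i | i <- c] = [seq iden h i | i <- c].
  by apply/eq_in_map => -[[f|] b] bc //; rewrite /iden /= ext //; apply: (Hc _ bc).
have vE : [seq den h' b | b <- drop (arity g) vs] = drop (arity g) [seq den h b | b <- vs].
  by rewrite -map_drop; apply/eq_in_map => b /mem_drop/Hv/ext.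
elim: rs => [|q rs IH] /=.
  rewrite /sden /= cE vE da; split=> //; split=> //= b; rewrite inE => /orP[/eqP->|/Hv'] //.
rewrite hmatch_den // da; case: ifP => // _.
have H x := hsub_den q.1 x hb' lt; split.
  split=> //= i; rewrite mem_cat => /orP[|/Hc'] //; apply: hcode_lt => // x; by case: (H x).
rewrite /sden /= map_cat cE vE hcode_den; congr (_ ++ _, _); apply: term_code_ext => x _.
by case: (H x) => -> _; rewrite da.
Qed.

Lemma hstep_spec rs st : valid st ->
  valid (hstep rs st) /\ sden (hstep rs st) = fstep rs (sden st).
Proof.
case: st => [[|[[g|] a] c] [vs h]] // [hb Hv Hc]; rewrite /hstep /=.
  by apply: hcall_spec => // i ic; apply: Hc; rewrite inE ic orbT.
split=> //; split=> //= b; last by move=> bc; apply: Hc; rewrite inE bc orbT.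
by rewrite inE => /orP[/eqP->|/Hv] //; apply: (Hc (None, a)); rewrite mem_head.
Qed.

End HeapMachine.

(** * Reading and writing words *)

Section Words.

Variable S : signature.
Implicit Types (h : heap S) (a : nat).

Definition nword (ls : seq nat) (nd : node S) : seq (letter S) :=
  if nd.1 is Some f then
    lsym f :: flatten [seq larg :: [seq lbit c | c <- nbits (index b ls)] | b <- nd.2]
  else lvar :: [seq lbit (b != 0) | b <- nd.2].

Definition hword h a : seq (letter S) :=
  flatten [seq nword (hlist h a) (hnode h b) | b <- hlist h a].

Lemma nat_wordE n : nat_word n = [seq lbit c | c <- nbits n] :> seq (letter S).
Proof. by rewrite /nat_word /nbits; case: (bin_of_nat n). Qed.

Lemma index_map_in (T U : eqType) (f : T -> U) (s : seq T) x :
  {in x :: s &, injective f} -> index (f x) (map f s) = index x s.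
Proof.
elim: s => //= y s IH inj; rewrite IH; last first.
  by move=> u v us vs; apply: inj; [move: us|move: vs]; rewrite !inE => /orP[->|->]; rewrite ?orbT.
congr (if _ then _ else _); apply/eqP/eqP => [|-> //]; apply: inj; by rewrite !inE eqxx ?orbT.
Qed.

Lemma map_enum_nth (T U : Type) (d : T) n (s : seq T) (F : T -> U) : size s = n ->
  [seq F (nth d s (nat_of_ord i)) | i <- enum 'I_n] = [seq F b | b <- s].
Proof.
move=> sz; rewrite -[in RHS](mkseq_nth d s) /mkseq sz -val_enum_ord -!map_comp.
by apply: eq_map.
Qed.

Lemma hword_spec h a : wf h -> a < size h -> hword h a = term_word (den h a).
Proof.
move=> w lt; have [E H] := hlist_spec w lt; rewrite /term_word -E -map_comp /hword.
congr flatten; apply/eq_in_map => b bl /=; have lb := H b bl; rewrite den_node //.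
have := hnode_ok w lb; rewrite /nodeok /nword /node_term; case: (hnode h b).1 => [f [sz kl]|[x ->]] /=.
  congr (_ :: flatten _).
  rewrite -(map_enum_nth 0 (fun c => larg :: [seq lbit d | d <- nbits (index c (hlist h a))]) sz).
  apply: eq_map => i; rewrite ffunE (nth_map 0) ?sz // nat_wordE; congr (_ :: map _ (nbits _)).
  rewrite index_map_in // => c d; rewrite !inE => /orP[/eqP->|/H lc] /orP[/eqP->|/H ld];
    apply: (den_inj w); rewrite inE //; apply: ltn_trans lb; apply: kl; apply: mem_nth; by rewrite sz.
rewrite nat_wordE -!map_comp; congr (_ :: _).
rewrite (_ : map ((fun b => b != 0) \o nat_of_bool) (nbits x) = nbits x) ?nbitsK.
  by apply: eq_map; case.
by rewrite -[RHS]map_id; apply: eq_map; case.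
Qed.

Definition rnode : Type := (option (symbol S) * seq (seq bool))%type.
(** The bits of the number being read, the argument positions of the node being read, and the
    blocks, one per argument of the call. *)
Definition pstate : Type := (seq bool * (seq (seq bool) * seq (seq rnode)))%type.

Definition addnode (nd : rnode) (bs : seq (seq rnode)) : seq (seq rnode) :=
  if bs is b :: bs' then (nd :: b) :: bs' else [::].

(* Words are read from right to left, without any syntax check: after reading,
   the result is written again and compared with the input. *)
Definition pstep (l : letter S) (st : pstate) : pstate :=
  match l with
  | inl f => (st.1, ([::], addnode (Some f, st.2.1) st.2.2))
  | inr (inl b) => (b :: st.1, st.2)
  | inr (inr i) =>
      if val i == 0 then ([::], (st.2.1, addnode (None, [:: st.1]) st.2.2))
      else if val i == 1 then ([::], (st.1 :: st.2.1, st.2.2))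
      else (st.1, (st.2.1, [::] :: st.2.2))
  end.

Definition parse (x : seq (letter S)) : seq (seq rnode) :=
  (foldr pstep ([::], ([::], [::])) x).2.2.

Definition rnode_of (ns : seq (term S)) (u : term S) : rnode :=
  match u with
  | Var x => (None, [:: nbits x])
  | App f a => (Some f, [seq nbits (index (a i) ns) | i <- enum 'I_(arity f)])
  end.

Definition rblock (t : term S) := [seq rnode_of (nodes t) u | u <- nodes t].

Lemma pstep_bits s st : foldr pstep st [seq lbit c | c <- s] = (s ++ st.1, st.2).
Proof. by elim: s => [|b s IH] /=; [case: st|rewrite IH]. Qed.

Lemma pstep_node ns u b bs :
  foldr pstep ([::], ([::], b :: bs)) (node_word ns u) = ([::], ([::], (rnode_of ns u :: b) :: bs)).
Proof.
case: u => [x|f a] /=; first by rewrite nat_wordE pstep_bits /= inordK //= cats0.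
suff -> : foldr pstep ([::], ([::], b :: bs))
     (flatten [seq larg :: nat_word (index (a i) ns) | i <- enum 'I_(arity f)]) =
   ([::], ([seq nbits (index (a i) ns) | i <- enum 'I_(arity f)], b :: bs)) by [].
elim: (enum _) => //= i s IH; rewrite foldr_cat IH nat_wordE pstep_bits /=.
by rewrite inordK //= cats0.
Qed.

Lemma parse_args f (v : args f) : parse (args_word v) = [seq rblock (v i) | i <- enum 'I_(arity f)].
Proof.
rewrite /parse /args_word; suff -> : foldr pstep ([::], ([::], [::]))
     (flatten [seq rcons (term_word (v i)) lend | i <- enum 'I_(arity f)]) =
   ([::], ([::], [seq rblock (v i) | i <- enum 'I_(arity f)])) by [].
elim: (enum _) => //= i s IH; rewrite foldr_cat IH foldr_rcons /= inordK //= /term_word /rblock.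
rewrite (_ : foldr _ _ _ = ([::], ([::], ([seq rnode_of (nodes (v i)) u | u <- nodes (v i)] ++ [::]) ::
   [seq rblock (v i) | i <- s]))) ?cats0 //.
elim: {2 4}(nodes (v i)) => //= u ns IHn.
by rewrite foldr_cat IHn pstep_node.
Qed.

(** Each node gets its position in binary, the form in which others refer to it. The list comes out
    reversed, so arguments are loaded before the nodes that use them. *)
Definition keyed (b : seq rnode) : seq (seq bool * rnode) :=
  foldl (fun acc r => (nbits (size acc), r) :: acc) [::] b.

Definition look (tbl : seq (seq bool * nat)) (k : seq bool) : nat :=
  (head ([::], 0) [seq e <- tbl | e.1 == k]).2.

(** Loading never fails: defined symbols become variables, missing references address 0, and bits
    are normalized. Hence the heap holds values only; the later comparison of words rejects inputs
    changed in this way. *)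
Definition ldnode (tbl : seq (seq bool * nat)) (r : rnode) : node S :=
  if r.1 is Some f then
    if defined f then bitnode S [::]
    else (Some f, [seq look tbl (nth [::] r.2 i) | i <- iota 0 (arity f)])
  else bitnode S (strip (head [::] r.2)).

Definition lstep (st : heap S * seq (seq bool * nat)) (kr : seq bool * rnode) :=
  let al := halloc st.1 (ldnode st.2 kr.2) in (al.1, (kr.1, al.2) :: st.2).

Definition load h (b : seq rnode) := foldl lstep (h, [::]) (keyed b).

Definition ldblock (b : seq rnode) (st : heap S * seq nat) : heap S * seq nat :=
  let ld := load st.1 b in (ld.1, (head ([::], 0) ld.2).2 :: st.2).

Definition heap0 : heap S := [:: hnew [::] (bitnode S [::])].

Definition decode (n : nat) (x : seq (letter S)) : seq nat * heap S :=
  let st := foldr ldblock (heap0, [::]) (parse x) in (hargs n st.2, st.1).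

Definition ldok h : Prop := hbase h /\ forall a, a < size h -> value (den h a).

Lemma heap0_ok : ldok heap0.
Proof.
have w : wf heap0 by split=> //; exists 0.
have d0 : den heap0 0 = Var 0 by rewrite den_consE /= node_term_bits.
split=> // a; rewrite ltnS leqn0 => /eqP->; rewrite d0 /value.
by apply/subsetP => y; rewrite inE.
Qed.

Lemma look_lt h tbl k : hbase h -> {in tbl, forall e, e.2 < size h} -> look tbl k < size h.
Proof.
case=> _ h0 _ H; rewrite /look; case E: [seq _ <- _ | _] => [|e s] //=.
by apply: H; have : e \in e :: s := mem_head _ _; rewrite -E mem_filter => /andP[].
Qed.

Lemma ldnode_ok h tbl r : ldok h -> {in tbl, forall e, e.2 < size h} ->
  nodeok (size h) (ldnode tbl r) /\ value (node_term (den h) (ldnode tbl r)).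
Proof.
case=> hb Hv Ht; have vv x : value (Var x : term S) by apply/subsetP => y; rewrite inE.
rewrite /ldnode; case: r.1 => [f|]; last first.
  by rewrite node_term_bits -nbits_bval; split=> //; exists (bval (head [::] r.2)).
case: ifP => df; first by rewrite node_term_bits; split=> //; exists 0.
split.
  split=> [|_ /mapP[i _ ->]]; first by rewrite size_map size_iota.
  exact: look_lt.
rewrite /node_term /= /mk_app value_App df /=; apply/forallP => i; rewrite ffunE.
rewrite (nth_map 0) ?size_map ?size_iota // (nth_map 0) ?size_iota //.
by apply: Hv; apply: look_lt.
Qed.

Definition lok h (st : heap S * seq (seq bool * nat)) : Prop :=
  [/\ ldok st.1, {in st.2, forall e, e.2 < size st.1}, size h <= size st.1
    & forall b, b < size h -> den st.1 b = den h b].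

Lemma lstep_ok h st kr : lok h st ->
  lok h (lstep st kr) /\
  den (lstep st kr).1 (head ([::], 0) (lstep st kr).2).2 = node_term (den st.1) (ldnode st.2 kr.2) /\
  forall b, b < size st.1 -> den (lstep st kr).1 b = den st.1 b.
Proof.
case=> ok Ht le ext; have [nok vn] := ldnode_ok kr.2 ok Ht; have [[w h0 d0] Hv] := ok.
have := halloc_spec w nok; rewrite /lstep; case: (halloc _ _) => h' a /= [w' lt da [/andP[le' le2] le3] ext'].
split; last by [].
split=> /=.
- split; first exact: den_ext_base ext'.
  move=> b lb; have [lb'|ge] := ltnP b (size st.1); first by rewrite ext' //; apply: Hv.
  by rewrite (_ : b = a) ?da // le3; lia.
- move=> e; rewrite inE => /orP[/eqP-> //|/Ht lt']; exact: leq_trans lt' le'.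
- exact: leq_trans le le'.
- by move=> b lb; rewrite ext' ?ext //; apply: leq_trans lb le.
Qed.

Lemma load_ok h b : ldok h -> lok h (load h b).
Proof.
move=> ok; rewrite /load; have : lok h (h, [::]) by split.
by elim: (keyed b) (h, [::]) => //= kr s IH st /(lstep_ok kr)[/IH].
Qed.

Lemma head_load_lt h b : lok h (load h b) -> (head ([::], 0) (load h b).2).2 < size (load h b).1.
Proof.
case=> [[[w h0 _] _] Ht _ _]; case: (load h b).2 Ht => [|e s] //= Ht.
by apply: Ht; rewrite mem_head.
Qed.

Definition dok (st : heap S * seq nat) : Prop := ldok st.1 /\ {in st.2, forall a, a < size st.1}.

Lemma ldblock_ok b st : dok st -> dok (ldblock b st).
Proof.
case=> ok Ht; have lo := load_ok b ok; have [ok' _ le _] := lo; split=> //= a.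
by rewrite inE => /orP[/eqP->|/Ht lt]; [exact: head_load_lt|exact: leq_trans lt le].
Qed.

Lemma decode_ok n x : let d := decode n x in
  [/\ hbase d.2, forall a, a < size d.2 -> value (den d.2 a), size d.1 = n
    & {in d.1, forall a, a < size d.2}].
Proof.
have : dok (foldr ldblock (heap0, [::]) (parse x)).
  elim: (parse x) => [|b s IH] /=; first by split; [exact: heap0_ok|].
  exact: ldblock_ok.
rewrite /decode; case: (foldr _ _ _) => h vs [[hb Hv] Ht] /=; split=> //; first exact: size_hargs.
by apply: hargs_lt => //; case: hb.
Qed.

Lemma keyed_map (ns : seq (term S)) (F : term S -> rnode) : uniq ns ->
  keyed (map F ns) = rev [seq (nbits (index u ns), F u) | u <- ns].
Proof.
elim/last_ind: ns => // ns u IH; rewrite rcons_uniq => /andP[nu un].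
rewrite map_rcons /keyed foldl_rcons -/(keyed _) IH // size_rev size_map map_rcons rev_rcons.
congr ((nbits _, _) :: rev _); first by rewrite -cats1 index_cat (negbTE nu) /= eqxx addn0.
by apply/eq_in_map => v vn; rewrite -cats1 index_cat vn.
Qed.

Lemma load_rblock h t : ldok h -> value t ->
  lok h (load h (rblock t)) /\ den (load h (rblock t)).1 (head ([::], 0) (load h (rblock t)).2).2 = t.
Proof.
move=> ok vt; split; first exact: load_ok.
set ns := nodes t; have uns : uniq ns := undup_uniq _.
have vns : {in ns, forall u, rootc u} by apply/allP; rewrite -value_nodes.
have later : args_later ns by apply: args_later_undup; apply: args_later_subterms.
rewrite /load keyed_map // foldl_rev.
set G := fun x z => _; pose st s := foldr G (h, [::]) [seq (nbits (index u ns), rnode_of ns u) | u <- s].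
(* After the reversal, loading processes suffixes of the node list; [args_later] guarantees that the
   arguments of a node are in the suffix already loaded. *)
have H s : uniq s -> {subset s <= ns} -> args_later s ->
    [/\ lok h (st s), forall u, u \in s -> den (st s).1 (look (st s).2 (nbits (index u ns))) = u
      & forall u s', s = u :: s' -> den (st s).1 (head ([::], 0) (st s).2).2 = u].
  elim: s => [|u s IH]; first by split.
  move=> /andP[nu us] sub [lu ls].
  have [lo Hl _] := IH us (fun x xs => sub x (mem_behead (s := u :: s) xs)) ls.
  have un : u \in ns by apply: sub; rewrite mem_head.
  pose kr := (nbits (index u ns), rnode_of ns u).
  have -> : st (u :: s) = lstep (st s) kr by [].
  have [lo' [dh ext]] := lstep_ok kr lo.
  have E : node_term (den (st s).1) (ldnode (st s).2 kr.2) = u.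
    have := vns u un; case: u @kr lu {nu sub un lo' dh ext} => [x|f a] kr lu /=.
      by rewrite /ldnode /= node_term_bits strip_nbits nbitsK.
    rewrite /ldnode /= => /negbTE->; rewrite /node_term /=; congr App; apply/ffunP => i; rewrite ffunE.
    rewrite (nth_map 0) ?size_map ?size_iota // (nth_map 0) ?size_iota // nth_iota // add0n.
    by rewrite (nth_map i) ?size_enum_ord // nth_ord_enum Hl.
  rewrite E in dh; split=> //; last by move=> v s' [<- _].
  move=> v; rewrite inE /look /=; case: eqP => [->|ne] /=; first by rewrite eqxx => _; exact: dh.
  move=> vs; rewrite ifN; last first.
    apply/eqP => /nbits_inj e; apply: ne; rewrite -(nth_index u un) -(nth_index u (sub v _)) ?e //.
    by rewrite inE vs orbT.
  have lt : look (st s).2 (nbits (index v ns)) < size (st s).1.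
    by case: lo => -[hb _] Ht _ _; apply: look_lt.
  by rewrite ext //; apply: Hl.
have [_ _ /(_ t (behead ns))] := H ns uns (fun x => id) later; apply.
by rewrite /ns; case: (t) => [x|f a] //; rewrite nodes_App.
Qed.

Lemma decode_args f (v : args f) : (forall i, value (v i)) ->
  let d := decode (arity f) (args_word v) in forall i : 'I_(arity f), den d.2 (nth 0 d.1 i) = v i.
Proof.
move=> Hv; rewrite /decode parse_args.
have H (s : seq 'I_(arity f)) : let st := foldr ldblock (heap0, [::]) [seq rblock (v i) | i <- s] in
    dok st /\ [seq den st.1 a | a <- st.2] = [seq v i | i <- s].
  elim: s => [|i s [IH1 IH2]] /=; first by split=> //; split=> //; exact: heap0_ok.
  set st := foldr _ _ _ in IH1 IH2 *; split; first exact: ldblock_ok.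
  have [ok Ht] := IH1; have [[_ _ _ ext] e] := load_rblock ok (Hv i); rewrite e -IH2; congr (_ :: _).
  by apply/eq_in_map => a /Ht; apply: ext.
move: (H (enum 'I_(arity f))) => /=; case: (foldr _ _ _) => h vs [_ e] /= i.
have sz : size vs = arity f by have := congr1 size e; rewrite !size_map -enumT size_enum_ord.
rewrite (nth_map 0) ?size_iota // nth_iota // add0n -(nth_map 0 (Var 0)) ?sz // e.
by rewrite (nth_map i) ?size_enum_ord // nth_ord_enum.
Qed.

End Words.

(** * The heap machine runs in polynomial time per step *)

#[global] Instance enc_symbol (S : signature) : Enc (symbol S) := enc_fin (symbol S).
#[global] Instance enc_letter (S : signature) : Enc (letter S) := enc_fin (letter S).

Section HeapFunctions.

Variables (Sigma : finType) (S : signature).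
Notation pfn := (@pf Sigma _ _ _ _).

Section Consts.

Context {X A : Type} {EX : Enc X} {EA : Enc A}.

Lemma pf_map_const (I : Type) (s : seq I) (F : I -> X -> A) :
  (forall i, pfn (F i)) -> pfn (fun x => [seq F i x | i <- s]).
Proof. by move=> H; elim: s => [|i s IH] /=; [exact: pf_const|exact: pf_cons]. Qed.

Lemma pf_flatten_const (I : Type) (s : seq I) (F : I -> X -> seq A) :
  (forall i, pfn (F i)) -> pfn (fun x => flatten [seq F i x | i <- s]).
Proof. by move=> H; elim: s => [|i s IH] /=; [exact: pf_const|exact: pf_cat]. Qed.

Lemma pf_all_const (I : Type) (s : seq I) (F : I -> X -> bool) :
  (forall i, pfn (F i)) -> pfn (fun x => all (fun i => F i x) s).
Proof. by move=> H; elim: s => [|i s IH] /=; [exact: pf_const|exact: pf_andb]. Qed.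

End Consts.

Section Heaps.

Context {X : Type} {EX : Enc X}.
Variable h : X -> heap S.
Hypothesis Hh : @pf Sigma X (heap S) EX _ h.

Lemma pf_hget (a : X -> nat) : pfn a -> pfn (fun x => hget (h x) (a x)).
Proof.
move=> Ha; apply: (@pf_snd _ _ nat (node S * seq nat)); apply: pf_head; first exact: pf_const.
apply: (@pf_filter _ _ _ _ _ h (fun x e => e.1 == a x)) => //; apply: pf_eq; by pfs.
Qed.

Lemma pf_hnode (a : X -> nat) : pfn a -> pfn (fun x => hnode (h x) (a x)).
Proof. by move=> Ha; apply: pf_fst; apply: pf_hget. Qed.

Lemma pf_hlist (a : X -> nat) : pfn a -> pfn (fun x => hlist (h x) (a x)).
Proof. by move=> Ha; apply: pf_snd; apply: pf_hget. Qed.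

End Heaps.

Section Heaps2.

Context {X : Type} {EX : Enc X}.
Variable h : X -> heap S.
Hypothesis Hh : @pf Sigma X (heap S) EX _ h.

Lemma pf_kids (nd : X -> node S) : pfn nd -> pfn (fun x => kids (nd x)).
Proof.
move=> Hn; apply: (@pf_ocase _ _ (symbol S) _ _ _ _ (fun x => (nd x).1) _ (fun x _ => (nd x).2)); by pfs.
Qed.

Lemma pf_halloc (nd : X -> node S) : pfn nd -> pfn (fun x => halloc (h x) (nd x)).
Proof.
move=> Hn; apply: (@pf_case _ _ (hentry S) _ _ _ _ (fun x => [seq e <- h x | e.2.1 == nd x]) _
  (fun x e _ => (h x, e.1))).
- by apply: (@pf_filter _ _ _ _ _ h (fun x e => e.2.1 == nd x)) => //; apply: pf_eq; pfs.
- apply: pf_pair; last exact: pf_size.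
  apply: pf_cons => //; apply: pf_pair; first exact: pf_size.
  apply: pf_pair => //; apply: pf_cons; first exact: pf_size.
  apply: pf_undup; apply: (@pf_flatmap _ _ _ _ _ _ _ (fun x => kids (nd x)) (fun x a => hlist (h x) a)).
    exact: pf_kids.
  by apply: pf_hlist; pfs.
- by pfs.
Qed.

Lemma pf_hchild (a : X -> nat) i : pfn a -> pfn (fun x => hchild (h x) (a x) i).
Proof.
move=> Ha; apply: pf_nth_const.
apply: (@pf_ocase _ _ (symbol S) _ _ _ _ (fun x => (hnode (h x) (a x)).1) _
         (fun x _ => (hnode (h x) (a x)).2)).
- by apply: pf_fst; apply: pf_hnode.
- exact: pf_const.
- apply: pf_snd; apply: (@pf_comp _ _ _ _ _ _ _ (fun x => hnode (h x) (a x)) fst); last by pfs.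
  exact: pf_hnode.
Qed.

Lemma pf_hsub p (a : X -> nat) y : pfn a -> pfn (fun x => hsub (h x) p (a x) y).
Proof.
move=> Ha; rewrite /hsub; case: (vpath y p) => [pi|]; last exact: pf_const.
elim: pi a Ha => [|i pi IH] a Ha //=.
by apply: (IH (fun x => hchild (h x) (a x) i)); apply: pf_hchild.
Qed.

(** The pattern is a fixed term, so the recursion on it takes place when the program is built and
    not when it runs. *)
Lemma pf_hmatch_at p (sigma : X -> nat -> nat) (a : X -> nat) :
  (forall y, pfn (fun x => sigma x y)) -> pfn a ->
  pfn (fun x => hmatch_at (h x) (sigma x) p (a x)).
Proof.
move=> Hs; elim: p a => [y|f ps IH] a Ha /=; first exact: pf_eq.
apply: pf_andb.
  apply: pf_eq; last exact: pf_const.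
  by apply: pf_fst; apply: pf_hnode.
apply: pf_all_const => i; apply: IH; exact: pf_hchild.
Qed.

Lemma pf_hmatch p (a : X -> nat) : pfn a -> pfn (fun x => hmatch (h x) p (a x)).
Proof.
move=> Ha; apply: (@pf_hmatch_at p (fun x => hsub (h x) p (a x))) => // y; exact: pf_hsub.
Qed.

End Heaps2.

Lemma pf_hcode X {EX : Enc X} (sigma : X -> nat -> nat) (t : term S) :
  (forall y, pfn (fun x => sigma x y)) -> pfn (fun x => hcode (sigma x) t).
Proof.
move=> Hs; elim: t => [y|f a IH] /=; first by apply: pf_cons; [apply: pf_pair => //|]; exact: pf_const.
by apply: pf_cat; [apply: pf_flatten_const|exact: pf_const].
Qed.

Lemma pf_hargs X {EX : Enc X} n (vs : X -> seq nat) : pfn vs -> pfn (fun x => hargs n (vs x)).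
Proof. by move=> Hv; apply: pf_map_const => i; apply: pf_nth_const. Qed.

Lemma pf_happly X {EX : Enc X} rs (al : X -> heap S * nat) c vs :
  pfn al -> pfn c -> pfn vs -> pfn (fun x => happly rs (al x) (c x) (vs x)).
Proof.
move=> Ha Hc Hv; elim: rs => [|q rs IH] /=; first by pfs.
have H1 := pf_fst Ha; have H2 := pf_snd Ha.
apply: pf_if => //; first exact: pf_hmatch.
apply: pf_pair; last exact: pf_pair.
by apply: pf_cat => //; apply: pf_hcode => y; apply: pf_hsub.
Qed.

Lemma pf_hstep rs : pfn (@hstep S rs).
Proof.
apply: (@pf_case _ _ (hinstr S) _ _ _ _ (fun st => st.1) id (fun st i c =>
  if i.1 is Some g then hcall rs g c st.2 else (c, (i.2 :: st.2.1, st.2.2)))); try by pfs.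
apply: (@pf_ocase _ _ (symbol S) _ _ _ _ (fun p => p.2.1.1) _ (fun p g => hcall rs g p.2.2 p.1.2)); try by pfs.
(* The symbol comes from the state, but its arity shapes the program; hence one program per
   symbol. *)
apply: (@pf_fincase _ _ _ _ _ (symbol S) snd (fun g p => hcall rs g p.1.2.2 p.1.1.2)); first by apply: pf_snd; exact: pf_id.
move=> g; apply: pf_happly; try by pfs.
  by apply: pf_halloc; [|apply: pf_pair; [exact: pf_const|apply: pf_hargs]]; pfs.
by apply: pf_drop_const; pfs.
Qed.

Lemma sz_bits (s : seq bool) : sz s <= 4 * size s + 1.
Proof.
have : all (fun b => sz b <= 3) s by apply/allP => b _; exact: sz_bool.
by move/sz_le; lia.
Qed.

Lemma pf_strip X {EX : Enc X} (s : X -> seq bool) : pfn s -> pfn (fun x => strip (s x)).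
Proof.
move=> Hs; pose g (b : bool) t := if b || ~~ nilp t then b :: t else [::].
have E l : foldr g [::] l = strip l by elim: l => //= b l ->.
apply: (@pf_ext _ _ _ _ _ (fun x => foldr g [::] (s x))) => [x|]; first exact: E.
have le l : sz (strip l) <= sz l.
  by elim: l => //= b l IH; case: ifP; rewrite !sz_cons ?sz_nil; lia.
apply: (@pf_foldr _ _ _ _ _ _ _ s _ (fun _ => g) (fun x => sz (s x))) => //.
- exact: pf_const.
- apply: (@pf_ext _ _ _ _ _ (fun p : X * (bool * seq bool) => if p.2.1 then p.2.1 :: p.2.2 else
     if nilp p.2.2 then [::] else p.2.1 :: p.2.2)).
    by move=> [x [b t]]; rewrite /g /=; case: b; case: (nilp t).
  by apply: pf_if; [|..]; pfs; apply: pf_nilp; pfs.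
- exact: pf_sz Hs.
- by move=> x i; rewrite E; apply: leq_trans (le _) (sz_drop _ _).
Qed.

(** Increment as a left fold over the bits: the state is the carry and the bits written so far,
    reversed. *)
Definition binc_step (st : bool * seq bool) (b : bool) : bool * seq bool :=
  (st.1 && b, (if st.1 then ~~ b else b) :: st.2).

Lemma binc_foldl s : let st := foldl binc_step (true, [::]) s in
  rev (if st.1 then true :: st.2 else st.2) = binc s.
Proof.
have F s' acc : foldl binc_step (false, acc) s' = (false, rev s' ++ acc).
  by elim: s' acc => //= b s' IH acc; rewrite IH rev_cons cat_rcons.
suff H acc : let st := foldl binc_step (true, acc) s in
    rev (if st.1 then true :: st.2 else st.2) = rev acc ++ binc s by exact: (H [::]).
elim: s acc => [|[] s IH] acc /=; first by rewrite rev_cons cats1.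
  by rewrite /binc_step /= IH rev_cons cat_rcons.
by rewrite /binc_step /= F rev_cat revK rev_cons cat_rcons.
Qed.

Lemma pf_binc X {EX : Enc X} (s : X -> seq bool) : pfn s -> pfn (fun x => binc (s x)).
Proof.
move=> Hs; pose F x := foldl binc_step (true, [::]) (s x).
have PF : pfn F.
  apply: (@pf_foldl _ _ _ _ _ _ _ s _ (fun _ b st => binc_step st b) (fun x => 4 * sz (s x) + 5)) => //.
  - exact: pf_const.
  - apply: pf_pair; first by apply: pf_andb; pfs.
    by apply: pf_cons; [apply: pf_if; [|apply: pf_negb|]|]; pfs.
  - by have P := pf_sz Hs; pbs.
  move=> x i; change (sz (foldl binc_step (true, [::]) (take i (s x))) <= 4 * sz (s x) + 5).
  have [e1 e2] : size (foldl binc_step (true, [::]) (take i (s x))).2 = size (take i (s x)) /\ True.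
    split=> //; suff H st l : size (foldl binc_step st l).2 = size st.2 + size l by rewrite H.
    by elim: l st => [|b l IH] st /=; rewrite ?addn0 // IH /= addSnnS.
  rewrite sz_pair; have := sz_bool (foldl binc_step (true, [::]) (take i (s x))).1.
  have := sz_bits (foldl binc_step (true, [::]) (take i (s x))).2; rewrite e1 size_take_min.
  pose proof (size_sz (s x)); lia.
apply: (@pf_ext _ _ _ _ _ (fun x => rev (if (F x).1 then true :: (F x).2 else (F x).2))).
  by move=> x; rewrite /F binc_foldl.
apply: pf_rev; have H1 := pf_fst PF; have H2 := pf_snd PF.
by apply: pf_if => //; apply: pf_cons => //; exact: pf_const.
Qed.

Lemma size_binc s : size (binc s) <= (size s).+1.
Proof. by elim: s => [|[] s IH] /=; lia. Qed.

Lemma size_nbits n : size (nbits n) <= n.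
Proof. by elim: n => // n IH; rewrite nbitsS; apply: leq_trans (size_binc _) _. Qed.

Lemma pf_nbits X {EX : Enc X} (f : X -> nat) : pfn f -> pfn (fun x => nbits (f x)).
Proof.
move=> Hf; have E n : foldl (fun b (_ : unit) => binc b) [::] (nseq n tt) = nbits n.
  elim: n => // n IH; rewrite -[n.+1]addn1 nseqD foldl_cat IH addn1 nbitsS //.
apply: (@pf_ext _ _ _ _ _ (fun x => foldl (fun b (_ : unit) => binc b) [::] (nseq (f x) tt))) => [x|].
  exact: E.
apply: (@pf_foldl _ _ _ _ _ _ _ (fun x => nseq (f x) tt) _ (fun _ _ b => binc b)
   (fun x => 4 * sz (f x) + 1)).
(* A unary number and a list of that many [tt] have the same encoding, so the conversion costs
   nothing. *)
- by apply: pf_enc Hf => x; elim: (f x) => //= n ->.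
- exact: pf_const.
- by apply: pf_binc; pfs.
- by have P := pf_sz Hf; pbs.
move=> x i; rewrite (_ : take i _ = nseq (minn i (f x)) tt); last first.
  by apply: (@eq_from_nth _ tt) => [|j _]; [rewrite size_take_min !size_nseq|case: nth; case: nth].
rewrite E; have := sz_bits (nbits (minn i (f x))); have := size_nbits (minn i (f x)).
rewrite sz_nat; lia.
Qed.

End HeapFunctions.

(** * Size of heaps *)

Section HeapSize.

Variable S : signature.
Implicit Types (h : heap S).

Lemma sz_some A {EA : Enc A} (a : A) : sz (Some a) = (sz a).+2.
Proof. by rewrite /sz csize_Nd addn1. Qed.

Lemma sz_none A {EA : Enc A} : sz (None : option A) = 1.
Proof. by []. Qed.

Lemma sz_symbol (f : symbol S) : sz f <= 2 * #|symbol S|.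
Proof.
change (sz (nat_of_ord (enum_rank f)) <= 2 * #|symbol S|); rewrite sz_nat.
by rewrite -mul2n ltn_mul2l /=; exact: ltn_ord.
Qed.

(* V bounds the words stored in variable nodes. *)
Definition varbound (V : nat) h : Prop :=
  {in h, forall e, e.2.1.1 = None -> sz e.2.1.2 <= V}.

Definition heap_bound (n V : nat) : nat :=
  n * (2 * n + 1 + (2 * #|symbol S| + 9 + V + max_arity S * (2 * n + 2)) + (n * (2 * n + 2) + 1)).+1 + 1.

Lemma sz_addrs (s : seq nat) n : {in s, forall a, a < n} -> sz s <= size s * (2 * n + 2) + 1.
Proof.
move=> H; have : all (fun a => sz a <= 2 * n + 1) s by apply/allP => a /H; rewrite sz_nat; lia.
by move/sz_le; rewrite -[(2 * n + 1).+1]addn1 -addnA.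
Qed.

Lemma sz_heap n V h : wf h -> varbound V h -> size h <= n -> sz h <= heap_bound n V.
Proof.
move=> w vb le; set Q := 2 * n + 1 + (2 * #|symbol S| + 9 + V + max_arity S * (2 * n + 2)) + (n * (2 * n + 2) + 1).
have H : all (fun e : hentry S => sz e <= Q) h; last first.
  apply: leq_trans (sz_le H) _; rewrite /heap_bound -/Q leq_add2r leq_mul2r; by apply/orP; right.
elim: h w vb le => // e h IH w vb /= le; have [w' ok _ ee] := w.
apply/andP; split; last by apply: IH => // [e' e'h|]; [apply: vb; rewrite inE e'h orbT|lia].
have He := vb e (mem_head _ _).
have Hnd : sz e.2.1 <= 2 * #|symbol S| + 4 + V + max_arity S * (2 * n + 2).
  rewrite sz_pair; move: ok He; rewrite /nodeok; case: e.2.1.1 => [f [s lt] _|_ /(_ (erefl _)) He]; last first.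
    have ar p : p <= V -> 1 + p < 2 * #|symbol S| + 4 + V + max_arity S * (2 * n + 2) by lia.
    exact: ar He.
  have lt' : {in e.2.1.2, forall a, a < n} by move=> a /lt; lia.
  have sA : size e.2.1.2 <= max_arity S.
    by rewrite s; exact: (leq_bigmax (F := fun f : symbol S => arity f) f).
  have ar p q r : p <= 2 * #|symbol S| -> q <= r * (2 * n + 2) + 1 -> r <= max_arity S ->
      p.+2 + q < 2 * #|symbol S| + 4 + V + max_arity S * (2 * n + 2) by nia.
  rewrite sz_some; exact: ar (sz_symbol f) (sz_addrs lt') sA.
have HK : {in e.2.2, forall a, a < n} /\ size e.2.2 <= n.
  rewrite ee /=; set K := undup _.
  have HK : {in K, forall a, a < size h}.
    move=> a; rewrite mem_undup => /flattenP[_ /mapP[b bk ->]].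
    by have [_ H] := hlist_spec w' (kids_lt ok bk) => /H.
  split; first by move=> a; rewrite inE => /orP[/eqP->|/HK]; lia.
  (* A node list has no repetitions and only addresses of the heap, so it is no longer than the
     heap. *)
  have : size K <= size (iota 0 (size h)).
    by apply: uniq_leq_size; [exact: undup_uniq|move=> a /HK; rewrite mem_iota].
  by rewrite size_iota => /leq_ltn_trans; apply.
have [HK1 HK2] := HK; rewrite (sz_pair e) (sz_pair e.2).
have H1 : sz e.1 <= 2 * n + 1 by rewrite ee sz_nat /=; lia.
have ar p q r m : p <= 2 * n + 1 -> q <= 2 * #|symbol S| + 4 + V + max_arity S * (2 * n + 2) ->
    r <= m * (2 * n + 2) + 1 -> m <= n -> p + (q + r).+1 < Q by rewrite /Q; nia.
exact: ar H1 Hnd (sz_addrs HK1) HK2.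
Qed.

Lemma varbound_halloc V h nd : varbound V h -> (nd.1 = None -> sz nd.2 <= V) -> varbound V (halloc h nd).1.
Proof.
move=> vb Hn; rewrite /halloc; case: [seq _ <- _ | _] => // e; rewrite inE => /orP[/eqP->|/vb] //.
Qed.

Definition state_bound (N V : nat) : nat :=
  N * (2 * #|symbol S| + 2 * N + 10) + N * (2 * N + 2) + heap_bound N V + 10.

Definition hinv N V (st : hstate S) : Prop :=
  [/\ valid st, varbound V st.2.2, size st.1 <= N, size st.2.1 <= N & size st.2.2 <= N].

Lemma hinv_sz N V st : hinv N V st -> sz st <= state_bound N V.
Proof.
case=> -[[w _ _] Hv Hc] vb sc sv sh.
have Hv' : {in st.2.1, forall a, a < N} by move=> a /Hv; lia.
have H : all (fun i : hinstr S => sz i <= 2 * #|symbol S| + 2 * N + 6) st.1.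
  apply/allP => i /Hc lt; rewrite (sz_pair i) sz_nat.
  have ar p q : p <= 2 * #|symbol S| + 2 -> q < size st.2.2 ->
      p + q.*2.+1 < 2 * #|symbol S| + 2 * N + 6 by lia.
  apply: ar lt; case: i.1 => [f|]; last by rewrite sz_none; lia.
  by rewrite sz_some addn2; exact: sz_symbol.
have ar p q r c v : p <= c * (2 * #|symbol S| + 2 * N + 6).+1 + 1 -> q <= v * (2 * N + 2) + 1 ->
    r <= heap_bound N V -> c <= N -> v <= N -> (p + (q + r).+1).+1 <= state_bound N V.
  by rewrite /state_bound; move: (heap_bound N V) => hb; nia.
rewrite (sz_pair st) (sz_pair st.2); exact: ar (sz_le H) (sz_addrs Hv') (sz_heap w vb sh) sc sv.
Qed.

Lemma size_hcode sigma (t : term S) : size (hcode sigma t) = term_size t.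
Proof.
elim: t => [x|f a IH] //=; rewrite size_cat addn1; congr _.+1.
rewrite size_flatten /shape -map_comp sumnE big_map (perm_big _ (permEl (perm_rev _))) /= big_enum.
by apply: eq_bigr => i _; apply: IH.
Qed.

(** A step adds at most one node and either one value or the code of one right-hand side. So the
    state grows linearly with the steps, however large the terms become as trees. *)
Lemma hinv_hstep N V K rs st : 0 < K -> {in rs, forall q, term_size q.2 <= K} ->
  hinv N V st -> hinv (N + K) V (hstep rs st).
Proof.
move=> K0 HK [va vb sc sv sh]; have [va' _] := hstep_spec rs va.
move: va' vb sc sv sh; case: st va => [[|[[g|] a] c] [vs h]] va /= va' vb sc sv sh;
  [by split=> //=; lia| |by split=> //=; lia].
have [hb Hv Hc] := va; have [w h0 _] := hb.
have ok : nodeok (size h) (Some g, hargs (arity g) vs).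
  by split; [exact: size_hargs|exact: hargs_lt].
have vb' : varbound V (halloc h (Some g, hargs (arity g) vs)).1 by apply: varbound_halloc.
have := halloc_spec w ok; move: va' vb'; rewrite /hstep /= /hcall /=.
case: (halloc h _) => h' b va' vb' [_ _ _ [/andP[_ le] _] _]; rewrite /= in vb'.
have sd : size (drop (arity g) vs) <= N by rewrite size_drop; lia.
suff H : [/\ (happly rs (h', b) c (drop (arity g) vs)).2.2 = h',
    size (happly rs (h', b) c (drop (arity g) vs)).1 <= N + K
  & size (happly rs (h', b) c (drop (arity g) vs)).2.1 <= N + K].
  by case: H => H1 H2 H3; split=> //; rewrite H1 //; lia.
elim: rs HK {va'} => [|q rs IH] HK /=; first by split=> //=; lia.
case: ifP => _; last by apply: IH => r rr; apply: HK; rewrite inE rr orbT.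
split=> //=; last exact: leq_trans sd (leq_addr _ _).
rewrite size_cat size_hcode addnC; apply: leq_add; first exact: ltnW.
exact: HK (mem_head _ _).
Qed.

End HeapSize.

(** * Reading and writing in polynomial time *)

Section WordFunctions.

Variables (Sigma : finType) (S : signature).
Notation pfn := (@pf Sigma _ _ _ _).

Lemma pf_lbit X {EX : Enc X} (b : X -> bool) : pfn b -> pfn (fun x => lbit (b x) : letter S).
Proof.
move=> Hb; apply: (@pf_ext _ _ _ _ _ (fun x => if b x then lbit true else lbit false : letter S)).
  by move=> x; case: (b x).
by apply: pf_if => //; exact: pf_const.
Qed.

Lemma pf_nword X {EX : Enc X} (ls : X -> seq nat) (nd : X -> node S) :
  pfn ls -> pfn nd -> pfn (fun x => nword (ls x) (nd x)).
Proof.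
move=> Hl Hn; apply: (@pf_ocase _ _ (symbol S) _ _ _ _ (fun x => (nd x).1) _
  (fun x f => lsym f :: flatten [seq larg :: [seq lbit c | c <- nbits (index b (ls x))] | b <- (nd x).2])).
- by pfs.
- apply: pf_cons; first exact: pf_const.
  apply: (@pf_map _ _ _ _ _ _ _ (fun x => (nd x).2) (fun _ b => lbit (b != 0))); first by pfs.
  by apply: pf_lbit; apply: pf_negb; apply: pf_eq; pfs.
apply: pf_cons.
  apply: (@pf_fincase _ _ _ _ _ (symbol S) snd (fun f _ => lsym f)); last by move=> f; exact: pf_const.
  by apply: pf_snd; exact: pf_id.
apply: (@pf_flatmap _ _ _ _ _ _ _ (fun p => (nd p.1).2)
  (fun p b => larg :: [seq lbit c | c <- nbits (index b (ls p.1))])); first by pfs.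
apply: pf_cons; first exact: pf_const.
apply: (@pf_map _ _ _ _ _ _ _ (fun p => nbits (index p.2 (ls p.1.1))) (fun _ c => lbit c)).
  by apply: pf_nbits; apply: pf_index; pfs.
by apply: pf_lbit; pfs.
Qed.

Lemma pf_hword X {EX : Enc X} (h : X -> heap S) (a : X -> nat) :
  pfn h -> pfn a -> pfn (fun x => hword (h x) (a x)).
Proof.
move=> Hh Ha; have Hl := pf_hlist Hh Ha.
apply: (@pf_flatmap _ _ _ _ _ _ _ (fun x => hlist (h x) (a x))
  (fun x b => nword (hlist (h x) (a x)) (hnode (h x) b))) => //.
apply: pf_nword; last by apply: pf_hnode; pfs.
by apply: (@pf_comp _ _ _ _ _ _ _ (fun x => hlist (h x) (a x)) fst) => //; apply: pf_fst; exact: pf_id.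
Qed.

Lemma pf_addnode X {EX : Enc X} (nd : X -> rnode S) (bs : X -> seq (seq (rnode S))) :
  pfn nd -> pfn bs -> pfn (fun x => addnode (nd x) (bs x)).
Proof.
move=> Hn Hb; apply: (@pf_case _ _ _ _ _ _ _ bs _ (fun x b bs' => (nd x :: b) :: bs')) => //; by pfs.
Qed.

Lemma pf_pstep (l : letter S) : pfn (pstep l).
Proof.
case: l => [f|[b|i]] /=.
- by apply: pf_pair; [|apply: pf_pair; [|apply: pf_addnode]]; pfs.
- by apply: (@pf_ext _ _ _ _ _ (fun st : pstate S => (b :: st.1, st.2))) => //; pfs.
rewrite /pstep; case: (val i == 0).
  by apply: pf_pair; [|apply: pf_pair; [|apply: pf_addnode]]; pfs.
by case: (val i == 1); pfs.
Qed.

Lemma sz_addnode (nd : rnode S) bs : sz (addnode nd bs) <= sz bs + sz nd + 1.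
Proof. by case: bs => [|b bs] /=; rewrite ?sz_cons ?sz_nil; have := sz_gt0 nd; lia. Qed.

(** The pending data are moved and never copied, so each letter adds at most a constant; this bounds
    the fold in [parse]. *)
Lemma sz_pstep (l : letter S) st : sz (pstep l st) <= sz st + (2 * #|symbol S| + 20).
Proof.
case: st => [bits [as_ bs]]; rewrite (sz_pair (bits, _)) (sz_pair (as_, _)) /=.
case: l => [f|[b|i]] /=.
- rewrite !sz_pair /= sz_nil; have H := sz_addnode (Some f, as_) bs.
  rewrite sz_pair /= sz_some in H.
  have ar t u v a b : u <= 2 * #|symbol S| -> t <= v + (u.+2 + a).+1 + 1 ->
    b + (1 + t).+1 < (b + (a + v).+1).+1 + (2 * #|symbol S| + 20) by lia.
  exact: ar (sz_symbol f) H.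
- by rewrite !sz_pair /= sz_cons; have := sz_bool b; lia.
have H := sz_addnode (None, [:: bits]) bs; rewrite sz_pair /= sz_cons sz_nil in H.
case: ifP => _.
  rewrite !sz_pair /= sz_nil.
  have ar t v a b : t <= v + (1 + (b + 1).+1).+1 + 1 ->
    1 + (a + t).+1 < (b + (a + v).+1).+1 + (2 * #|symbol S| + 20) by lia.
  exact: ar H.
by case: ifP => _; rewrite !sz_pair /= ?sz_cons ?sz_nil; lia.
Qed.

Lemma pf_parse X {EX : Enc X} (w : X -> seq (letter S)) : pfn w -> pfn (fun x => parse (w x)).
Proof.
move=> Hw; apply: pf_snd; apply: pf_snd.
apply: (@pf_foldr _ _ _ _ _ _ _ w _ (fun _ => @pstep S)
   (fun x => (2 * #|symbol S| + 20) * sz (w x) + 10)) => //.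
- exact: pf_const.
- apply: (@pf_fincase _ _ _ _ _ (letter S) (fun p : X * (letter S * pstate S) => p.2.1) (fun l p => pstep l p.2.2)).
    by apply: pf_fst; apply: pf_snd; exact: pf_id.
  by move=> l; have H := pf_pstep l; pfs.
- by have P := pf_sz Hw; pbs.
move=> x i; set C := 2 * _ + 20.
have H (s : seq (letter S)) : sz (foldr (@pstep S) ([::], ([::], [::])) s) <= C * size s + 5.
  elim: s => [|l s IH]; first by rewrite !sz_pair /= !sz_nil; lia.
  apply: leq_trans (sz_pstep _ _) _; rewrite -/C.
  have ar p : p <= C * size s + 5 -> p + C <= C * (size s).+1 + 5 by rewrite mulnS; lia.
  exact: ar IH.
apply: leq_trans (H _) _; apply: leq_add => //; rewrite leq_mul2l; apply/orP; right.
by apply: leq_trans (ltnW (size_sz (w x))); rewrite size_drop; exact: leq_subr.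
Qed.

Lemma sz_keyed (b : seq (rnode S)) : sz (keyed b) <= size b * (4 * size b + sz b + 3) + 1 /\ size (keyed b) = size b.
Proof.
have H (s : seq (rnode S)) : {subset s <= b} -> size s <= size b ->
    all (fun e => sz e <= 4 * size b + sz b + 2) (keyed s) /\ size (keyed s) = size s.
  elim/last_ind: s => // s r IH sub; rewrite size_rcons => le.
  have [||H1 H2] := IH; [by move=> y ys; apply: sub; rewrite mem_rcons inE ys orbT|by lia|].
  rewrite /keyed foldl_rcons -/(keyed s) /= H1 H2; split=> //; rewrite andbT sz_pair /=.
  have rb : r \in b by apply: sub; rewrite mem_rcons mem_head.
  have H4 : sz (nbits (size s)) <= 4 * size s + 1.
    by apply: leq_trans (sz_bits _) _; rewrite leq_add2r leq_mul2l size_nbits.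
  have ar p q : p <= sz b -> q <= 4 * size s + 1 -> q + p < 4 * size b + sz b + 2 by lia.
  exact: ar (sz_mem rb) H4.
have [H1 H2] := H b (fun x => id) (leqnn _); split=> //.
by apply: leq_trans (sz_le H1) _; rewrite H2 -addnS.
Qed.

Lemma pf_keyed X {EX : Enc X} (b : X -> seq (rnode S)) : pfn b -> pfn (fun x => keyed (b x)).
Proof.
move=> Hb; apply: (@pf_foldl _ _ _ _ _ _ _ b _ (fun _ r acc => (nbits (size acc), r) :: acc)
  (fun x => sz (b x) * (5 * sz (b x) + 3) + 1)) => //.
- exact: pf_const.
- by apply: pf_cons; [apply: pf_pair; [apply: pf_nbits; apply: pf_size|]|]; pfs.
- by have P := pf_sz Hb; pbs.
move=> x i; have [le _] := sz_keyed (take i (b x)); apply: leq_trans le _.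
pose proof (sz_take (b x) i); pose proof (size_sz (take i (b x))); nia.
Qed.

Lemma pf_look X {EX : Enc X} (tbl : X -> seq (seq bool * nat)) k :
  pfn tbl -> pfn k -> pfn (fun x => look (tbl x) (k x)).
Proof.
move=> Ht Hk; apply: (@pf_snd _ _ (seq bool) nat); apply: pf_head; first exact: pf_const.
by apply: (@pf_filter _ _ _ _ _ tbl (fun x e => e.1 == k x)) => //; apply: pf_eq; pfs.
Qed.

Lemma pf_bitnode X {EX : Enc X} (s : X -> seq bool) : pfn s -> pfn (fun x => bitnode S (s x)).
Proof.
move=> Hs; apply: pf_pair; first exact: pf_const.
apply: (@pf_map _ _ _ _ _ _ _ s (fun _ b => nat_of_bool b)) => //.
apply: (@pf_ext _ _ _ _ _ (fun p : X * bool => if p.2 then 1 else 0)) => //; by pfs.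
Qed.

Lemma pf_ldnode X {EX : Enc X} (tbl : X -> seq (seq bool * nat)) (r : X -> rnode S) :
  pfn tbl -> pfn r -> pfn (fun x => ldnode (tbl x) (r x)).
Proof.
move=> Ht Hr; apply: (@pf_ocase _ _ (symbol S) _ _ _ _ (fun x => (r x).1) _
  (fun x f => if defined f then bitnode S [::]
    else (Some f, [seq look (tbl x) (nth [::] (r x).2 i) | i <- iota 0 (arity f)]))).
- by pfs.
- by apply: pf_bitnode; apply: pf_strip; apply: pf_head; pfs.
apply: (@pf_fincase _ _ _ _ _ (symbol S) snd (fun f p => if defined f then bitnode S [::]
    else (Some f, [seq look (tbl p.1) (nth [::] (r p.1).2 i) | i <- iota 0 (arity f)]))).
  by apply: pf_snd; exact: pf_id.
move=> f; case: (defined f); first exact: pf_const.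
apply: pf_pair; first exact: pf_const.
by apply: pf_map_const => i; apply: pf_look; [|apply: pf_nth_const]; pfs.
Qed.

(** The nested loops over blocks and nodes are flattened, with [None] at the end of each block:
    decoding becomes one fold with one size bound. *)
Definition items (x : seq (letter S)) : seq (option (seq bool * rnode S)) :=
  flatten [seq rcons (map Some (keyed b)) None | b <- rev (parse x)].

Definition dstate : Type := (heap S * (seq (seq bool * nat) * seq nat))%type.

Definition dstep (st : dstate) (it : option (seq bool * rnode S)) : dstate :=
  if it is Some kr then
    let al := halloc st.1 (ldnode st.2.1 kr.2) in (al.1, ((kr.1, al.2) :: st.2.1, st.2.2))
  else (st.1, ([::], (head ([::], 0) st.2.1).2 :: st.2.2)).

Definition dstate0 : dstate := (heap0 S, ([::], [::])).

Lemma decode_items n x :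
  decode n x = (hargs n (foldl dstep dstate0 (items x)).2.2, (foldl dstep dstate0 (items x)).1).
Proof.
have F ks (h : heap S) t r : foldl dstep (h, (t, r)) (map Some ks) =
    ((foldl (@lstep S) (h, t) ks).1, ((foldl (@lstep S) (h, t) ks).2, r)).
  by elim: ks h t => [|k ks IH] h t //=; rewrite {1}/dstep /= IH.
have G L (h : heap S) r : foldl dstep (h, ([::], r)) (flatten [seq rcons (map Some (keyed b)) None | b <- L]) =
    ((foldl (fun st b => ldblock b st) (h, r) L).1, ([::], (foldl (fun st b => ldblock b st) (h, r) L).2)).
  elim: L h r => [|b L IH] h r //=; rewrite foldl_cat foldl_rcons F {1}/dstep /= IH //.
by rewrite /decode /items G /= foldl_rev.
Qed.

Lemma pf_items X {EX : Enc X} (w : X -> seq (letter S)) : pfn w -> pfn (fun x => items (w x)).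
Proof.
move=> Hw; apply: (@pf_flatmap _ _ _ _ _ _ _ (fun x => rev (parse (w x)))
  (fun _ b => rcons (map Some (keyed b)) None)); first by apply: pf_rev; apply: pf_parse.
apply: (@pf_ext _ _ _ _ _ (fun p : X * seq (rnode S) => [seq Some e | e <- keyed p.2] ++ [:: None])).
  by move=> p; rewrite cats1.
apply: pf_cat; last exact: pf_const.
apply: (@pf_map _ _ _ _ _ _ _ (fun p : X * seq (rnode S) => keyed p.2) (fun _ e => Some e)); last by pfs.
by apply: pf_keyed; pfs.
Qed.

Lemma pf_dstep : pfn (fun p : dstate * option (seq bool * rnode S) => dstep p.1 p.2).
Proof.
apply: (@pf_ocase _ _ (seq bool * rnode S) _ _ _ _ snd _ (fun p kr =>
   ((halloc p.1.1 (ldnode p.1.2.1 kr.2)).1,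
    ((kr.1, (halloc p.1.1 (ldnode p.1.2.1 kr.2)).2) :: p.1.2.1, p.1.2.2)))).
- by apply: pf_snd; exact: pf_id.
- by apply: pf_pair; [|apply: pf_pair; [|apply: pf_cons; [apply: pf_snd; apply: pf_head|]]]; pfs.
have H : pfn (fun p : dstate * option (seq bool * rnode S) * (seq bool * rnode S) =>
    halloc p.1.1.1 (ldnode p.1.1.2.1 p.2.2)).
  by apply: pf_halloc; [|apply: pf_ldnode]; pfs.
by pfs.
Qed.

Definition dinv n V (st : dstate) : Prop :=
  [/\ ldok st.1, size st.1 <= n /\ varbound V st.1,
      size st.2.1 <= n /\ {in st.2.1, forall e, e.2 < size st.1 /\ sz e.1 <= V}
    & size st.2.2 <= n /\ {in st.2.2, forall a, a < size st.1}].

Lemma dinv_dstep n V st it : dinv n V st ->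
  (if it is Some kr then sz kr.1 <= V /\ 4 * size (head [::] kr.2.2) + 1 <= V else True) -> 1 <= V ->
  dinv n.+1 V (dstep st it).
Proof.
case=> ok [sh vb] [st1 Ht] [sr Hr] Hit V1; have [[w h0 _] _] := ok.
case: it Hit => [kr [k1 k2]|_]; last first.
  split=> //=; first by split=> //; lia.
  split; first by lia.
  move=> a; rewrite inE => /orP[/eqP->|/Hr] //.
  by case: st.2.1 Ht => [|e s] //= Ht; case: (Ht e (mem_head _ _)).
have Ht' : {in st.2.1, forall e, e.2 < size st.1} by move=> e /Ht[].
have lo : lok st.1 (st.1, st.2.1) by split.
have [lo' _] := lstep_ok kr lo; have [nok vn] := ldnode_ok kr.2 ok Ht'.
have := halloc_spec w nok; have : varbound V (halloc st.1 (ldnode st.2.1 kr.2)).1.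
  apply: varbound_halloc => // ; rewrite /ldnode; case: kr.2.1 => [f|] /=.
    by case: ifP => //= _ _; rewrite sz_nil.
  move=> _; apply: leq_trans k2.
  have H (s : seq bool) : sz (map nat_of_bool s) <= 4 * size s + 1.
    by elim: s => [|b s IH] //=; rewrite sz_cons sz_nat; case: b => /=; lia.
  have le (s : seq bool) : size (strip s) <= size s by elim: s => //= b s IH; case: ifP => /=; lia.
  by apply: leq_trans (H _) _; have := le (head [::] kr.2.2); lia.
move: lo'; rewrite /lstep /dstep /=; case: (halloc _ _) => h' a /= lo' vb' [_ lt _ [/andP[le1 le2] _] _].
have [ok' Ht2 _ _] := lo'; split=> //=.
- by split=> //; lia.
- split; first by lia.
  move=> e; rewrite inE => /orP[/eqP-> //|/Ht[l1 l2]]; split=> //; exact: leq_trans l1 le1.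
- split; first by lia.
  by move=> b /Hr l1; apply: leq_trans l1 le1.
Qed.

Lemma dinv_sz n V st : dinv n V st ->
  sz st <= heap_bound S n V + (n * (V + 2 * n + 4) + 1) + (n * (2 * n + 2) + 1) + 2.
Proof.
case=> [[[w _ _] _]] [sh vb] [st1 Ht] [sr Hr]; rewrite (sz_pair st) (sz_pair st.2).
have Hr' : {in st.2.2, forall a, a < n} by move=> a /Hr; lia.
have H : all (fun e : seq bool * nat => sz e <= V + 2 * n + 2) st.2.1.
  apply/allP => e /Ht[l1 l2]; rewrite (sz_pair e) sz_nat.
  have ar p q : p <= V -> q < size st.1 -> p + q.*2.+1 < V + 2 * n + 2 by lia.
  exact: ar l2 l1.
have ar p q r c v : p <= heap_bound S n V -> q <= c * (V + 2 * n + 2).+1 + 1 -> r <= v * (2 * n + 2) + 1 ->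
    c <= n -> v <= n ->
    (p + (q + r).+1).+1 <= heap_bound S n V + (n * (V + 2 * n + 4) + 1) + (n * (2 * n + 2) + 1) + 2.
  by move: (heap_bound _ _ _) => hb; nia.
exact: ar (sz_heap w vb sh) (sz_le H) (sz_addrs Hr') st1 sr.
Qed.

Lemma pf_decode X {EX : Enc X} (w : X -> seq (letter S)) n : pfn w -> pfn (fun x => decode n (w x)).
Proof.
move=> Hw; pose F x := foldl dstep dstate0 (items (w x)).
have Hi := pf_items Hw; have P := pf_sz Hi.
have PF : pfn F.
  (* In [V] a bit costs at most 4 and the end of a list 1; the successor in [n'] is for the node of
     [heap0]. *)
  pose (V := fun x => 4 * sz (items (w x)) + 1); pose (n' := fun x => (sz (items (w x))).+1).
  apply: (@pf_foldl _ _ _ _ _ _ _ (fun x => items (w x)) _ (fun _ it st => dstep st it)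
    (fun x => heap_bound S (n' x) (V x) + (n' x * (V x + 2 * n' x + 4) + 1) + (n' x * (2 * n' x + 2) + 1) + 2)) => //.
  - exact: pf_const.
  - apply: (@pf_comp _ _ _ _ _ _ _ (fun p => dstep p.1 p.2)
       (fun p : X * (option (seq bool * rnode S) * dstate) => (p.2.2, p.2.1))); first exact: pf_dstep.
    by pfs.
  - by rewrite /heap_bound /n' /V; pbs.
  move=> x i; apply: dinv_sz.
  have H (s : seq (option (seq bool * rnode S))) : {subset s <= items (w x)} ->
      dinv (size s).+1 (V x) (foldl dstep dstate0 s).
    elim/last_ind: s => [|s it IH] sub.
      split=> //; first exact: heap0_ok.
      by split=> // e; rewrite inE => /eqP-> _ /=; rewrite sz_nil /V; lia.
    rewrite foldl_rcons size_rcons; apply: dinv_dstep; last by rewrite /V; lia.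
      by apply: IH => y ys; apply: sub; rewrite mem_rcons inE ys orbT.
    have : it \in items (w x) by apply: sub; rewrite mem_rcons mem_head.
    case: it {sub IH} => // -[k [f rs]] itin; pose proof (sz_mem itin) as H.
    rewrite sz_some (sz_pair (k, _)) (sz_pair (f, rs)) /= in H.
    have ar1 p q t : (p + q).+1.+2 <= t -> p <= 4 * t + 1 by lia.
    split=> /=; first exact: ar1 H.
    rewrite /V; case: rs H {itin} => [|b rs] //=; first by move=> _; lia.
    rewrite sz_cons => H.
    have ar2 p q r u v t : (p + (q + (u + v).+1).+1).+1.+2 <= t -> r < u -> 4 * r + 1 <= 4 * t + 1 by lia.
    exact: ar2 H (size_sz b).
  have sub : {subset take i (items (w x)) <= items (w x)} by move=> y /mem_take.
  have [H1 [H2 H3] [H4 H5] [H6 H7]] := H _ sub.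
  have le : (size (take i (items (w x)))).+1 <= n' x.
    by rewrite /n' size_take_min; pose proof (size_sz (items (w x))); lia.
  by split=> //; split=> //; apply: leq_trans le.
apply: (@pf_ext _ _ _ _ _ (fun x => (hargs n (F x).2.2, (F x).1))).
  by move=> x; rewrite decode_items.
by apply: pf_pair; [apply: pf_hargs|]; pfs.
Qed.

End WordFunctions.

(** * Input and output *)

Section InputOutput.

Variable S : signature.
Notation Sigma := (letter S).
Notation tp := (tape (Sigma + bool)).
Notation tapes := {ffun 'I_6 -> tape (Sigma + bool)}.
Notation cmd := (cmd Sigma 5).
Notation sym := (option (Sigma + bool)).
Notation wc := (@word_cells Sigma bool).

Lemma wp_act_i md g (ts : tapes) ti to m a b c (Q : tapes -> Prop) :
  rep ts ti to m a b c ->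
  (forall ts', rep ts' (tape_act (g (scanned ti)) ti) to m a b c -> Q ts') ->
  wpc md (Act itape g : cmd) 1 ts Q.
Proof.
move=> R H; apply: wp_act; apply: H; split; rewrite ffunE /=;
  [by rewrite (rep_i R)|exact: (rep_o R)|exact: (rep_m R)|exact: (rep_a R)|exact: (rep_b R)|exact: (rep_c R)].
Qed.

Lemma wp_act_o md g (ts : tapes) ti to m a b c (Q : tapes -> Prop) :
  rep ts ti to m a b c ->
  (forall ts', rep ts' ti (tape_act (g (scanned to)) to) m a b c -> Q ts') ->
  wpc md (Act otape g : cmd) 1 ts Q.
Proof.
move=> R H; apply: wp_act; apply: H; split; rewrite ffunE /=;
  [exact: (rep_i R)|by rewrite (rep_o R)|exact: (rep_m R)|exact: (rep_a R)|exact: (rep_b R)|exact: (rep_c R)].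
Qed.

Definition nlet := #|Sigma|.

Fixpoint read_letter (ls : seq Sigma) : cmd :=
  if ls is a :: ls' then
    If itape (fun s : sym => s == Some (inl a)) (push_tree _ (enc a)) (read_letter ls')
  else skip _.

Lemma sz_letter (a : Sigma) : sz a <= 2 * nlet.
Proof.
change (sz (nat_of_ord (enum_rank a)) <= 2 * #|Sigma|); rewrite sz_nat.
by rewrite -mul2n ltn_mul2l /=; exact: ltn_ord.
Qed.

Lemma wp_read_letter md ls a (ts : tapes) ti to l r (Q : tapes -> Prop) :
  a \in ls -> scanned ti = Some (inl a) -> trep ts ti to l r ->
  (forall ts', trep ts' ti to (enc a :: l) r -> Q ts') ->
  wpc md (read_letter ls) (size ls + 4 * nlet) ts Q.
Proof.
move=> al si R H; elim: ls al => // b ls IH; rewrite inE => al /=; rewrite addSn.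
apply: wp_if; rewrite (rep_i R) si; case: (eqVneq a b) al => [ab _|ne] /=; last first.
  move/IH; suff -> : (Some (inl a : Sigma + bool) == Some (inl b)) = false by [].
  by apply/eqP => -[e]; rewrite e eqxx in ne.
subst b; rewrite eqxx; apply: (@wp_mono _ _ _ _ (2 * csize (enc a)) _ _ _ Q Q _ _ (fun _ => id)).
  exact: (@runs_push_tree Sigma (enc a) l) R H.
have ar p q : p <= 2 * nlet -> 2 * p <= q + 4 * nlet by lia.
exact: ar (sz_letter a).
Qed.

Definition keep_right : sym -> sym * option bool := fun s => (s, Some true).
Definition keep_left : sym -> sym * option bool := fun s => (s, Some false).

(** A list is built from its last element, so the head first runs to the right end and then reads
    backwards. *)
Definition read_input : cmd :=
  Seq (While itape (@nonblank Sigma) (Act itape keep_right))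
  (Seq (Act itape keep_left) (Seq (push_cell _ mtape false)
  (While itape (@nonblank Sigma)
    (Seq (read_letter (enum Sigma)) (Seq (push_cell _ mtape true) (Act itape keep_left)))))).

Lemma wp_scan_right md x1 x2 (ts : tapes) ti to l r (Q : tapes -> Prop) :
  trep ts ti to l r -> ti = Tape (rev (wc x1)) (head None (wc x2)) (behead (wc x2)) ->
  (forall ts', trep ts' (Tape (rev (wc (x1 ++ x2))) None [::]) to l r -> Q ts') ->
  wpc md (While itape (@nonblank Sigma) (Act itape keep_right) : cmd) (2 * size x2 + 1) ts Q.
Proof.
elim: x2 x1 ts ti => [|a x2 IH] x1 ts ti R e H.
  apply: wp_while_false; first by rewrite (rep_i R) e.
  by apply: H; rewrite cats0 -[Tape _ _ _]e.
rewrite (_ : 2 * size (a :: x2) + 1 = (1 + (2 * size x2 + 1)).+1); last by rewrite /=; lia.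
apply: wp_while_true; first by rewrite (rep_i R) e.
apply: (wp_act_i _ R) => ts' R'; apply: (IH (rcons x1 a)) R' _ _.
  by rewrite e /word_cells map_rcons rev_rcons.
by rewrite cat_rcons.
Qed.

Lemma wp_read_back md y (ts : tapes) ti to x r (Q : tapes -> Prop) :
  trep ts ti to [:: enc (x : seq Sigma)] r -> scanned ti = head None (wc y) -> lcells ti = behead (wc y) ->
  (forall ts' ti', trep ts' ti' to [:: enc (catrev y x)] r -> Q ts') ->
  wpc md (While itape (@nonblank Sigma)
    (Seq (read_letter (enum Sigma)) (Seq (push_cell _ mtape true) (Act itape keep_left))))
    (size y * (5 * nlet + 4) + 1) ts Q.
Proof.
elim: y x ts ti => [|a y IH] x ts ti R e1 e2 H.
  apply: wp_while_false; first by rewrite (rep_i R) e1.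
  exact: H R.
rewrite (_ : _ + 1 = ((5 * nlet + (2 + 1)) + (size y * (5 * nlet + 4) + 1)).+1); last by rewrite /=; lia.
apply: wp_while_true; first by rewrite (rep_i R) e1.
apply: wp_seq; apply: (@wp_mono _ _ _ _ (size (enum Sigma) + 4 * nlet) _ _ _ _ _ _ _ (fun _ => id)); last first.
- by rewrite -cardE -/nlet; lia.
have e1' : scanned ti = Some (inl a) := e1.
apply: (@wp_read_letter _ _ a _ _ _ _ _ _ _ e1' R) => [|t1 R1]; first by rewrite mem_enum.
apply: wp_seq; apply: (@runs_cons Sigma _ _ [::]) R1 _ => t2 R2.
apply: (wp_act_i _ R2) => t3 R3; apply: (IH (a :: x)) R3 _ _ _ => //=; by rewrite e2.
Qed.

Definition read_time n := 2 * n + (n * (5 * nlet + 4)) + 10.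

Lemma wp_read_input md x (ts : tapes) to r (Q : tapes -> Prop) :
  trep ts (word_tape x) to [::] r -> (forall ts' ti', trep ts' ti' to [:: enc x] r -> Q ts') ->
  wpc md read_input (read_time (size x)) ts Q.
Proof.
move=> R H; apply: (@wp_mono _ _ _ _ ((2 * size x + 1) + (1 + (2 + (size x * (5 * nlet + 4) + 1)))) _ _ _ _ _ _ _ (fun _ => id)).
- apply: wp_seq; apply: (wp_scan_right (x1 := [::]) _ R) => // t1 R1.
  apply: wp_seq; apply: (wp_act_i _ R1) => t2 R2.
  apply: wp_seq; apply: (@runs_push_Lf Sigma [::]) R2 _ => t3 R3.
  rewrite -(size_rev x); apply: (wp_read_back (x := [::]) _ R3).
  + by rewrite /= /word_cells map_rev.
  + by rewrite /= /word_cells map_rev.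
  + by move=> ts' ti'; rewrite -/(rev (rev x)) revK; apply: H.
- by rewrite /read_time; lia.
Qed.

(** A letter is encoded in unary by its rank in [enum]; each unit taken off skips one candidate. *)
Fixpoint write_letter (ls : seq Sigma) : cmd :=
  if ls is a :: ls' then
    If mtape (is_top true)
       (Seq (pop_cell _ mtape) (Seq (pop_cell _ mtape) (write_letter ls')))
       (Seq (pop_cell _ mtape) (Act otape (fun _ => (Some (inl a), Some false))))
  else skip _.

Lemma wp_write_letter md ls j a0 (ts : tapes) ti to l r (Q : tapes -> Prop) :
  j < size ls -> trep ts ti to (nat_tree j :: l) r ->
  (forall ts', trep ts' ti (tape_act (Some (inl (nth a0 ls j)), Some false) to) l r -> Q ts') ->
  wpc md (write_letter ls) (3 * j + 3) ts Q.
Proof.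
elim: ls j ts => // a ls IH [|j] ts lt R H /=.
  apply: (@wp_if _ _ _ _ _ _ _ 2); move: (R); rewrite /trep /= => R'; rewrite (stk_cons_scan (rep_m R')) /=.
  apply: (@wp_seq _ _ _ _ _ 1 1); apply: (@runs_pop_Lf Sigma l) R _ => t1 R1.
  by apply: (wp_act_o _ R1).
rewrite (_ : 3 * j.+1 + 3 = (1 + (1 + (3 * j + 3))).+1); last by lia.
apply: wp_if; move: (R); rewrite /trep /= => R'; rewrite (stk_cons_scan (rep_m R')) /=.
apply: wp_seq; apply: (@runs_uncons Sigma Lf (nat_tree j) l) R _ => t1 R1.
apply: wp_seq; apply: (@runs_pop_Lf Sigma) R1 _ => t2 R2.
exact: IH R2 H.
Qed.

(** Writing to the left leaves the head next to the first letter without a return pass. It also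
    reverses the word, which is why [hfin] delivers it reversed. *)
Definition write_output : cmd :=
  Seq (While mtape (is_top true) (Seq (pop_cell _ mtape) (write_letter (enum Sigma))))
      (Act otape (fun _ => (None, Some true))).

Lemma wp_write_loop md (y z : seq Sigma) (ts : tapes) ti r (Q : tapes -> Prop) :
  trep ts ti (Tape [::] None (wc z)) [:: enc y] r ->
  (forall ts', trep ts' ti (Tape [::] None (wc (catrev y z))) [:: Lf] r -> Q ts') ->
  wpc md (While mtape (is_top true) (Seq (pop_cell _ mtape) (write_letter (enum Sigma))))
    (size y * (3 * nlet + 5) + 1) ts Q.
Proof.
elim: y z ts => [|a y IH] z ts R H.
  apply: wp_while_false; last exact: H R.
  by move: (R); rewrite /trep /= => R'; rewrite (stk_cons_scan (rep_m R')).
rewrite (_ : _ + 1 = ((1 + (3 * nlet + 3)) + (size y * (3 * nlet + 5) + 1)).+1); last by rewrite /=; lia.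
apply: wp_while_true; first by move: (R); rewrite /trep /= => R'; rewrite (stk_cons_scan (rep_m R')).
apply: wp_seq; apply: (@runs_uncons Sigma (enc a) (enc y) [::]) R _ => t1 R1.
have lt : enum_rank a < size (enum Sigma) by rewrite -cardE; exact: ltn_ord.
apply: (@wp_mono _ _ _ _ (3 * enum_rank a + 3) _ _ _ _ _ _ _ (fun _ => id)); last first.
  by rewrite leq_add2r leq_mul2l /=; apply: ltnW; rewrite /nlet; exact: ltn_ord.
have R1' : trep t1 ti (Tape [::] None (wc z)) (nat_tree (enum_rank a) :: [:: enc y]) r := R1.
apply: (@wp_write_letter _ _ (enum_rank a) a _ _ _ _ _ _ lt R1') => t2; rewrite nth_enum_rank => R2.
exact: (IH (a :: z)) R2 H.
Qed.

Lemma wp_write_output md (y : seq Sigma) (ts : tapes) ti r (Q : tapes -> Prop) :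
  trep ts ti (word_tape [::]) [:: enc y] r -> y != [::] ->
  (forall ts' : tapes, tape_holds (ts' otape) (rev y) -> Q ts') ->
  wpc md write_output (size y * (3 * nlet + 5) + 2) ts Q.
Proof.
move=> R ne H; rewrite (_ : _ + 2 = (size y * (3 * nlet + 5) + 1) + 1); last by lia.
have R' : trep ts ti (Tape [::] None (wc [::])) [:: enc y] r := R.
apply: wp_seq; apply: (@wp_write_loop _ y [::] _ _ _ _ R') => t1 R1.
apply: (wp_act_o _ R1) => t2 R2; apply: H; rewrite (rep_o R2) /tape_holds.
(* The final move to the right passes one blank cell, which stays to the left of the word. *)
exists 1, 0; split=> //=; rewrite cats0 -/(rev y); have : rev y != [::] by rewrite -size_eq0 size_rev size_eq0.
by case: (rev y).
Qed.

End InputOutput.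

(** * The machine *)

Section Initial.

Variables (S : signature) (N : seq (term S)) (f : symbol S).
Notation Sigma := (letter S).
Notation pfn := (@pf Sigma _ _ _ _).

(** A word that does not encode argument values gives a halted state with empty stack, for which
    [hfin] answers no. *)
Definition hinit (x : seq Sigma) : hstate S :=
  let d := decode (arity f) x in
  if flatten [seq rcons (hword d.2 a) lend | a <- d.1] == x then ([:: (Some f, 0)], d)
  else ([::], ([::], heap0 S)).

Definition croot (nd : node S) : bool := if nd.1 is Some g then ~~ defined g else true.

(* The reversed result word, or the empty word for "no". *)
Definition hfin (st : seq nat * heap S) : seq Sigma :=
  if st.1 is a :: l then
    if nilp l && (all (fun b => croot (hnode st.2 b)) (hlist st.2 a)
                  && all (fun p => ~~ hmatch st.2 p a) N)
    then rev (hword st.2 a) else [::]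
  else [::].

Lemma pf_hinit : pfn hinit.
Proof.
have D : @pf Sigma _ _ _ _ (fun x : seq Sigma => decode (arity f) x) by apply: pf_decode; exact: pf_id.
have H1 := pf_fst D; have H2 := pf_snd D.
apply: pf_if; last exact: pf_const.
  apply: pf_eq; last exact: pf_id.
  apply: (@pf_flatmap _ _ _ _ _ _ _ (fun x => (decode (arity f) x).1)
    (fun x a => rcons (hword (decode (arity f) x).2 a) lend)) => //.
  apply: (@pf_ext _ _ _ _ _ (fun p : seq Sigma * nat => hword (decode (arity f) p.1).2 p.2 ++ [:: lend])).
    by move=> p; rewrite cats1.
  apply: pf_cat; last exact: pf_const.
  apply: pf_hword; last by pfs.
  by apply: (@pf_comp _ _ _ _ _ _ _ (fun x => (decode (arity f) x).2) fst) => //; apply: pf_fst; exact: pf_id.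
by apply: pf_pair => //; exact: pf_const.
Qed.

Lemma pf_croot X {EX : Enc X} (nd : X -> node S) : pfn nd -> pfn (fun x => croot (nd x)).
Proof.
move=> Hn; apply: (@pf_ocase _ _ (symbol S) _ _ _ _ (fun x => (nd x).1) _ (fun _ g => ~~ defined g)); try by pfs.
apply: (@pf_fincase _ _ _ _ _ (symbol S) snd (fun g _ => ~~ defined g)); last by move=> g; exact: pf_const.
by apply: pf_snd; exact: pf_id.
Qed.

Lemma pf_hfin : pfn hfin.
Proof.
apply: (@pf_case _ _ nat _ _ _ _ fst _ (fun st a l =>
  if nilp l && (all (fun b => croot (hnode st.2 b)) (hlist st.2 a) && all (fun p => ~~ hmatch st.2 p a) N)
  then rev (hword st.2 a) else [::])); try by pfs.
apply: pf_if; last exact: pf_const.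
  apply: pf_andb; first by apply: pf_nilp; pfs.
  apply: pf_andb.
    apply: (@pf_all _ _ _ _ _ (fun p : (seq nat * heap S) * (nat * seq nat) => hlist p.1.2 p.2.1)
      (fun p b => croot (hnode p.1.2 b))).
      by apply: pf_hlist; pfs.
    by apply: pf_croot; apply: pf_hnode; pfs.
  by apply: pf_all_const => p; apply: pf_negb; apply: pf_hmatch; pfs.
by apply: pf_rev; apply: pf_hword; pfs.
Qed.

Lemma args_word_den h (vs : seq nat) : hbase h -> size vs = arity f -> {in vs, forall a, a < size h} ->
  flatten [seq rcons (hword h a) lend | a <- vs] = args_word [ffun i : 'I_(arity f) => den h (nth 0 vs i)].
Proof.
case=> w _ _ sz Hv; rewrite /args_word; congr flatten.
rewrite -(map_enum_nth 0 (fun a => rcons (hword h a) lend) sz); apply: eq_map => i; rewrite ffunE.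
by rewrite hword_spec //; apply: Hv; apply: mem_nth; rewrite sz.
Qed.

(** [decode] is a left inverse on tuples of values. *)
Lemma args_word_inj (v v' : args f) : (forall i, value (v i)) -> (forall i, value (v' i)) ->
  args_word v = args_word v' -> v = v'.
Proof.
move=> Hv Hv' e; apply/ffunP => i; rewrite -(decode_args Hv i) -(decode_args Hv' i) e //.
Qed.

Lemma hinit_spec x :
  (hinit x = ([::], ([::], heap0 S)) /\ forall v : args f, (forall i, value (v i)) -> x <> args_word v) \/
  exists v : args f, [/\ forall i, value (v i), x = args_word v
    & sden (hinit x) = ([:: (Some f, Var 0)], [seq v i | i <- enum 'I_(arity f)])].
Proof.
rewrite /hinit; have [hb Hval sz Hv] := decode_ok (arity f) x.
rewrite args_word_den //; case: eqP => [<-|ne]; last first.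
  left; split=> // v vv e; apply: ne; rewrite e; congr args_word; apply/ffunP => i.
  by rewrite ffunE decode_args.
right; exists [ffun i : 'I_(arity f) => den (decode (arity f) x).2 (nth 0 (decode (arity f) x).1 i)].
have vv i : value ([ffun i : 'I_(arity f) => den (decode (arity f) x).2 (nth 0 (decode (arity f) x).1 i)] i).
  by rewrite ffunE; apply: Hval; apply: Hv; apply: mem_nth; rewrite sz.
split=> //; rewrite /sden /=; congr (_, _).
have [_ _ sz' _] := decode_ok (arity f) (args_word [ffun i : 'I_(arity f) => den (decode (arity f) x).2 (nth 0 (decode (arity f) x).1 i)]).
rewrite -(map_enum_nth 0 _ sz'); apply: eq_map => i; exact: decode_args.
Qed.

Lemma hinit_valid x : valid (hinit x).
Proof.
rewrite /hinit; have [hb Hval sz Hv] := decode_ok (arity f) x.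
case: ifP => _; last by split=> //; case: (heap0_ok S).
by split=> // i; rewrite inE => /eqP->; case: hb.
Qed.

Lemma hinit_hinv x : hinv (sz (hinit x)) (sz (hinit x)) (hinit x).
Proof.
have va := hinit_valid x; move: (hinit x) va => st va.
have H1 : sz st = (sz st.1 + (sz st.2.1 + sz st.2.2).+1).+1 by rewrite (sz_pair st) (sz_pair st.2).
have ar p q r n : n < p \/ n < q \/ n < r -> n <= (p + (q + r).+1).+1 by lia.
split=> //; rewrite ?H1; last 3 first.
- by apply: ar; left; apply: size_sz.
- by apply: ar; right; left; apply: size_sz.
- by apply: ar; right; right; apply: size_sz.
move=> e eh _; have le : sz (e : hentry S) <= sz st.2.2 by exact: sz_mem.
rewrite (sz_pair e) (sz_pair e.2) (sz_pair e.2.1) in le.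
have ar2 a b c d p q r : (a + ((b + c).+1 + d).+1).+1 <= r -> c <= (p + (q + r).+1).+1 by lia.
exact: ar2 le.
Qed.

Lemma hfin_spec st : valid ([::], st) -> hfin st != [::] ->
  exists a, [/\ st.1 = [:: a], value (den st.2 a), accepting N (den st.2 a)
              & rev (hfin st) = term_word (den st.2 a)].
Proof.
case: st => [[|a l] h]; first by rewrite /hfin.
move=> [/= hb Hv _]; have [w _ _] := hb; rewrite /hfin /=.
have lt : a < size h by apply: Hv; rewrite mem_head.
case: ifP => // /andP[/nilP l0 /andP[H1 H2]] _; exists a; rewrite l0 revK hword_spec //; split=> //.
  rewrite value_nodes; have [<- Hl] := hlist_spec w lt; rewrite all_map; apply/allP => b bl /=.
  have := allP H1 b bl; rewrite /croot den_node ?Hl // /node_term.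
  by case: (hnode h b).1.
move=> p sg pN e; have := allP H2 p pN; rewrite hmatch_den // => /tmatchP[]; by exists sg.
Qed.

Lemma hfin_complete h a : hbase h -> a < size h -> value (den h a) -> accepting N (den h a) ->
  hfin ([:: a], h) != [::].
Proof.
move=> hb lt va ac; have [w _ _] := hb; rewrite /hfin /= ifT; last first.
  apply/andP; split; last first.
    by apply/allP => p pN; rewrite hmatch_den //; apply/tmatchP => -[sg e]; apply: (ac p sg pN).
  apply/allP => b bl.
  have [E Hl] := hlist_spec w lt; move: va; rewrite value_nodes -E all_map => /allP/(_ b bl) /=.
  by rewrite den_node ?Hl // /node_term /croot; case: (hnode h b).1.
rewrite hword_spec // -size_eq0 size_rev /term_word; case: (den h a) => [x|g b] //=.
by rewrite nodes_App.
Qed.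

End Initial.

(** * The complete program and its verification *)

Section Main.

Variables (S : signature) (N : seq (term S)) (R : trs S) (f : symbol S) (RS : seq (trs S)).
Hypotheses (hR : constructor_trs R)
  (hvars : forall l r, (l, r) \in R -> {subset vars r <= vars l})
  (RSsub : forall rs, rs \in RS -> {subset rs <= R})
  (RSsup : forall rs, rs \in RS -> {subset R <= rs})
  (RSne : RS != [::]).
Variable c0 : nat.
Hypothesis Hc0 : forall g (w : 'I_(arity g) -> term S) D,
  (forall i, depth (w i) <= D) -> @callq S R ((D + 2) ^ c0) g w (fun _ => True).

Notation Sigma := (letter S).
Notation tapes := {ffun 'I_6 -> tape (Sigma + bool)}.
Notation cmd := (cmd Sigma 5).

Definition steps_all (C : cmd) (T : hstate S -> nat) (L : seq (trs S)) : Prop :=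
  forall st (ts : tapes) ti to r (Q : tapes -> Prop), trep ts ti to [:: enc st] r ->
    (forall rs, rs \in L -> forall ts', trep ts' ti to [:: enc (hstep rs st)] r -> Q ts') ->
    wpc true C (T st) ts Q.

Definition steps_some (C : cmd) (T : hstate S -> nat) (L : seq (trs S)) : Prop :=
  forall st (ts : tapes) ti to r (Q : tapes -> Prop) rs, rs \in L -> trep ts ti to [:: enc st] r ->
    (forall ts', trep ts' ti to [:: enc (hstep rs st)] r -> Q ts') ->
    wpc false C (T st) ts Q.

(** Each list has its own deterministic program for a step; [Choose] joins them, and with one list
    it does not occur. *)
Lemma choose_steps L : L != [::] -> exists (C : cmd) (T : hstate S -> nat),
  [/\ pb sz T, size L = 1 -> nochoice C, steps_all C T L & steps_some C T L].
Proof.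
elim: L => // rs [|rs' L] IH _; have [c [t [nc pt _ Hr]]] := @pf_hstep Sigma S rs.
  exists c, t; split=> // [st ts ti to r Q R0 H|st ts ti to r Q q].
    by apply: (Hr st true _ _ _ _ _ R0) => ts' R'; apply: H R'; rewrite mem_head.
  by rewrite inE => /eqP-> R0 H; apply: (Hr st false _ _ _ _ _ R0).
have [C [T [pT _ HA HS]]] := IH isT.
exists (Choose c C), (fun st => (t st + T st).+1); split=> //.
- by pbs.
- move=> st ts ti to r Q R0 H; apply: wp_choose_all.
    apply: (@wp_mono _ _ _ _ (t st) _ _ _ Q Q _ (leq_addr _ _) (fun _ => id)).
    by apply: (Hr st true _ _ _ _ _ R0) => ts' R'; apply: H R'; rewrite mem_head.
  apply: (@wp_mono _ _ _ _ (T st) _ _ _ Q Q _ (leq_addl _ _) (fun _ => id)).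
  by apply: HA R0 _ => q qL ts' R'; apply: H R'; rewrite inE qL orbT.
- move=> st ts ti to r Q q qL R0 H; apply: wp_choose_some.
  move: qL; rewrite inE => /orP[/eqP eq|qL]; [left|right].
    apply: (@wp_mono _ _ _ _ (t st) _ _ _ Q Q _ (leq_addr _ _) (fun _ => id)).
    by apply: (Hr st false _ _ _ _ _ R0) => ts' R'; apply: H; rewrite eq.
  apply: (@wp_mono _ _ _ _ (T st) _ _ _ Q Q _ (leq_addl _ _) (fun _ => id)).
  exact: HS qL R0 H.
Qed.

(** A bound for every right-hand side at once; the successor keeps it positive, which also pays for
    a pushed value or a new node. *)
Definition Kstep := (\sum_(q <- R) term_size q.2).+1.

Lemma Kstep_rule rs : rs \in RS -> {in rs, forall q, term_size q.2 <= Kstep}.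
Proof.
move=> rsin q /(RSsub rsin) qR; rewrite /Kstep (big_rem q) //=; lia.
Qed.

Lemma hinv_mono n m V st : @hinv S n V st -> n <= m -> hinv m V st.
Proof. by case=> va vb s1 s2 s3 le; split=> //; apply: leq_trans le. Qed.

Section Loop.

Variables (C : cmd) (T : hstate S -> nat) (Nm V TB : nat).
Hypotheses (HA : steps_all C T RS) (HS : steps_some C T RS)
  (HT : forall st, hinv Nm V st -> T st <= TB).

Lemma loop_test md (ts : tapes) ti to (st : hstate S) r Q k :
  trep ts ti to [:: enc st.1; enc st.2] r -> st.1 = [::] -> Q ts ->
  wpc md (loop_cmd C) (k + 1) ts Q.
Proof.
move=> R0 e q; rewrite addn1; apply: wp_while_false => //.
by move: R0; rewrite e /trep /= => R'; rewrite (stk_cons_scan (rep_m R')).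
Qed.

Lemma loop_round md (ts : tapes) ti to (st : hstate S) r Q k :
  trep ts ti to [:: enc st.1; enc st.2] r -> st.1 != [::] -> hinv Nm V st ->
  (forall ts1, trep ts1 ti to [:: enc st] r ->
     wpc md C (T st) ts1 (fun ts' => exists2 st' : hstate S, trep ts' ti to [:: enc st'] r &
       forall ts2, trep ts2 ti to [:: enc st'.1; enc st'.2] r -> wpc md (loop_cmd C) k ts2 Q)) ->
  wpc md (loop_cmd C) (TB + 4 + k) ts Q.
Proof.
move=> R0 ne hi H; rewrite (_ : TB + 4 + k = ((2 + (TB + 1)) + k).+1); last by lia.
apply: wp_while_true.
  move: R0 ne; case: (st.1) => // i l; rewrite /trep /= => R' _.
  by rewrite (stk_cons_scan (rep_m R')).
apply: wp_seq; apply: (@runs_cons Sigma _ _ [::]) R0 _ => t1 R1.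
apply: wp_seq; apply: (wp_mono (H t1 R1) (HT hi)) => t2 [st' R2 H2].
by apply: (@runs_uncons Sigma (enc st'.1) (enc st'.2) [::]) R2 _ => t3 /H2.
Qed.

(** [n] bounds the current state. Since [n + k * Kstep] stays below [Nm], the remaining rounds all
    remain within the sizes for which [TB] bounds the time of a step. *)
Lemma wp_loop_all k n (ts : tapes) ti to (st : hstate S) r (Q : tapes -> Prop) :
  must R k (sden st) (fun _ => True) -> hinv n V st -> n + k * Kstep <= Nm ->
  trep ts ti to [:: enc st.1; enc st.2] r ->
  (forall m st' ts', reach RS m (sden st) (sden st') -> st'.1 = [::] -> hinv Nm V st' ->
     trep ts' ti to [:: Lf; enc st'.2] r -> Q ts') ->
  wpc true (loop_cmd C) (k * (TB + 4) + 1) ts Q.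
Proof.
elim: k n ts st => [|k IH] n ts st mu hi le R0 H; have hi' : hinv Nm V st by apply: hinv_mono hi _; lia.
  case E: st.1 => [|i l]; last by move: mu; rewrite /must /sden E.
  apply: (loop_test _ _ R0) => //; apply: (H 0 st) => //; first exact: reach0.
  by rewrite E in R0.
case: (eqVneq st.1 [::]) => [E|ne].
  apply: (loop_test _ _ R0) => //; apply: (H 0 st) => //; first exact: reach0.
  by rewrite E in R0.
rewrite mulSn -addnA; apply: (loop_round R0) => // t1 R1; apply: (HA R1) => rs rsin t2 R2.
exists (hstep rs st) => // t3 R3; have [va _ _ _ _] := hi; have [va' E] := hstep_spec rs va.
have ne' : (sden st).1 != [::] by move: ne; rewrite /sden /=; case: (st.1).
have mu' : must R k (sden (hstep rs st)) (fun _ => True).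
  move: mu (fstep_tstep RSsub rsin ne'); rewrite -E; move: ne'.
  by case: (sden st) => [[|i l] vs] //= _ mu /mu.
apply: (IH (n + Kstep)) mu' _ _ R3 _.
- by apply: hinv_hstep hi => //; exact: Kstep_rule.
- by rewrite mulSn in le; lia.
move=> m st' ts' re; apply: (H m.+1); apply: (reachS ne' rsin); by rewrite -E.
Qed.

Lemma wp_loop_some m n vs (ts : tapes) ti to (st : hstate S) r (Q : tapes -> Prop) :
  reach RS m (sden st) ([::], vs) -> hinv n V st -> n + m * Kstep <= Nm ->
  trep ts ti to [:: enc st.1; enc st.2] r ->
  (forall st' ts', sden st' = ([::], vs) -> hinv Nm V st' ->
     trep ts' ti to [:: Lf; enc st'.2] r -> Q ts') ->
  wpc false (loop_cmd C) (m * (TB + 4) + 1) ts Q.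
Proof.
move E0: (sden st) => ss; move E1: ([::], vs) => fin re.
elim: re n ts st E0 E1 => {m ss fin} [ss|m rs ss fin ne rsin _ IH] n ts st E0 E1 hi le R0 H;
  have hi' : hinv Nm V st by apply: hinv_mono hi _; lia.
  have E : st.1 = [::] by move: (congr1 (fun z => z.1) E0); rewrite -E1 /sden /=; case: (st.1).
  apply: (loop_test _ _ R0) => //; apply: (H st) => //.
  by rewrite E in R0.
have ne' : st.1 != [::] by move: ne; rewrite -E0 /sden /=; case: (st.1).
rewrite mulSn -addnA; apply: (loop_round R0) => // t1 R1; apply: (HS rsin R1) => t2 R2.
exists (hstep rs st) => // t3 R3; have [va _ _ _ _] := hi; have [va' E] := hstep_spec rs va.
apply: (IH (n + Kstep)) E1 _ _ R3 H; first by rewrite E E0.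
- by apply: hinv_hstep hi => //; exact: Kstep_rule.
- by rewrite mulSn in le; lia.
Qed.

End Loop.

Definition Kruns x := (sz (hinit f x) + 2) ^ c0.

(** The arguments are stored in the initial heap, so their depths are bounded by its size and [Hc0]
    yields a bound in terms of the encoded input. *)
Lemma must_hinit x : must R (Kruns x) (sden (hinit f x)) (fun _ => True).
Proof.
have [[-> _]|[v [vv xe e]]] := hinit_spec f x; first by rewrite /sden /=; case: (Kruns x).
have [va _ _ _ hs] := hinit_hinv f x; have [[w _ _] Hv _] := va.
have dv i : depth (v i) <= sz (hinit f x).
  apply: leq_trans hs; have : v i \in (sden (hinit f x)).2.
    by rewrite e; apply: map_f; rewrite mem_enum.
  by case/mapP=> a /Hv lt ->; apply: depth_den.
have := Hc0 dv [::] (Var 0); rewrite cats0 e => H; exact: must_mono H (leqnn _) _.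
Qed.

Definition problem := word_relation (sem N R (f := f)).

Lemma call_sound m (v : args f) vs : (forall i, value (v i)) ->
  reach RS m ([:: (Some f, Var 0)], [seq v i | i <- enum 'I_(arity f)]) ([::], vs) ->
  exists w, [/\ vs = [:: w], clos_refl_trans _ (istep R) (App f v) w & normal_form R w].
Proof.
move=> vv re; have [||w [wE st nw]] := @reach_sound S R RS hR hvars RSsub RSsup _ _ _ (App f v) re; last by exists w.
- split=> t /=; last by rewrite inE.
  by case/mapP=> i _ ->; apply: value_nf.
- rewrite /readback /= /rbi /=.
    have [-> ->] : take (arity f) [seq v i | i <- enum 'I_(arity f)] = [seq v i | i <- enum 'I_(arity f)] /\
      drop (arity f) [seq v i | i <- enum 'I_(arity f)] = [::].
    by have /= := take_drop_enum v [::]; rewrite cats0.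
  by rewrite mk_app_enum; congr [:: App f _]; apply/ffunP => i; rewrite ffunE.
Qed.

Lemma final_sound x m (st : hstate S) : reach RS m (sden (hinit f x)) (sden st) -> st.1 = [::] ->
  valid st -> hfin N st.2 != [::] -> problem x (rev (hfin N st.2)).
Proof.
move=> re e va nf; have va' : valid ([::], st.2) by case: st e va {re nf} => c st /= ->.
have [a [sa vala acc ->]] := hfin_spec va' nf.
have sE : sden st = ([::], [:: den st.2.2 a]) by rewrite /sden e sa.
have [[hE _]|[v [vv xe he]]] := hinit_spec f x.
  by rewrite hE sE /sden /= in re; inversion re.
rewrite sE he in re; have [w [[wE] st' nw]] := call_sound vv re.
by exists v, w; rewrite wE in vala acc *; split=> //; split.
Qed.

Lemma final_complete w (st : hstate S) : sden st = ([::], [:: w]) -> valid st ->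
  value w -> accepting N w -> hfin N st.2 != [::].
Proof.
case: st => c [[|a [|b vs]] h] [] // _ [<-] [hb Hv _] vw ac; apply: hfin_complete => //.
by apply: Hv; rewrite mem_head.
Qed.

Lemma pb_state_bound (X : Type) (mu A B : X -> nat) : pb mu A -> pb mu B ->
  pb mu (fun x => state_bound S (A x) (B x)).
Proof. by move=> PA PB; rewrite /state_bound /heap_bound; pbs. Qed.

(** Both classes come from one program: for FNP the list [RS] offers guesses, for FP it has a single
    element and the machine is deterministic. *)
Theorem machine_exists : exists M : machine Sigma,
  [/\ polytime M, size RS = 1 -> deterministic M,
      forall x c, accepts_with x c -> exists2 y, tape_holds (c.2 (ord_max : 'I_(ntape M).+1)) y & problem x y
    & forall (v : args f) m w, (forall i, value (v i)) ->
        reach RS m ([:: (Some f, Var 0)], [seq v i | i <- enum 'I_(arity f)]) ([::], [:: w]) ->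
        value w -> accepting N w -> exists c : config M, accepts_with (args_word v) c].
Proof.
have [ci [ti [nci pti psi Hi]]] := @pf_hinit S f.
have [cf [tf [ncf [kf Hkf] [ks Hks] Hf]]] := @pf_hfin S N.
have [C [T [[kT HkT] ncC HA HS]]] := choose_steps RSne.
pose prog : cmd := Seq (read_input S) (Seq ci (Seq (pop_cell _ mtape) (Seq (loop_cmd C)
  (Seq (pop_cell _ mtape) (Seq cf (If mtape (is_top true) (write_output S) (Halt _ _))))))).
pose (s0 := fun x : seq Sigma => sz (hinit f x)).
pose (Nm := fun x => s0 x + Kruns x * Kstep).
pose (SB := fun x => state_bound S (Nm x) (s0 x)).
pose (TB := fun x => (SB x + 2) ^ kT).
pose (Tl := fun x => Kruns x * (TB x + 4) + 1).
pose (Tf := fun x => (SB x + 2) ^ kf).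
pose (To := fun x => (SB x + 2) ^ ks * (3 * nlet S + 5) + 3).
pose (TT := fun x => read_time S (size x) + (ti x + (1 + (Tl x + (1 + (Tf x + To x)))))).
have HT x st : hinv (Nm x) (s0 x) st -> T st <= TB x.
  by move=> hi; apply: leq_trans (HkT st) _; apply: leq_powl; apply: hinv_sz.
have sz2 x (st : hstate S) : hinv (Nm x) (s0 x) st -> sz st.2 <= SB x.
  move=> hi; apply: leq_trans (hinv_sz hi); rewrite [X in _ <= X]sz_pair; lia.
(* [Halt] satisfies the mode of all runs only; where some accepting run is wanted, the answer has to
   be non-empty. *)
have tail md x (st : hstate S) (ts : tapes) ti0 r Q : trep ts ti0 (word_tape [::]) [:: Lf; enc st.2] r ->
    hinv (Nm x) (s0 x) st ->
    (hfin N st.2 != [::] \/ md = true) ->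
    (forall ts' : tapes, hfin N st.2 != [::] -> tape_holds (ts' otape) (rev (hfin N st.2)) -> Q ts') ->
    wpc md (Seq (pop_cell _ mtape) (Seq cf (If mtape (is_top true) (write_output S) (Halt _ _))))
       (1 + (Tf x + To x)) ts Q.
  move=> R0 hi D H; apply: wp_seq; apply: (@runs_pop_Lf Sigma [:: enc st.2]) R0 _ => t1 R1.
  apply: wp_seq; apply: (@wp_mono _ _ _ _ (tf st.2) _ _ _ _ _ _ _ (fun _ => id)); last first.
    by apply: leq_trans (Hkf _) _; apply: leq_powl; apply: sz2.
  apply: (Hf st.2 md _ _ _ _ _ R1) => t2 R2.
  have le : size (hfin N st.2) * (3 * nlet S + 5) + 2 <= To x - 1.
    rewrite /To; have : size (hfin N st.2) <= (SB x + 2) ^ ks.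
      apply: leq_trans (ltnW (size_sz _)) _; apply: leq_trans (Hks _) _; apply: leq_powl; exact: sz2.
    by move: (_ ^ ks) => p; nia.
  rewrite (_ : To x = (To x - 1).+1); last by rewrite /To; lia.
  apply: wp_if; case E: (hfin N st.2) => [|a y].
    case: D => [|mt]; first by rewrite E.
    move: (R2); rewrite /trep E /= => R'; rewrite (stk_cons_scan (rep_m R')) /=.
    rewrite mt; apply: (@wp_mono _ _ _ _ 1 _ _ _ Q Q); [exact: wp_halt|by rewrite /To; lia|by []].
  move: (R2); rewrite /trep E /= => R'; rewrite (stk_cons_scan (rep_m R')) /=.
  have ne : hfin N st.2 != [::] by rewrite E.
  apply: (@wp_mono _ _ _ _ (size (hfin N st.2) * (3 * nlet S + 5) + 2) _ _ _ Q Q _ le (fun _ => id)).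
  apply: (wp_write_output _ R2) => // ts'; exact: H.
have init0 (x : seq Sigma) : trep [ffun i : 'I_6 => if i == ord0 then word_tape x else word_tape [::]] (word_tape x)
    (word_tape [::]) [::] [::].
  have sk : stk (word_tape [::] : tape (Sigma + bool)) [::] by exists 1.
  by rewrite /trep /=; split; rewrite ffunE.
have pre md x r (Q : tapes -> Prop) ts : trep ts (word_tape x) (word_tape [::]) [::] r ->
    (forall ts' ti', trep ts' ti' (word_tape [::]) [:: enc (hinit f x).1; enc (hinit f x).2] r ->
       wpc md (Seq (loop_cmd C) (Seq (pop_cell _ mtape) (Seq cf (If mtape (is_top true) (write_output S) (Halt _ _)))))
         (Tl x + (1 + (Tf x + To x))) ts' Q) ->
    wpc md prog (TT x) ts Q.
  move=> R0 H; apply: wp_seq; apply: (wp_read_input _ R0) => t1 ti1 R1.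
  apply: wp_seq; apply: (Hi x md _ _ _ _ _ R1) => t2 R2.
  apply: wp_seq; apply: (@runs_uncons Sigma (enc (hinit f x).1) (enc (hinit f x).2) [::]) R2 _ => t3.
  exact: H.
have all x : wpc true prog (TT x) [ffun i : 'I_6 => if i == ord0 then word_tape x else word_tape [::]]
    (fun ts => exists2 y, tape_holds (ts otape) y & problem x y).
  apply: pre (init0 x) _ => t1 ti1 R1; apply: wp_seq.
  apply: (wp_loop_all HA (HT x) (must_hinit x) (hinit_hinv f x) (leqnn _) R1) => m st' t2 re e hi R2.
  apply: (tail _ x st' _ _ _ _ R2) => //; first by right.
  move=> ts' nf th; exists (rev (hfin N st'.2)) => //; apply: final_sound re e _ nf; by case: hi.
have some (v : args f) m w : (forall i, value (v i)) ->
    reach RS m ([:: (Some f, Var 0)], [seq v i | i <- enum 'I_(arity f)]) ([::], [:: w]) ->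
    value w -> accepting N w ->
    wpc false prog (TT (args_word v)) [ffun i : 'I_6 => if i == ord0 then word_tape (args_word v) else word_tape [::]]
      (fun _ => True).
  move=> vv re vw ac; set x := args_word v; apply: pre (init0 x) _ => t1 ti1 R1; apply: wp_seq.
  have [[_ /(_ v vv)] //|[v' [vv' xe he]]] := hinit_spec f x.
  have ve : v' = v by apply: args_word_inj => //; rewrite -xe.
  (* The given run is one of those bounded by [must_hinit], so it fits into the time and space
     reserved for all runs. *)
  rewrite ve in he; rewrite -he in re; have [mk _] := must_reach RSsub (must_hinit x) re.
  apply: (@wp_mono _ _ _ _ (m * (TB x + 4) + 1) _ _ _ _ _ _ _ (fun _ => id)); last first.
    by rewrite /Tl leq_add2r leq_mul2r mk orbT.
  apply: (wp_loop_some HS (HT x) re (hinit_hinv f x) _ R1).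
    by rewrite /Nm leq_add2l leq_mul2r mk orbT.
  move=> st' t2 e hi R2; apply: (tail _ x st' _ _ _ _ R2) => //.
  by left; apply: final_complete e _ vw ac; case: hi.
have pTT : pb (fun x : seq Sigma => sz x) TT.
  have P0 : pb (fun x : seq Sigma => sz x) s0 := psi.
  have Ps : pb (fun x : seq Sigma => sz x) (fun x => size x).
    by apply: pb_le (pb_mu _) => x; exact: ltnW (size_sz _).
  have PK : pb (fun x : seq Sigma => sz x) Kruns by rewrite /Kruns; pbs.
  have PN : pb (fun x : seq Sigma => sz x) Nm by rewrite /Nm; pbs.
  have PS : pb (fun x : seq Sigma => sz x) SB by exact: pb_state_bound PN P0.
  by rewrite /TT /Tl /TB /Tf /To /read_time; pbs.
exists (cmd_machine prog); split.
- have [k Hk] := pTT; exists ((2 * nlet S + 4) ^ k), k => x n c ms.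
  have [le _] := wp_all_steps (all x) ms; apply: leq_trans le _; apply: leq_trans (Hk x) _.
  have szx : sz x <= size x * (2 * nlet S).+1 + 1 by apply: sz_le; apply/allP => a _; exact: sz_letter.
  (* An encoded letter has size at most [2 * nlet S], so [sz x + 2] is linear in the length; [maxn]
     covers the empty word. *)
  apply: (@leq_trans (((2 * nlet S + 4) * maxn (size x) 1) ^ k)).
    case: (k) => // k'; rewrite leq_exp2r //.
    have ar p q : p <= q * (2 * nlet S).+1 + 1 -> p + 2 <= (2 * nlet S + 4) * maxn q 1.
      by case: q => [|q]; rewrite ?max0n ?maxnE ?subn1 /=; nia.
    exact: ar szx.
  rewrite expnMn -[X in _ <= _ + X]muln1 -mulnDr leq_mul2l; apply/orP; right.
  case: (size x) => [|n']; first by rewrite max0n exp1n; lia.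
  by rewrite (maxn_idPl _) // leq_addr.
- move=> s1; apply: cmd_machine_deterministic; rewrite /prog /= nci ncf ncC //=.
  have rl ls : nochoice (read_letter (S := S) ls) by elim: ls => //= a ls ->; rewrite nochoice_push_tree.
  have wl ls : nochoice (write_letter (S := S) ls) by elim: ls => //= a ls ->.
  by rewrite rl wl.
- move=> x c [[n ms] _ e]; have [_ /(_ e)[y th p]] := wp_all_steps (all x) ms.
  by exists y => //; rewrite (_ : ord_max = otape) //; apply: val_inj.
- move=> v m w vv re vw ac; have [n [ts' [ms _]]] := wp_some_steps (some v m w vv re vw ac).
  by exists (None, ts'); split=> //; exists n.
Qed.

End Main.

(** * Uniqueness of normal forms under confluence *)

Section UniqueNormalForms.

Variables (S : signature) (R : trs S).

Lemma istep_rstep s t : istep R s t -> rstep R s t.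
Proof.
elim=> {s t} [l r sigma f a lr <- _|f a b i _ IH e]; first exact: rstep_root.
exact: rstep_arg IH e.
Qed.

Lemma istep_star_rstep s t : clos_refl_trans _ (istep R) s t -> clos_refl_trans _ (rstep R) s t.
Proof.
elim=> {s t} [s t /istep_rstep|s|s t u _ IH1 _ IH2]; [exact: rt_step|exact: rt_refl|].
exact: rt_trans IH1 IH2.
Qed.

Lemma nf_star s t : clos_refl_trans _ (rstep R) s t -> normal_form R s -> t = s.
Proof.
elim=> {s t} [s t st /(_ t)[]|//|s t u _ IH1 _ IH2 ns] //.
by have e := IH1 ns; rewrite -e; apply: IH2; rewrite e.
Qed.

Lemma confluent_nf s t u : confluent R ->
  clos_refl_trans _ (istep R) s t -> clos_refl_trans _ (istep R) s u ->
  normal_form R t -> normal_form R u -> t = u.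
Proof.
move=> cR /istep_star_rstep st /istep_star_rstep su nt nu.
by have [v /nf_star<- // /nf_star<-] := cR _ _ _ st su.
Qed.

End UniqueNormalForms.

Theorem theorem7p1 (S : signature) (N : seq (term S)) (R : trs S)
  (hR : predicative_recursive R) (f : symbol S) (hf : defined f) :
  FNP (word_relation (sem N R (f := f))) /\
  (confluent R -> FP (word_relation (sem N R (f := f)))).
Proof.
have [hc [sf [ge [hsf hge had hpop]]]] := hR.
have hvars l r (lr : (l, r) \in R) : {subset vars r <= vars l} by exact: pop_vars (hpop l r lr).
have [c0 Hc0] := runtime_bound hc hsf hge had hpop.
split.
  (* One list for each guess of the rule to be tried first; [R] itself keeps [RS] non-empty when
     there are no rules. *)
  pose RS := R :: [seq q :: R | q <- R].
  have sub rs : rs \in RS -> {subset rs <= R}.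
    rewrite inE => /orP[/eqP-> //|/mapP[q qR ->] z]; by rewrite inE => /orP[/eqP->|].
  have sup rs : rs \in RS -> {subset R <= rs}.
    by rewrite inE => /orP[/eqP-> //|/mapP[q qR ->] z zR]; rewrite inE zR orbT.
  have all l r : (l, r) \in R -> (l, r) :: R \in RS.
    by move=> lr; rewrite inE; apply/orP; right; apply/mapP; exists (l, r).
  have [M [pM _ so co]] := @machine_exists S N R f RS hc hvars sub sup isT c0 Hc0.
  exists M; split=> // x; split=> [c|[y [v [w [-> _ [vv vw st nw ac]]]]]]; first exact: so.
  have [||n re] := @ev_mreach_call S R RS hc hvars sub isT all f v w [::] [::].
  - exact: ev_complete.
  - by move=> i; apply: value_nf.
  by rewrite cats0 in re; apply: co re vw ac.
move=> cR; split.
  move=> x y y' [v [w [-> -> [vv vw st nw _]]]] [v' [w' [e -> [vv' _ st' nw' _]]]].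
  have ev : v = v' by apply: args_word_inj.
  by subst v'; rewrite (confluent_nf cR st st' nw nw').
have sub rs : rs \in [:: R] -> {subset rs <= R} by rewrite inE => /eqP->.
have sup rs : rs \in [:: R] -> {subset R <= rs} by rewrite inE => /eqP->.
have [M [pM dM so co]] := @machine_exists S N R f [:: R] hc hvars sub sup isT c0 Hc0.
exists M; split=> //; first exact: dM.
move=> x; split=> [c|[y [v [w [-> _ [vv vw st nw ac]]]]]]; first exact: so.
have dv i : depth (v i) <= \max_j depth (v j) by exact: leq_bigmax.
(* The deterministic machine stops with some normal form [w'] of the call, and confluence identifies
   it with the given [w]. *)
have mu := Hc0 f v _ dv [::] (Var 0); rewrite cats0 in mu.
have [n [vs re]] := must_run sub (mem_head R [::]) mu.
have [w' [e st' nw']] := call_sound hc hvars sub sup vv re.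
by rewrite e -(confluent_nf cR st st' nw nw') in re; apply: co re vw ac.
Qed.
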